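(* Let $E$ be a closed subset of the unit sphere $S$ of $\mathbb C^n$, $\upsilon\ge\Upsilon(E)$, $\lambda\le\Lambda(E)$, $\mu\in U_\upsilon(E)\cap L_\lambda(E)$. Let $\alpha>0$ with $2\alpha\notin\mathbb N$, let $f=\{f_j\}_{\omega(j)\le\alpha}\in A_\alpha(E)$, and let $q>\alpha+\upsilon$. Assume there is $C>0$ with $$|h_q(z)|\ge C\,d(z,E)^{-q}\mu(B_z)\qquad\text{for all } z\in\overline{B^n}\setminus E.$$ Let $\mathbb X$ be a differential operator. If $\omega(\mathbb X)<\alpha$, then for $z\in\overline{B^n}\setminus E$, $$|\mathbb X\mathcal E(f)(z)-\mathcal E(\mathbb X(f)(\cdot))(z)|\le C(\mathbb X)\,\|f\|_\alpha\, d(z,E)^{\alpha-\omega(\mathbb X)},$$ where $\mathcal E(\mathbb X(f)(\cdot))(z)=\frac1{h_q(z)}\int_E\frac{\mathbb X(T^\alpha_\zeta f)(z)}{(1-z\overline\zeta)^q}\,d\mu(\zeta)$. Furthermore, if $\omega(\mathbb X)>\alpha$, then for $z\in\overline{B^n}\setminus E$, $$|\mathbb X\mathcal E(f)(z)|\le C(\mathbb X)\,\|f\|_\alpha\, d(z,E)^{\alpha-\omega(\mathbb X)},$$ and in particular $\mathcal E(f)\in A_\alpha(B^n)$.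
   Context: $B^n$ is the unit ball of $\mathbb C^n$, $S=\partial B^n$, $z\overline w=\sum_jz_j\overline{w_j}$, and $d(z,w)=|1-z\overline w|$ for $z,w\in\overline{B^n}$ ($d$ is a pseudo-metric on $S$; $d^{1/2}$ is a metric there). Balls, $d(z,E)=\inf_{w\in E}d(z,w)$, and dimensions are with respect to $d$. For $z\notin E$, $z_0\in E$ is a point with $d(z,z_0)=d(z,E)$ and $B_z=B(z_0,3d(z,E))$. Dimensions: $N(x,R,k)$ is the maximum number of points of $E$ in $B(x,kR)$ separated by distance $\ge R$. $\Upsilon(E)$ is the infimum of the $\gamma$ for which there is $C$ with $N(x,R,k)\le Ck^\gamma$ for all $x\in E$, $0<R<kR\le1$; $\Lambda(E)$ is the supremum of the $\gamma$ for which there is $C>0$ with $N(x,R,k)\ge Ck^\gamma$ for all such $x,R,k$. A probability measure $\mu$ on $E$ is in $U_\gamma(E)$ if $\mu(B(x,kR))\le Ck^\gamma\mu(B(x,R))$, and a doubling measure is in $L_\gamma(E)$ if $\mu(B(x,kR))\ge Ck^\gamma\mu(B(x,R))$ (for some $C>0$ and all such $x,R,k$). Weights: a vector field $X=\sum_ja_j\frac{\partial}{\partial z_j}+\overline{a_j}\frac{\partial}{\partial\overline z_j}$, $a_j\in C^\infty(\overline{B^n})$, has weight $\omega(X)=1/2$ if it is complex-tangential ($\sum a_j\overline{z_j}=0$) and $1$ otherwise; a differential operator is $\mathbb X=X_1\cdots X_r$ with $\omega(\mathbb X)=\sum_i\omega(X_i)$. For a multiindex $j\in\mathbb N^n$,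 $\omega(j)=j_n+\frac12(j_1+\dots+j_{n-1})$. Jets: for $\zeta\in S$, $w(z,\zeta)=(w_1,\dots,w_n)$ are affine holomorphic coordinates centred at $\zeta$, $w_n(\cdot,\zeta)$ being the normal coordinate ($w_n(z,\zeta)=(z-\zeta)\overline\zeta$) and $w_1,\dots,w_{n-1}$ coordinates on the complex tangent space $T^{\mathbb C}_\zeta(S)$ ($w_i(z,\zeta)=(z-\zeta)\overline{e_i(\zeta)}$ for an orthonormal basis $e_i(\zeta)$ of it, chosen locally smoothly in $\zeta$). $D^j$ at $\zeta$ is the $j$-th derivative with respect to these coordinates. A (non-isotropic) jet on $E$ is a collection of continuous functions $f=\{f_j\}_{\omega(j)\le\alpha}$; $T^\alpha_\zeta f(z)=\sum_{\omega(j)\le\alpha}\frac1{j!}f_j(\zeta)w(z,\zeta)^j$; $\Delta_j(\zeta,\xi)=f_j(\xi)-D^jT^\alpha_\zeta f(\xi)$. $A_\alpha(E)$ is the non-isotropic Lipschitz space of jets with $$\|f\|_\alpha=\sum_{\omega(j)\le\alpha}\Big(\|f_j\|_{\infty,E}+\sup_{\zeta,\xi\in E}\frac{|\Delta_j(\zeta,\xi)|}{d(\zeta,\xi)^{\alpha-\omega(j)}}\Big)<\infty,$$ and $A_\alpha(B^n)$ is the space of holomorphic functions on $B^n$ belonging to $C^\alpha(\overline{B^n})$ (Lipschitz class of order $\alpha$). Extension: $h_q(z)=\int_E(1-z\overline\zeta)^{-q}d\mu(\zeta)$ and $\mathcal E(f)(z)=\frac1{h_q(z)}\int_E\frac{T^\alpha_\zeta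 f(z)}{(1-z\overline\zeta)^q}d\mu(\zeta)$ (principal branch). $C(\mathbb X)$ denotes a constant independent of $f$ and $z$. *)

(* Defs.v *)
From HB Require Import structures.
From mathcomp Require Import all_boot all_order all_algebra.
From mathcomp Require Import all_classical all_reals all_analysis.
From mathcomp Require Import complex.

Set Implicit Arguments.
Unset Strict Implicit.
Unset Printing Implicit Defensive.

Import Order.TTheory GRing.Theory Num.Theory numFieldNormedType.Exports.

Local Open Scope classical_set_scope.
Local Open Scope ring_scope.

(* The field R[i], seen as a numClosedFieldType: this gives it the topology and
   the normed module structure of a numeric field.  Cn R n is the space of
   complex dimension n.+1; in multiindices and frames ord_max is the index of
   the normal coordinate. *)
Definition Cplx (R : realType) : numClosedFieldType := R[i].
Definition Cn (R : realType) (n : nat) : normedModType (Cplx R) :=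
  'rV[Cplx R]_n.+1.
Notation borelCn R n := (g_sigma_algebraType (@open (Cn R n))).

Section Complex.
Context {R : realType}.
Implicit Types (x : Cplx R) (s : R).

Definition mkC (a b : R) : Cplx R := Complex a b.
Definition cRe x : R := complex.Re (x : R[i]).
Definition cIm x : R := complex.Im (x : R[i]).
Definition cabs x : R := ComplexField.Normc.normc (x : R[i]).

(* Principal argument, in ]-pi, pi], for x != 0. *)
Definition carg x : R :=
  if 0 <= cIm x then acos (cRe x / cabs x) else - acos (cRe x / cabs x).

(* Principal branch of x to the real power s. *)
Definition cpow x s : Cplx R :=
  mkC (cabs x `^ s * cos (s * carg x)) (cabs x `^ s * sin (s * carg x)).

Definition cintegral d (T : measurableType d)
    (mu : {measure set T -> \bar R}) (A : set T) (F : T -> Cplx R) : Cplx R :=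
  mkC (\int[mu]_(t in A) cRe (F t)) (\int[mu]_(t in A) cIm (F t)).

End Complex.

Section Geometry.
Context {R : realType} {n : nat}.
Local Notation C := (Cplx R).
Local Notation V := (Cn R n).
Implicit Types (z w x : V) (E : set V) (r k gamma : R).

Definition hdot z w : C := \sum_(j < n.+1) z 0 j * (w 0 j)^*.
Definition enorm z : R := Num.sqrt (\sum_(j < n.+1) cabs (z 0 j) ^+ 2).

Definition oball : set V := [set z | enorm z < 1].
Definition cball : set V := [set z | enorm z <= 1].
Definition sphere : set V := [set z | enorm z = 1].

Definition dist z w : R := cabs (1 - hdot z w).
Definition dball x r : set V := [set w | cball w /\ dist x w < r].
Definition dist_set z E : R := inf [set dist z w | w in E].

Definition separated r (s : seq V) : Prop :=
  uniq s /\ {in s &, forall u v, u != v -> r <= dist u v}.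

(* N(x, r, k) *)
Definition packing E x r k : \bar R :=
  ereal_sup [set ((size s)%:R)%:E | s in
    [set s : seq V | separated r s /\ {in s, forall u, E u /\ dball x (k * r) u}]].

Definition upper_dim E : \bar R :=
  ereal_inf [set gamma%:E | gamma in [set gamma : R | exists c : R,
    forall x r k, E x -> 0 < r -> r < k * r -> k * r <= 1 ->
      (packing E x r k <= (c * k `^ gamma)%:E)%E]].

Definition lower_dim E : \bar R :=
  ereal_sup [set gamma%:E | gamma in [set gamma : R | exists2 c : R, 0 < c &
    forall x r k, E x -> 0 < r -> r < k * r -> k * r <= 1 ->
      ((c * k `^ gamma)%:E <= packing E x r k)%E]].

Definition upper_class gamma E (mu : probability (borelCn R n) R) : Prop :=
  mu E = 1%E /\
  exists2 c : R, 0 < c &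
    forall x r k, E x -> 0 < r -> r < k * r -> k * r <= 1 ->
      (mu (dball x (k * r)) <= (c * k `^ gamma)%:E * mu (dball x r))%E.

(* All radii are allowed here: as dist x is bounded on E, every ball centred on
   E then has positive measure, i.e. the support of mu is all of E. *)
Definition doubling E (mu : probability (borelCn R n) R) : Prop :=
  mu E = 1%E /\
  exists2 c : R, 0 < c & forall x r, E x -> 0 < r ->
    (mu (dball x (2 * r)) <= c%:E * mu (dball x r))%E.

Definition lower_class gamma E (mu : probability (borelCn R n) R) : Prop :=
  doubling E mu /\
  exists2 c : R, 0 < c &
    forall x r k, E x -> 0 < r -> r < k * r -> k * r <= 1 ->
      ((c * k `^ gamma)%:E * mu (dball x r) <= mu (dball x (k * r)))%E.

End Geometry.

Section RealCalculus.
Context {R : realType} {n : nat}.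
Local Notation C := (Cplx R).
Local Notation V := (Cn R n).
Implicit Types (v z : V) (F : V -> C) (U : set V).

(* Derivatives along real lines t |-> z + t v, as opposed to the library's
   'D_v, which on V is the complex one. *)
Definition line F v z (t : R) : C := F (z + mkC t 0 *: v).
Definition rderivable F v z : Prop :=
  derivable (cRe \o line F v z) 0 1 /\ derivable (cIm \o line F v z) 0 1.
Definition rderive v F z : C :=
  mkC ('D_1 (cRe \o line F v z) 0) ('D_1 (cIm \o line F v z) 0).
Definition rderives (s : seq V) F : V -> C := foldr rderive F s.

Definition Ck_on (k : nat) U F : Prop :=
  forall s z, (size s <= k)%N -> U z ->
    {for z, continuous (rderives s F)} /\
    ((size s < k)%N -> forall v, rderivable (rderives s F) v z).
Definition smooth_on U F : Prop := forall k, Ck_on k U F.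

Definition ebase (j : 'I_n.+1) : V := delta_mx 0 j.
Definition d_dz (j : 'I_n.+1) F z : C :=
  (rderive (ebase j) F z - 'i * rderive ('i *: ebase j) F z) / 2.
Definition d_dzbar (j : 'I_n.+1) F z : C :=
  (rderive (ebase j) F z + 'i * rderive ('i *: ebase j) F z) / 2.

(* Coefficients are smooth on some open neighbourhood of the closed ball; on
   the closed ball these are exactly the functions smooth up to the boundary. *)
Record vfield := VField {
  vcoef :> V -> V ;
  vcoef_smooth : exists U : set V, [/\ open U, cball `<=` U &
    forall j : 'I_n.+1, smooth_on U (fun z => vcoef z 0 j)] }.

Definition vapply (X : vfield) F z : C :=
  \sum_(j < n.+1) (X z 0 j * d_dz j F z + (X z 0 j)^* * d_dzbar j F z).

Definition complex_tangential (X : vfield) : Prop :=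
  forall z, cball z -> hdot (X z) z = 0.
Definition vweight (X : vfield) : R :=
  if `[< complex_tangential X >] then 2^-1 else 1.

(* [:: X1; ...; Xr] stands for the operator X1 ... Xr. *)
Definition opapply (XX : seq vfield) F : V -> C := foldr vapply F XX.
Definition opweight (XX : seq vfield) : R := \sum_(X <- XX) vweight X.

(* Lipschitz class of non-integer order alpha on the closed ball, through the
   restriction to the open ball: derivatives of order less than alpha then
   extend continuously to the boundary. *)
Definition lipschitz_ball (alpha : R) F : Prop :=
  exists k : nat, [/\ k%:R < alpha < k.+1%:R,
    Ck_on k oball F,
    forall s, (size s <= k)%N -> exists M : R, forall z, oball z ->
      cabs (rderives s F z) <= M &
    forall s, size s = k -> exists M : R, forall z w, oball z -> oball w ->
      cabs (rderives s F z - rderives s F w)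
        <= M * enorm (z - w) `^ (alpha - k%:R)].

Definition A_ball (alpha : R) F : Prop :=
  (forall z, oball z -> differentiable F z) /\ lipschitz_ball alpha F.

End RealCalculus.
Arguments vfield : clear implicits.

Section Jets.
Context {R : realType} {n : nat}.
Local Notation C := (Cplx R).
Local Notation V := (Cn R n).
Definition multiindex := {ffun 'I_n.+1 -> nat}.
Implicit Types (j : multiindex) (E : set V) (zeta xi z : V).

Definition omega j : R :=
  (j ord_max)%:R + (\sum_(i < n.+1 | i != ord_max) (j i)%:R) / 2.
Definition mfact j : nat := \prod_(i < n.+1) (j i)`!.

(* Row i of e zeta is the i-th vector of the basis of the complex tangent space
   {v | hdot v zeta = 0} at zeta. *)
Definition tangent_frame E (e : V -> 'M[C]_(n, n.+1)) : Prop :=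
  (forall zeta, E zeta ->
    (forall i, hdot (row i (e zeta)) zeta = 0) /\
    (forall i i', hdot (row i (e zeta)) (row i' (e zeta)) = (i == i')%:R)) /\
  (forall zeta, E zeta -> exists U : set V, [/\ open U, U zeta &
    forall i l, smooth_on U (fun z => e z i l)]).

Variables (e : V -> 'M[C]_(n, n.+1)) (alpha : R).

Definition fvec zeta (i : 'I_n.+1) : V :=
  if unlift ord_max i is Some i' then row i' (e zeta) else zeta.
Definition wcoord zeta z (i : 'I_n.+1) : C := hdot (z - zeta) (fvec zeta i).

(* As z = zeta + \sum_i wcoord zeta z i *: fvec zeta i, the derivative with
   respect to the i-th coordinate is the complex directional derivative along
   fvec zeta i. *)
Definition Djet j zeta (g : V -> C) : V -> C :=
  foldr (fun i h => iter (j i) (fun h' z => 'D_(fvec zeta i) h' z) h)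
    g (enum 'I_n.+1).

Variable f : multiindex -> V -> C.

Definition taylor zeta z : C :=
  \sum_(j \in [set j | omega j <= alpha])
    (mfact j)%:R^-1 * f j zeta * \prod_(i < n.+1) wcoord zeta z i ^+ j i.

Definition jet_diff j zeta xi : C := f j xi - Djet j xi (taylor zeta) xi.

(* The term zeta = xi contributes 0 / 0 = 0 to the second supremum. *)
Definition jet_norm E : \bar R :=
  (\sum_(j \in [set j | (omega j <= alpha)%R])
    (ereal_sup [set (cabs (f j zeta))%:E | zeta in E] +
     ereal_sup [set (cabs (jet_diff j p.1 p.2)
                      / dist p.1 p.2 `^ (alpha - omega j))%:E
               | p in E `*` E]))%E.

Definition A_jet E : Prop :=
  (forall j, omega j <= alpha -> {within E, continuous (f j)}) /\
  (jet_norm E < +oo)%E.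

End Jets.
Arguments multiindex : clear implicits.

Section Extension.
Context {R : realType} {n : nat}.
Local Notation C := (Cplx R).
Local Notation V := (Cn R n).
Variables (E : set V) (mu : probability (borelCn R n) R) (q : R).

Definition hq (z : V) : C :=
  cintegral mu E (fun zeta => cpow (1 - hdot z zeta) (- q)).

(* Weighted average over zeta of the values G zeta z; E(f) and E(X(f)(.)) are
   both instances of it. *)
Definition average (G : V -> V -> C) (z : V) : C :=
  (hq z)^-1 *
  cintegral mu E (fun zeta => G zeta z / cpow (1 - hdot z zeta) q).

Definition extension e alpha f : V -> C := average (taylor e alpha f).
Definition extension_op e alpha f (XX : seq (vfield R n)) : V -> C :=
  average (fun zeta => opapply XX (taylor e alpha f zeta)).

End Extension.

(* Main.v *)
Require Import Defs.
From HB Require Import structures.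
From mathcomp Require Import all_boot all_order all_algebra.
From mathcomp Require Import all_classical all_reals all_analysis.
From mathcomp Require Import measurable_realfun complex ring lra.
Set Implicit Arguments.
Unset Strict Implicit.
Unset Printing Implicit Defensive.
Import Order.TTheory GRing.Theory Num.Theory numFieldNormedType.Exports.
Local Open Scope classical_set_scope.
Local Open Scope ring_scope.

(* Fix z off E, let z0 be its nearest point in E and delta = d(z, z0), and write
   K = 1 - z.zeta^*.  Then E(f) = T_{z0} f + R / h_q near z, where
     R(w) = int_E (T_zeta f - T_{z0} f)(w) K^(-q) dmu(zeta).
   Expanding T_{z0} f at zeta, T_zeta f - T_{z0} f is a sum of the monomials
   w(z, zeta)^j with coefficients Delta_j(z0, zeta) / j!; since
   d(z0, zeta) <= 6 d(z, zeta) and w^j = O(d(z, zeta)^omega(j)), it is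
   O(||f|| d(z, zeta)^alpha), and a derivative of weight omega costs
   d(z, zeta)^(-omega), because a tangential field maps K to O(|K|^(1/2)).
   The same holds for K^(-q), and int_E d(z, zeta)^(-s) dmu is bounded by
   delta^(-s) mu(B_z) for s > upsilon, so the lower bound on h_q makes the
   derivatives of R / h_q of weight omega O(||f|| delta^(alpha - omega)).
   As the derivatives of T_{z0} f are bounded, both estimates follow.  Finally
   delta >= 1 - |z|, and E(f) is holomorphic because T_zeta f and K are, so that
   the Lipschitz bound is the Hardy-Littlewood lemma. *)

(** * Complex numbers and the geometry of the ball *)

(** Complex tangent spaces turn with the point, so the monomials of T_{z0} f, recentred at zeta,
    also produce w(z, zeta)^j with omega(j) > alpha. Their coefficients -D^j T_{z0} f(zeta) / j! are
    merely bounded, which suffices since w^j alone is then O(d(z, zeta)^alpha). Products of any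
    number of fields are to be estimated, while the tangential gain concerns one derivative of K. It
    propagates because every weight is at least 1/2: after one field, or for a tangential
    coordinate, the order is at most 1/2, so any further derivative needs only to be bounded. The
    nearest point z0 need not depend continuously on z. It is therefore frozen: f, z0 and zeta are
    parameters of the families that are differentiated, and the same device makes the constants
    independent of them. Finally z may lie on the sphere; there Re K >= d(z, zeta)^2 / 2 bounds Re K
    below uniformly in zeta, hence on a full neighbourhood of z, where the principal branch is
    smooth. *)

Section ComplexBasics.
Context {R : realType}.
Local Notation C := (Cplx R).
Implicit Types (x y : C) (a b r : R).

Lemma cRe_mkC a b : cRe (mkC a b) = a. Proof. by []. Qed.
Lemma cIm_mkC a b : cIm (mkC a b) = b. Proof. by []. Qed.

Lemma cext x y : cRe x = cRe y -> cIm x = cIm y -> x = y.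
Proof. by case: x => a b; case: y => c d; rewrite /cRe /cIm /= => -> ->. Qed.

Lemma mkC0_inj a b : mkC a 0 = mkC b 0 -> a = b.
Proof. by case. Qed.

Lemma mkC00 : mkC 0 0 = 0 :> C. Proof. by []. Qed.
Lemma mkC10 : mkC 1 0 = 1 :> C. Proof. by []. Qed.

Lemma cReD x y : cRe (x + y) = cRe x + cRe y.
Proof. by case: x => a b; case: y. Qed.
Lemma cImD x y : cIm (x + y) = cIm x + cIm y.
Proof. by case: x => a b; case: y. Qed.
Lemma cReN x : cRe (- x) = - cRe x. Proof. by case: x. Qed.
Lemma cImN x : cIm (- x) = - cIm x. Proof. by case: x. Qed.
Lemma cReB x y : cRe (x - y) = cRe x - cRe y.
Proof. by rewrite cReD cReN. Qed.
Lemma cImB x y : cIm (x - y) = cIm x - cIm y.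
Proof. by rewrite cImD cImN. Qed.
Lemma cRe0 : cRe (0 : C) = 0. Proof. by []. Qed.
Lemma cIm0 : cIm (0 : C) = 0. Proof. by []. Qed.
Lemma cRe1 : cRe (1 : C) = 1. Proof. by []. Qed.
Lemma cIm1 : cIm (1 : C) = 0. Proof. by []. Qed.
Lemma cReM x y : cRe (x * y) = cRe x * cRe y - cIm x * cIm y.
Proof. by case: x => a b; case: y. Qed.
Lemma cImM x y : cIm (x * y) = cRe x * cIm y + cIm x * cRe y.
Proof. by case: x => a b; case: y. Qed.
Lemma cRe_conj x : cRe x^* = cRe x. Proof. by case: x. Qed.
Lemma cIm_conj x : cIm x^* = - cIm x. Proof. by case: x. Qed.
Lemma cRe_i : cRe ('i : C) = 0. Proof. by []. Qed.
Lemma cIm_i : cIm ('i : C) = 1. Proof. by []. Qed.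
Lemma cRe_nat k : cRe (k%:R : C) = k%:R.
Proof. by elim: k => // k IH; rewrite -addn1 !natrD cReD IH. Qed.
Lemma cIm_nat k : cIm (k%:R : C) = 0.
Proof. by elim: k => // k IH; rewrite -addn1 !natrD cImD IH addr0. Qed.

Definition cE := (cRe_mkC, cIm_mkC, cReD, cImD, cReN, cImN, cReM, cImM, cRe0,
  cIm0, cRe1, cIm1, cRe_conj, cIm_conj, cRe_i, cIm_i, cRe_nat, cIm_nat).

Lemma cabsE x : cabs x = Num.sqrt (cRe x ^+ 2 + cIm x ^+ 2).
Proof. by case: x. Qed.
Lemma normCE x : `|x| = mkC (cabs x) 0. Proof. by case: x. Qed.

Lemma ltC_mkC a b : (mkC a 0 < mkC b 0) = (a < b).
Proof. by rewrite ltcE /= eqxx. Qed.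
Lemma mkC_gt0 a : (0 < mkC a 0) = (0 < a).
Proof. exact: (ltC_mkC 0 a). Qed.
Lemma leC_mkC a b : (mkC a 0 <= mkC b 0) = (a <= b).
Proof. by rewrite lecE /= eqxx. Qed.

Lemma cabs_ge0 x : 0 <= cabs x. Proof. by rewrite cabsE sqrtr_ge0. Qed.
Lemma cabs0 : cabs (0 : C) = 0. Proof. exact: ComplexField.Normc.normc0. Qed.
Lemma cabs1 : cabs (1 : C) = 1. Proof. exact: ComplexField.Normc.normc1. Qed.
Lemma cabsM x y : cabs (x * y) = cabs x * cabs y.
Proof. exact: ComplexField.Normc.normcM. Qed.
Lemma cabsV x : cabs x^-1 = (cabs x)^-1.
Proof. exact: ComplexField.Normc.normcV. Qed.
Lemma cabsN x : cabs (- x) = cabs x.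
Proof. by rewrite !cabsE !cE !sqrrN. Qed.
Lemma cabsJ x : cabs x^* = cabs x.
Proof. by rewrite !cabsE !cE !sqrrN. Qed.
Lemma ler_cabsD x y : cabs (x + y) <= cabs x + cabs y.
Proof. by rewrite -leC_mkC -!normCE (_ : mkC _ 0 = `|x| + `|y|) ?ler_normD// !normCE; apply: cext; rewrite !cE ?addr0. Qed.
Lemma cabs_eq0 x : (cabs x == 0) = (x == 0).
Proof.
apply/eqP/eqP => [/ComplexField.Normc.eq0_normc//|->]; exact: cabs0.
Qed.
Lemma cabs_gt0 x : (0 < cabs x) = (x != 0).
Proof. by rewrite lt0r cabs_eq0 cabs_ge0 andbT. Qed.
Lemma cabs_distC x y : cabs (x - y) = cabs (y - x).
Proof. by rewrite -cabsN opprB. Qed.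
Lemma cabs_sqr x : cabs x ^+ 2 = cRe x ^+ 2 + cIm x ^+ 2.
Proof. by rewrite cabsE sqr_sqrtr// addr_ge0// sqr_ge0. Qed.
Lemma cabs_mkC a : cabs (mkC a 0) = `|a|.
Proof. by rewrite cabsE !cE expr0n addr0 sqrtr_sqr. Qed.
Lemma cabs_nat k : cabs (k%:R : C) = k%:R.
Proof. by rewrite cabsE !cE expr0n/= addr0 sqrtr_sqr ger0_norm. Qed.

Lemma mkC0M (a b : R) : mkC a 0 * mkC b 0 = mkC (a * b) 0 :> C.
Proof. by apply: cext; rewrite !cE; ring. Qed.

Lemma cRe_le x : `|cRe x| <= cabs x.
Proof. by rewrite cabsE -sqrtr_sqr ler_wsqrtr// lerDl sqr_ge0. Qed.
Lemma cIm_le x : `|cIm x| <= cabs x.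
Proof. by rewrite cabsE -sqrtr_sqr ler_wsqrtr// lerDr sqr_ge0. Qed.
Lemma cabs_le x : cabs x <= `|cRe x| + `|cIm x|.
Proof.
rewrite cabsE -[leRHS]ger0_norm ?addr_ge0// -sqrtr_sqr ler_wsqrtr//.
rewrite sqrrD -(real_normK (num_real (cRe x))) -(real_normK (num_real (cIm x))).
by rewrite addrAC lerDl mulrn_wge0// mulr_ge0.
Qed.
Lemma cRe_normle x : cRe x <= cabs x.
Proof. exact: le_trans (ler_norm _) (cRe_le x). Qed.

Lemma ler_cabs_sum (I : Type) (s : seq I) (P : pred I) (F : I -> C) :
  cabs (\sum_(i <- s | P i) F i) <= \sum_(i <- s | P i) cabs (F i).
Proof.
elim/big_ind2: _ => [|x u y v xu yv|//]; first by rewrite cabs0.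
exact: le_trans (ler_cabsD _ _) (lerD xu yv).
Qed.

Lemma cRe_sum (I : Type) (s : seq I) (P : pred I) (F : I -> C) :
  cRe (\sum_(i <- s | P i) F i) = \sum_(i <- s | P i) cRe (F i).
Proof. by apply: big_morph => [x y|//]; rewrite cReD. Qed.
Lemma cIm_sum (I : Type) (s : seq I) (P : pred I) (F : I -> C) :
  cIm (\sum_(i <- s | P i) F i) = \sum_(i <- s | P i) cIm (F i).
Proof. by apply: big_morph => [x y|//]; rewrite cImD. Qed.

(** Positive elements of the complex field are real; this turns the radii and epsilons of the
    topology on [Cplx R], which are complex, into elements of [R]. *)
Lemma gtC0P (e : C) : 0 < e -> exists2 r : R, 0 < r & e = mkC r 0.
Proof.
case: e => a b; rewrite ltcE /= => /andP[/eqP -> a0]; by exists a.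
Qed.
Lemma cvg_cabsP {T : Type} (F : set_system T) {FF : Filter F} (f : T -> C) (l : C) :
  (forall e : R, 0 < e -> \forall t \near F, cabs (f t - l) < e) <->
  f @ F --> l.
Proof.
split=> [h|/cvgrPdist_lt h e e0].
  apply/cvgrPdist_lt => _ /gtC0P[r r0 ->].
  apply: filterS (h _ r0) => t; by rewrite normCE ltC_mkC cabs_distC.
have e0' : (0 : C) < mkC e 0 by rewrite mkC_gt0.
apply: filterS (h _ e0') => t; by rewrite normCE ltC_mkC cabs_distC.
Qed.

Lemma cvg_cReIm {T : Type} (F : set_system T) {FF : Filter F} (f : T -> C) (l : C) :
  (cRe (f t) @[t --> F] --> cRe l) -> (cIm (f t) @[t --> F] --> cIm l) ->
  f @ F --> l.
Proof.
move=> /cvgrPdist_lt hr /cvgrPdist_lt hi; apply/cvg_cabsP => e e0.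
have e2 : 0 < e / 2 by rewrite divr_gt0.
near=> t; apply: le_lt_trans (cabs_le _) _; rewrite [e]splitr ltrD//.
  by rewrite cReB distrC; near: t; apply: hr.
by rewrite cImB distrC; near: t; apply: hi.
Unshelve. all: by end_near. Qed.

Lemma cvg_cRe {T : Type} (F : set_system T) {FF : Filter F} (f : T -> C) (l : C) :
  f @ F --> l -> cRe (f t) @[t --> F] --> cRe l.
Proof.
move=> /cvg_cabsP h; apply/cvgrPdist_lt => e e0.
by apply: filterS (h e e0) => t; apply: le_lt_trans; rewrite distrC -cReB cRe_le.
Qed.
Lemma cvg_cIm {T : Type} (F : set_system T) {FF : Filter F} (f : T -> C) (l : C) :
  f @ F --> l -> cIm (f t) @[t --> F] --> cIm l.
Proof.
move=> /cvg_cabsP h; apply/cvgrPdist_lt => e e0.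
by apply: filterS (h e e0) => t; apply: le_lt_trans; rewrite distrC -cImB cIm_le.
Qed.

End ComplexBasics.

Section Geometry.
Context {R : realType} {n : nat}.
Local Notation C := (Cplx R).
Local Notation V := (Cn R n).
Implicit Types (z w v u : V).

Lemma hdotDl z w v : hdot (z + w) v = hdot z v + hdot w v.
Proof. by rewrite /hdot -big_split/=; apply: eq_bigr => j _; rewrite mxE mulrDl. Qed.
Lemma hdotZl (c : C) z v : hdot (c *: z) v = c * hdot z v.
Proof. by rewrite /hdot mulr_sumr; apply: eq_bigr => j _; rewrite mxE mulrA. Qed.
Lemma hdotC z w : hdot w z = (hdot z w)^*.
Proof.
rewrite /hdot raddf_sum; apply: eq_bigr => j _ /=.
by rewrite rmorphM/= conjCK mulrC.
Qed.
Lemma hdotDr z w v : hdot z (w + v) = hdot z w + hdot z v.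
Proof. by rewrite hdotC hdotDl raddfD/= -!hdotC. Qed.
Lemma hdotZr (c : C) z v : hdot z (c *: v) = c^* * hdot z v.
Proof. by rewrite hdotC hdotZl rmorphM/= -hdotC. Qed.
Lemma hdotNl z w : hdot (- z) w = - hdot z w.
Proof. by rewrite -scaleN1r hdotZl mulN1r. Qed.
Lemma hdotBl z w v : hdot (z - w) v = hdot z v - hdot w v.
Proof. by rewrite hdotDl hdotNl. Qed.
Lemma hdotBr z w v : hdot v (z - w) = hdot v z - hdot v w.
Proof. by rewrite hdotC hdotBl raddfB/= -!hdotC. Qed.
Lemma hdot0l z : hdot 0 z = 0.
Proof. by rewrite -(scale0r (0 : V)) hdotZl mul0r. Qed.
Lemma hdot_suml (I : Type) (s : seq I) (P : pred I) (F : I -> V) z :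
  hdot (\sum_(i <- s | P i) F i) z = \sum_(i <- s | P i) hdot (F i) z.
Proof. by apply: (big_morph (hdot^~ z)) => [x y|]; rewrite ?hdotDl ?hdot0l. Qed.

Lemma enorm_ge0 z : 0 <= enorm z. Proof. exact: sqrtr_ge0. Qed.
Lemma enorm_sqr z : enorm z ^+ 2 = \sum_(j < n.+1) cabs (z 0 j) ^+ 2.
Proof. by rewrite sqr_sqrtr// sumr_ge0// => j _; rewrite sqr_ge0. Qed.
Lemma hdotzz z : hdot z z = mkC (enorm z ^+ 2) 0.
Proof.
rewrite enorm_sqr; apply: cext; rewrite ?cRe_sum ?cIm_sum !cE.
  by apply: eq_bigr => j _; rewrite !cE cabs_sqr; ring.
by rewrite big1// => j _; rewrite !cE; ring.
Qed.
Lemma cabs_coord_le z j : cabs (z 0 j) <= enorm z.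
Proof.
rewrite -(ger0_norm (cabs_ge0 _)) -sqrtr_sqr ler_wsqrtr// (bigD1 j)//= lerDl.
by rewrite sumr_ge0// => i _; rewrite sqr_ge0.
Qed.
Lemma enorm_eq0 z : enorm z = 0 -> z = 0.
Proof.
move=> z0; apply/rowP => j; apply/eqP; rewrite mxE -cabs_eq0 eq_le cabs_ge0 andbT.
by rewrite -z0 cabs_coord_le.
Qed.
Lemma enorm0 : enorm (0 : V) = 0.
Proof.
rewrite /enorm big1 ?sqrtr0// => j _.
by rewrite mxE cabs0 expr0n.
Qed.
Lemma enormZ (c : C) z : enorm (c *: z) = cabs c * enorm z.
Proof.
rewrite /enorm -[cabs c]ger0_norm ?cabs_ge0// -sqrtr_sqr -sqrtrM ?sqr_ge0//.
by congr Num.sqrt; rewrite mulr_sumr; apply: eq_bigr => j _; rewrite mxE cabsM exprMn.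
Qed.
Lemma enormN z : enorm (- z) = enorm z.
Proof. by rewrite -scaleN1r enormZ cabsN cabs1 mul1r. Qed.
Lemma enorm_distC z w : enorm (z - w) = enorm (w - z).
Proof. by rewrite -enormN opprB. Qed.

(** With b = |w|^2 and s = [hdot z w], the square norm of b z - s w is b (b |z|^2 - |s|^2), and it
    is nonnegative. *)
Lemma CauchySchwarz z w : cabs (hdot z w) <= enorm z * enorm w.
Proof.
have [w0|w0] := eqVneq (enorm w) 0.
  rewrite (enorm_eq0 w0) enorm0 mulr0 hdotC hdot0l -[X in X^*]/(0:C).
  by rewrite cabsJ cabs0.
set s := hdot z w; set b := enorm w ^+ 2.
have b0 : 0 < b by rewrite exprn_even_gt0.
have : 0 <= enorm (mkC b 0 *: z - s *: w) ^+ 2 by rewrite sqr_ge0.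
have -> : enorm (mkC b 0 *: z - s *: w) ^+ 2 = b * (b * enorm z ^+ 2 - cabs s ^+ 2).
  apply: mkC0_inj.
  rewrite -hdotzz !(hdotBl, hdotBr, hdotZl, hdotZr) !hdotzz (hdotC z w) -/s -/b.
  by apply: cext; rewrite !cE ?cabs_sqr; ring.
rewrite pmulr_rge0// subr_ge0 => h.
rewrite -(@ler_pXn2r _ 2)// ?nnegrE ?cabs_ge0 ?mulr_ge0 ?enorm_ge0//.
by rewrite exprMn mulrC.
Qed.

Lemma ler_enormD z w : enorm (z + w) <= enorm z + enorm w.
Proof.
rewrite -(@ler_pXn2r _ 2)// ?nnegrE ?addr_ge0 ?enorm_ge0//.
have -> : enorm (z + w) ^+ 2 = enorm z ^+ 2 + enorm w ^+ 2 + 2 * cRe (hdot z w).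
  apply: mkC0_inj.
  rewrite -hdotzz !(hdotDl, hdotDr) !hdotzz (hdotC z w).
  by apply: cext; rewrite !cE; ring.
have := le_trans (cRe_normle _) (CauchySchwarz z w).
by rewrite sqrrD -mulr_natl; lra.
Qed.

Lemma enormB_sqr z w :
  enorm (z - w) ^+ 2 = enorm z ^+ 2 + enorm w ^+ 2 - 2 * cRe (hdot z w).
Proof.
apply: mkC0_inj.
rewrite -hdotzz !(hdotBl, hdotBr) !hdotzz (hdotC z w).
by apply: cext; rewrite !cE; ring.
Qed.

Definition kern (zeta z : V) : C := 1 - hdot z zeta.

Lemma cabs_kern zeta z : cabs (kern zeta z) = dist z zeta. Proof. by []. Qed.

(** The square expands to |z|^2 + 1 - 2 Re ([hdot z zeta]). The real part is kept, and not only the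
    modulus, because it later places the kernel in the right half-plane. *)
Lemma enorm_sqr_le_Re z zeta : cball z -> sphere zeta ->
  enorm (z - zeta) ^+ 2 <= 2 * cRe (kern zeta z).
Proof.
rewrite /cball /sphere /= => hz hs; rewrite enormB_sqr hs /kern cReB cRe1.
have : enorm z ^+ 2 <= 1 by rewrite expr_le1// enorm_ge0.
by lra.
Qed.
Lemma enorm_sqr_le z zeta : cball z -> sphere zeta ->
  enorm (z - zeta) ^+ 2 <= 2 * dist z zeta.
Proof.
move=> hz hs; apply: le_trans (enorm_sqr_le_Re hz hs) _.
by rewrite ler_pM2l// cRe_normle.
Qed.
(** As [hdot zeta zeta] is 1, the kernel is minus the normal coordinate of z at zeta. *)
Lemma kern_sphere z zeta : sphere zeta -> kern zeta z = hdot (zeta - z) zeta.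
Proof.
by rewrite /sphere /= => hs; rewrite hdotBl hdotzz hs expr1n.
Qed.
Lemma dist_le_enorm z zeta : sphere zeta -> dist z zeta <= enorm (z - zeta).
Proof.
move=> hs; rewrite -cabs_kern kern_sphere// -enormN opprB.
by apply: le_trans (CauchySchwarz _ _) _; rewrite hs mulr1.
Qed.
Lemma dist_ge0 z w : 0 <= dist z w. Proof. exact: cabs_ge0. Qed.
Lemma dist_le2 z w : cball z -> cball w -> dist z w <= 2.
Proof.
rewrite /cball /= => hz hw; apply: le_trans (ler_cabsD _ _) _.
rewrite cabs1 cabsN [2]splitr [2 / 2]divff// lerD2l.
by apply: le_trans (CauchySchwarz _ _) _; rewrite mulr_ile1 ?enorm_ge0.
Qed.
Lemma sphere_cball z : sphere z -> cball z.
Proof. by rewrite /sphere /cball /= => ->. Qed.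
Lemma dist_ge_norm z w : cball z -> cball w -> 1 - enorm z <= dist z w.
Proof.
rewrite /cball /= => hz hw.
have : cabs (1 : C) <= cabs (1 - hdot z w) + cabs (hdot z w).
  by rewrite -{1}(subrK (hdot z w) 1) ler_cabsD.
have : cabs (hdot z w) <= enorm z.
  by apply: le_trans (CauchySchwarz _ _) _; rewrite ler_piMr ?enorm_ge0.
by rewrite cabs1 /dist; lra.
Qed.

Lemma quasi_triangle z z0 zeta : cball z -> sphere z0 -> sphere zeta ->
  dist z0 zeta <= 4 * dist z z0 + 2 * dist z zeta.
Proof.
move=> hz h0 hs.
(* The term 1 - |z|^2 is at most 2 d(z, z0), and the last one is estimated by
   |z - z0|^2 <= 2 d(z, z0) and |z - zeta|^2 <= 2 d(z, zeta). *)
have E : kern zeta z0 =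
    (hdot (z0 - z) z0)^* + kern zeta z - (1 - hdot z z) - hdot (z0 - z) (zeta - z).
  rewrite !(hdotBl, hdotBr) !(raddfB, rmorphB) /= -!hdotC.
  rewrite /kern hdotzz h0 expr1n.
  have -> : mkC 1 0 = 1 :> C by [].
  by ring.
have h1 : cabs (1 - hdot z z) <= 2 * dist z z0.
  rewrite hdotzz.
  have -> : 1 - mkC (enorm z ^+ 2) 0 = mkC (1 - enorm z ^+ 2) 0 :> C.
    by apply: cext; rewrite !cE; ring.
  rewrite cabs_mkC ger0_norm; last by rewrite subr_ge0 expr_le1// enorm_ge0.
  have := dist_ge_norm hz (sphere_cball h0).
  have := enorm_ge0 z; have : enorm z <= 1 by [].
  nra.
have h2 : cabs (hdot (z0 - z) (zeta - z)) <= dist z z0 + dist z zeta.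
  apply: le_trans (CauchySchwarz _ _) _.
  have := enorm_sqr_le hz h0; have := enorm_sqr_le hz hs.
  rewrite ![enorm (z - _)]enorm_distC.
  have := sqr_ge0 (enorm (z0 - z) - enorm (zeta - z)).
  by rewrite sqrrB -[_ *+ 2]mulr_natl; lra.
rewrite -cabs_kern E.
have tri (a b c d : C) : cabs (a + b - c - d) <= cabs a + cabs b + cabs c + cabs d.
  by do 3![apply: le_trans (ler_cabsD _ _) _; rewrite ?cabsN ?lerD2r].
apply: le_trans (tri _ _ _ _) _.
by move: h1 h2; rewrite cabsJ -kern_sphere// !cabs_kern; lra.
Qed.

End Geometry.

(** * Neighbourhoods and compactness in the Euclidean norm *)

Section Topology.
Context {R : realType} {n : nat}.
Local Notation C := (Cplx R).
Local Notation V := (Cn R n).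
Implicit Types (z w v u : V).

Lemma enorm_le_coord z (r : R) :
  (forall j, cabs (z 0 j) < r) -> enorm z <= n.+1%:R * r.
Proof.
move=> h; have r0 : 0 <= r by rewrite ltW// (le_lt_trans _ (h ord0))// cabs_ge0.
rewrite -(@ler_pXn2r _ 2)// ?nnegrE ?mulr_ge0 ?enorm_ge0//.
rewrite enorm_sqr; apply: (@le_trans _ _ (\sum_(j < n.+1) r ^+ 2)).
  by apply: ler_sum => j _; rewrite ler_pXn2r ?nnegrE ?cabs_ge0// ltW.
rewrite sumr_const card_ord -[leLHS]mulr_natl exprMn ler_wpM2r ?sqr_ge0//.
by rewrite -natrX ler_nat expnS expn1 leq_pmulr.
Qed.

(** The topology of [V] comes from a maximum norm with values in [Cplx R]; this passes once and for
    all to the Euclidean norm and real radii. *)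
Lemma nbhs_enormP z (A : set V) :
  nbhs z A <-> exists2 r : R, 0 < r & forall w, enorm (w - z) < r -> A w.
Proof.
split=> [/nbhs_ballP[_ /= /gtC0P[r r0 ->] h]|[r r0 h]].
  exists r => // w hw; apply: h; split; first by rewrite mkC_gt0.
  move=> i j; rewrite -ball_normE /= normCE ltC_mkC cabs_distC ord1.
  by apply: le_lt_trans hw; have := cabs_coord_le (w - z) j; rewrite !mxE.
(* With n.+2 in place of n.+1, the bound (n+1) e of [enorm_le_coord] is strictly below r. *)
pose e : R := r / n.+2%:R.
have e0 : 0 < e by rewrite divr_gt0.
apply/nbhs_ballP; exists (mkC e 0); first by rewrite /= mkC_gt0.
move=> w [_ hw]; apply: h.
have : forall j, cabs ((w - z) 0 j) < e.
  move=> j; have := hw 0 j; rewrite -ball_normE /= normCE ltC_mkC cabs_distC.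
  by rewrite !mxE.
move=> /enorm_le_coord /le_lt_trans; apply.
by rewrite /e mulrCA -[ltRHS]mulr1 ltr_pM2l// ltr_pdivrMr// mul1r ltr_nat.
Qed.

Lemma nbhs_enorm z (r : R) : 0 < r -> nbhs z [set w : V | enorm (w - z) < r].
Proof. by move=> r0; apply/nbhs_enormP; exists r. Qed.

Lemma continuous_cst (T : topologicalType) (c : C) (z : T) :
  {for z, continuous (fun _ => c)}.
Proof. exact: cvg_cst. Qed.

Lemma continuousVP (F : V -> C) z :
  {for z, continuous F} <-> forall e : R, 0 < e -> exists2 d : R, 0 < d &
    forall w, enorm (w - z) < d -> cabs (F w - F z) < e.
Proof.
split=> [/cvg_cabsP h e /h/nbhs_enormP//|h].
apply/(@cvg_cabsP _ _ (nbhs z) (nbhs_filter z)) => e /h ?.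
exact/nbhs_enormP.
Qed.

Lemma continuousVRP (F : V -> R) z :
  {for z, continuous F} <-> forall e : R, 0 < e -> exists2 d : R, 0 < d &
    forall w, enorm (w - z) < d -> `|F w - F z| < e.
Proof.
split=> [/cvgrPdist_lt h e /h/nbhs_enormP[d d0 hd]|h].
  by exists d => // w /hd; rewrite distrC.
apply/(@cvgrPdist_lt _ _ _ (nbhs z) (nbhs_filter z)) => e /h[d d0 hd].
by apply/nbhs_enormP; exists d => // w /hd; rewrite distrC.
Qed.

Lemma cabs_dist (x y : C) : `|cabs x - cabs y| <= cabs (x - y).
Proof.
have := ler_cabsD x (y - x); have := ler_cabsD y (x - y).
by rewrite !(addrC _ (_ - _)) !subrK (cabs_distC y) ler_norml; lra.
Qed.

Lemma continuous_hdot u z : {for z, continuous (hdot^~ u)}.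
Proof.
apply/continuousVP => e e0; have p : 0 < enorm u + 1 by rewrite ltr_wpDl ?enorm_ge0.
exists (e / (enorm u + 1)); first by rewrite divr_gt0.
move=> w /= hw; rewrite -hdotBl.
apply: le_lt_trans (CauchySchwarz _ _) _.
apply: le_lt_trans (_ : _ <= enorm (w - z) * (enorm u + 1)) _.
  by rewrite ler_wpM2l ?enorm_ge0// lerDl.
by rewrite -ltr_pdivlMr.
Qed.

Lemma continuous_cabs (F : V -> C) z : {for z, continuous F} ->
  {for z, continuous (fun w => cabs (F w))}.
Proof.
move=> /continuousVP h; apply/continuousVRP => e /h[d d0 hd]; exists d => // w /hd.
by apply: le_lt_trans; exact: cabs_dist.
Qed.

Lemma continuous_dist z u : {for z, continuous (fun z : V => dist z u)}.
Proof.
apply: continuous_cabs; apply/continuousVP => e e0.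
have /continuousVP/(_ e e0)[d d0 hd] := @continuous_hdot u z; exists d => // w /hd.
by rewrite cabs_distC; congr (cabs _ < _); ring.
Qed.

Lemma distC z w : dist z w = dist w z.
Proof. by rewrite /dist hdotC -{1}(rmorph1 (Num.conj : C -> C)) -raddfB/= cabsJ. Qed.

Lemma oball_open : open (@oball R n).
Proof.
rewrite openE => z; rewrite /oball /interior /= => hz.
apply/nbhs_enormP; exists (1 - enorm z); first by rewrite subr_gt0.
move=> w hw; have := ler_enormD (w - z) z; rewrite subrK /=; lra.
Qed.

Lemma cball_closed : closed (@cball R n).
Proof.
move=> z hz; rewrite /cball /=; apply/ler_addgt0Pr => e e0.
have [w [hw1 hw2]] := hz _ (nbhs_enorm z e0); rewrite /cball /= in hw1 hw2.
have := ler_enormD (z - w) w; rewrite subrK enorm_distC /=; lra.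
Qed.

Lemma compact_disc (r : R) : compact [set x : C | `|cRe x| <= r /\ `|cIm x| <= r].
Proof.
pose I : set R := `[- r, r]%classic.
have -> : [set x : C | `|cRe x| <= r /\ `|cIm x| <= r] =
    (fun p : R * R => mkC p.1 p.2) @` (I `*` I).
  apply/seteqP; split=> [x [hr hi]|_ [[a b] [/= ha hb] <-]].
    exists (cRe x, cIm x); last by case: x {hr hi}.
    by split; rewrite /I /= in_itv/= -ler_norml.
  by move: ha hb; rewrite /I /= !in_itv /= -!ler_norml.
apply: continuous_compact; last by apply: compact_setX; exact: segment_compact.
apply: continuous_subspaceT => -[a b]; apply: cvg_cReIm => /=.
  exact: cvg_fst.
exact: cvg_snd.
Qed.

Lemma cball_compact : compact (@cball R n).
Proof.
pose D := [set x : C | `|cRe x| <= 1 /\ `|cIm x| <= 1].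
apply: (@subclosed_compact _ _ [set v : V | forall j : 'I_n.+1, D (v ord0 j)]).
- exact: cball_closed.
- by apply: (@rV_compact C n.+1 (fun=> D)) => _; exact: compact_disc.
- move=> z hz j; split; [apply: le_trans (cRe_le _) _|apply: le_trans (cIm_le _) _];
    exact: le_trans (cabs_coord_le _ _) hz.
Qed.

Lemma compact_cabs_bounded (F : V -> C) :
  (forall z, cball z -> {for z, continuous F}) ->
  exists2 M : R, 0 < M & forall z, cball z -> cabs (F z) <= M.
Proof.
move=> cF; have h : compact ((fun z => cabs (F z)) @` (@cball R n)).
  apply: continuous_compact; last exact: cball_compact.
  apply: continuous_in_subspaceT => z /set_mem hz.
  exact/continuous_cabs/cF.
have [M [_ hM]] := compact_bounded h.
exists (`|M| + 1); first by rewrite ltr_wpDl.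
move=> z hz; apply: le_trans (ler_norm _) _.
by apply: (hM (`|M| + 1)); [rewrite ltr_pwDr// ler_norm|exists z].
Qed.

End Topology.

(** * Real directional derivatives *)

Section Curves.
Context {R : realType}.
Local Notation C := (Cplx R).
Implicit Types (f g : R -> C) (t : R) (d : C).

(** Real and imaginary parts are taken separately, as in [rderivable], so that real differential
    calculus applies. *)
Definition is_cderive f t d : Prop :=
  is_derive t (1 : R) (fun s => cRe (f s)) (cRe d) /\
  is_derive t (1 : R) (fun s => cIm (f s)) (cIm d).

Lemma is_cderive_near f g t d :
  (\forall s \near t, f s = g s) -> is_cderive f t d -> is_cderive g t d.
Proof.
move=> fg [h1 h2]; split.
  by apply: near_eq_is_derive h1; apply: filterS fg => s ->.
by apply: near_eq_is_derive h2; apply: filterS fg => s ->.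
Qed.

Lemma is_cderive_cst (c : C) t : is_cderive (fun _ => c) t 0.
Proof. by split; exact: is_derive_cst. Qed.

Lemma is_cderiveD f g t d d' : is_cderive f t d -> is_cderive g t d' ->
  is_cderive (fun s => f s + g s) t (d + d').
Proof.
move=> [f1 f2] [g1 g2]; split.
  rewrite cReD (_ : (fun s => _) = (fun s => cRe (f s)) + (fun s => cRe (g s))).
    exact: is_deriveD.
  by apply/funext => s; rewrite cReD.
rewrite cImD (_ : (fun s => _) = (fun s => cIm (f s)) + (fun s => cIm (g s))).
  exact: is_deriveD.
by apply/funext => s; rewrite cImD.
Qed.

Lemma is_cderiveM f g t d d' : is_cderive f t d -> is_cderive g t d' ->
  is_cderive (fun s => f s * g s) t (d * g t + f t * d').
Proof.
move=> [f1 f2] [g1 g2]; split.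
  rewrite (_ : (fun s => _) = (fun s => cRe (f s)) * (fun s => cRe (g s)) -
    (fun s => cIm (f s)) * (fun s => cIm (g s))); last first.
    by apply/funext => s; rewrite cReM.
  apply: (is_derive_eq (is_deriveB (is_deriveM f1 g1) (is_deriveM f2 g2))).
  by rewrite !cE /GRing.scale /=; ring.
rewrite (_ : (fun s => _) = (fun s => cRe (f s)) * (fun s => cIm (g s)) +
    (fun s => cIm (f s)) * (fun s => cRe (g s))); last first.
  by apply/funext => s; rewrite cImM.
apply: (is_derive_eq (is_deriveD (is_deriveM f1 g2) (is_deriveM f2 g1))).
by rewrite !cE /GRing.scale /=; ring.
Qed.

Lemma cVE (x : C) : x^-1 = mkC (cRe x / (cRe x ^+ 2 + cIm x ^+ 2))
  (- cIm x / (cRe x ^+ 2 + cIm x ^+ 2)).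
Proof. by rewrite mulNr; case: x. Qed.

Lemma cabs_sqr_neq0 (x : C) : x != 0 -> cRe x ^+ 2 + cIm x ^+ 2 != 0.
Proof. by rewrite -cabs_sqr -cabs_eq0 => h; rewrite expf_neq0. Qed.

Lemma is_cderiveV f t d : f t != 0 -> is_cderive f t d ->
  is_cderive (fun s => (f s)^-1) t (- d / f t ^+ 2).
Proof.
move=> f0 [f1 f2].
pose N : R -> R := (fun s => cRe (f s)) ^+ 2 + (fun s => cIm (f s)) ^+ 2.
have N0 : N t != 0 by exact: cabs_sqr_neq0.
have NE : cRe (f t) * cRe (f t) + cIm (f t) * cIm (f t) != 0.
  exact: N0.
have dN : is_derive t (1 : R) N (2 * (cRe (f t) * cRe d + cIm (f t) * cIm d)).
  apply: (is_derive_eq (is_deriveD (is_deriveX 2 f1) (is_deriveX 2 f2))).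
  by rewrite /GRing.scale /= expr1; ring.
have dV := is_deriveV N0 dN.
rewrite expr2 invfM cVE; split.
  rewrite (_ : (fun s => _) = (fun s => cRe (f s)) * (fun s => (N s)^-1)); last first.
    by apply/funext => s; rewrite cVE.
  apply: (is_derive_eq (is_deriveM f1 dV)); rewrite !cE /GRing.scale /= /N.
  rewrite -[(_ + _ : R -> R) t]/(cRe (f t) ^+ 2 + cIm (f t) ^+ 2).
  by field.
rewrite (_ : (fun s => _) = (- (fun s => cIm (f s))) * (fun s => (N s)^-1)); last first.
  by apply/funext => s; rewrite cVE.
apply: (is_derive_eq (is_deriveM (is_deriveN f2) dV)); rewrite !cE /GRing.scale /= /N.
rewrite -[(_ + _ : R -> R) t]/(cRe (f t) ^+ 2 + cIm (f t) ^+ 2).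
rewrite -[(- _ : R -> R) t]/(- cIm (f t)).
by field.
Qed.

Lemma is_cderiveJ f t d : is_cderive f t d ->
  is_cderive (fun s => (f s)^*) t d^*.
Proof.
move=> [f1 f2]; split.
  by rewrite cRe_conj (_ : (fun s => _) = fun s => cRe (f s))//; apply/funext => s; rewrite cRe_conj.
rewrite cIm_conj (_ : (fun s => _) = - (fun s => cIm (f s))).
  exact: is_deriveN.
by apply/funext => s; rewrite cIm_conj.
Qed.

Lemma is_derive_continuous (h : R -> R) t (l : R) : is_derive t (1 : R) h l ->
  {for t, continuous h}.
Proof.
by move=> [/(@derivable1_diffP R R) + _]; exact: (@differentiable_continuous R R R).
Qed.

Lemma is_cderive_continuous f t d : is_cderive f t d -> {for t, continuous f}.
Proof.
move=> [h1 h2]; apply: (@cvg_cReIm _ _ (nbhs t)).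
  exact: is_derive_continuous h1.
exact: is_derive_continuous h2.
Qed.

(** [carg] is an arccosine with a sign, a form that is singular on the positive axis; on the right
    half-plane the arctangent is a smooth substitute. *)
Lemma carg_atan (x : C) : 0 < cRe x -> carg x = atan (cIm x / cRe x).
Proof.
move=> x0; have a0 : 0 < cabs x := lt_le_trans x0 (cRe_normle x).
have E : cRe x / cabs x = cos (atan (cIm x / cRe x)).
  rewrite cos_atan cabsE; set a := cRe x; set b := cIm x.
  have -> : a ^+ 2 + b ^+ 2 = a ^+ 2 * (1 + (b / a) ^+ 2).
    by field; rewrite gt_eqF.
  rewrite sqrtrM ?sqr_ge0// sqrtr_sqr gtr0_norm// invfM mulrA divff ?mul1r//.
  by rewrite gt_eqF.
have pi0 : 0 < pi :> R := pi_gt0 R.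
have l1 := atan_gtNpi2 (cIm x / cRe x); have l2 := atan_ltpi2 (cIm x / cRe x).
rewrite /carg E; case: ifPn => [b0|]; last rewrite -ltNge => b0.
  rewrite cosK// in_itv/=; apply/andP; split; last by lra.
  by rewrite -(@atan0 R) le_atan// divr_ge0// ltW.
rewrite cosKN ?opprK//; apply/andP; split; first by lra.
by rewrite -(@atan0 R) le_atan// ler_pdivrMr// mul0r ltW.
Qed.

(** The modulus enters through the logarithm of its square, so that no square root has to be
    differentiated. *)
Lemma cpowE (x : C) (s : R) : 0 < cRe x ->
  cpow x s = mkC
    (expR (s / 2 * ln (cRe x ^+ 2 + cIm x ^+ 2)) * cos (s * atan (cIm x / cRe x)))
    (expR (s / 2 * ln (cRe x ^+ 2 + cIm x ^+ 2)) * sin (s * atan (cIm x / cRe x))).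
Proof.
move=> x0; have a0 : 0 < cabs x := lt_le_trans x0 (cRe_normle x).
have E : cabs x `^ s = expR (s / 2 * ln (cRe x ^+ 2 + cIm x ^+ 2)).
  rewrite -cabs_sqr -[cabs x ^+ 2]powR_mulrn ?cabs_ge0// ln_powR /powR gt_eqF//.
  by congr expR; field.
by rewrite /cpow E carg_atan.
Qed.

(** The derivative contains x^s / x instead of x^(s-1): inductions on the number of derivatives can
    then keep s fixed and treat 1/x as a separate factor. *)
Lemma is_cderive_cpow f t d (s : R) : 0 < cRe (f t) -> is_cderive f t d ->
  is_cderive (fun r => cpow (f r) s) t (mkC s 0 * cpow (f t) s * (f t)^-1 * d).
Proof.
move=> f0 fd; have [f1 f2] := fd.
pose N : R -> R := (fun s => cRe (f s)) ^+ 2 + (fun s => cIm (f s)) ^+ 2.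
have ft0 : f t != 0 by apply: contraTneq f0 => ->; rewrite cRe0 ltxx.
have N0 : 0 < N t.
  by rewrite /N lt0r cabs_sqr_neq0//= addr_ge0// sqr_ge0.
have dN : is_derive t (1 : R) N (2 * (cRe (f t) * cRe d + cIm (f t) * cIm d)).
  apply: (is_derive_eq (is_deriveD (is_deriveX 2 f1) (is_deriveX 2 f2))).
  by rewrite /GRing.scale /= expr1; ring.
have dL : is_derive t (1 : R) ((s / 2) *: (@ln R \o N)) ((s / 2) *: ((N t)^-1 * (2 * (cRe (f t) * cRe d + cIm (f t) * cIm d)))).
  by apply: is_deriveZ; apply: is_derive1_comp; exact: is_derive1_ln.
have dE := is_derive1_comp (is_derive_expR _) dL.
have f0' : cRe (f t) != 0 by rewrite gt_eqF.
have dQ := is_deriveM f2 (is_deriveV f0' f1).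
have dA := is_deriveZ s (is_derive1_comp (is_derive1_atan _) dQ).
have dC := is_derive1_comp (is_derive_cos _) dA.
have dS := is_derive1_comp (is_derive_sin _) dA.
have near0 : \forall r \near t, 0 < cRe (f r).
  have h := @cvg_cRe _ _ (nbhs t) (nbhs_filter t) f _ (is_cderive_continuous fd).
  exact: (cvgr_gt _ h _ f0).
have NE : cRe (f t) * cRe (f t) + cIm (f t) * cIm (f t) != 0.
  by rewrite gt_eqF.
have NtE : N t = cRe (f t) ^+ 2 + cIm (f t) ^+ 2 by [].
have HA : (1 + (cIm (f t) / cRe (f t)) ^+ 2)^-1 = cRe (f t) ^+ 2 / N t.
  rewrite NtE; field; rewrite f0' /=.
  by rewrite NE.
split.
  apply: (@near_eq_is_derive _ _ _
    ((@expR R \o (s / 2 *: (@ln R \o N))) *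
     (@cos R \o (s *: (@atan R \o ((fun s => cIm (f s)) * (fun s => (cRe (f s))^-1))))))).
    by apply: filterS near0 => r r0; rewrite cpowE.
  have D := is_deriveM dE dC.
  apply: (is_derive_eq D); rewrite cpowE// cVE /= /GRing.scale !cE /= -NtE.
  rewrite -[((fun s => cIm (f s)) * _) t]/(cIm (f t) / cRe (f t)) HA /GRing.scale /=.
  set e := expR _; set c := cos _; set si := sin _.
  rewrite NtE; field.
  by rewrite f0' NE.
apply: (@near_eq_is_derive _ _ _
    ((@expR R \o (s / 2 *: (@ln R \o N))) *
     (@sin R \o (s *: (@atan R \o ((fun s => cIm (f s)) * (fun s => (cRe (f s))^-1))))))).
  by apply: filterS near0 => r r0; rewrite cpowE.
have D := is_deriveM dE dS.
apply: (is_derive_eq D); rewrite cpowE// cVE /= /GRing.scale !cE /= -NtE.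
rewrite -[((fun s => cIm (f s)) * _) t]/(cIm (f t) / cRe (f t)) HA /GRing.scale /=.
set e := expR _; set c := cos _; set si := sin _.
rewrite NtE; field.
by rewrite f0' NE.
Qed.

Lemma cabs_cpow (x : C) (s : R) : cabs (cpow x s) = cabs x `^ s.
Proof.
rewrite cabsE !cE !exprMn -mulrDr cos2Dsin2 mulr1 sqrtr_sqr ger0_norm//.
exact: powR_ge0.
Qed.

Lemma cpowN (x : C) (s : R) : x != 0 -> cpow x (- s) = (cpow x s)^-1.
Proof.
move=> x0; have a0 : cabs x `^ s != 0 by rewrite powR_eq0 cabs_eq0 (negbTE x0).
have E := cos2Dsin2 (s * carg x).
rewrite cVE !cE !exprMn -mulrDr E mulr1 /cpow !mulNr cosN sinN powRN.
by congr mkC; field.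
Qed.

End Curves.

(** * Directional derivatives and the mean value inequality *)

Section Directional.
Context {R : realType} {n : nat}.
Local Notation C := (Cplx R).
Local Notation V := (Cn R n).
Implicit Types (z w v u : V) (F G : V -> C).

(** A first-order expansion with error e |s|, meaningful at s = 0 as well; it adapts easily to a
    rescaled direction and to a sum of two directions. *)
Lemma is_cderiveP (f : R -> C) t (d : C) : is_cderive f t d <->
  forall e : R, 0 < e -> exists2 r : R, 0 < r & forall s, `|s| < r ->
    cabs (f (s + t) - f t - mkC s 0 * d) <= e * `|s|.
Proof.
have key (g : R -> R) (l : R) : is_derive t (1 : R) g l <->
    forall e : R, 0 < e -> exists2 r : R, 0 < r & forall s, `|s| < r ->
      `|g (s + t) - g t - s * l| <= e * `|s|.
  split=> [[dg <-] e e0|h].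
    have : h^-1 *: (g (h *: 1 + t) - g t) @[h --> 0^'] --> 'D_1 g t by [].
    move=> /cvgrPdist_le /(_ _ e0) /nbhs_ballP[r /= r0 hr].
    exists r => // s sr; have [->|s0] := eqVneq s 0.
      by rewrite add0r subrr normr0 mulr0 mul0r subr0 normr0.
    have := hr s; rewrite /ball /= sub0r normrN => /(_ sr s0).
    rewrite /GRing.scale /= mulr1 distrC => hh.
    rewrite -ler_pdivrMr ?normr_gt0// -normfV -normrM.
    by apply: le_trans hh; rewrite le_eqVlt; apply/orP; left; apply/eqP; congr `|_|; field.
  have hc : h^-1 *: (g (h *: 1 + t) - g t) @[h --> 0^'] --> l.
    apply/cvgrPdist_le => e e0; have [r r0 hr] := h e e0.
    apply/nbhs_ballP; exists r => // s; rewrite /ball /= sub0r normrN => sr s0.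
    rewrite /GRing.scale /= mulr1 distrC; have := hr s sr.
    rewrite -ler_pdivrMr ?normr_gt0// -normfV -normrM => hh.
    by apply: le_trans hh; rewrite le_eqVlt; apply/orP; left; apply/eqP; congr `|_|; field.
  by apply: DeriveDef; [apply/cvg_ex; exists l|exact: cvg_lim hc].
split=> [[/key h1 /key h2] e e0|h].
  have e2 : 0 < e / 2 by rewrite divr_gt0.
  have [r1 r10 hr1] := h1 _ e2; have [r2 r20 hr2] := h2 _ e2.
  exists (Num.min r1 r2); first by rewrite lt_min r10.
  move=> s; rewrite lt_min => /andP[/hr1 s1 /hr2 s2].
  apply: le_trans (cabs_le _) _; rewrite !cE mul0r subr0 mul0r addr0.
  by move: s1 s2; lra.
split; apply/key => e /h[r r0 hr]; exists r => // s /hr; apply: le_trans.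
  by apply: le_trans (cRe_le _); rewrite !cE mul0r subr0.
by apply: le_trans (cIm_le _); rewrite !cE mul0r addr0.
Qed.

Definition is_rderive F v z (d : C) := is_cderive (line F v z) 0 d.

Lemma is_rderiveP F v z d : is_rderive F v z d ->
  rderivable F v z /\ rderive v F z = d.
Proof.
move=> [[h1 e1] [h2 e2]]; split; first by split; [exact: h1|exact: h2].
by apply: cext; [exact: e1|exact: e2].
Qed.
Lemma is_rderive_val F v z d : is_rderive F v z d -> rderive v F z = d.
Proof. by move=> /is_rderiveP[]. Qed.
Lemma rderivableP F v z : rderivable F v z -> is_rderive F v z (rderive v F z).
Proof.
move=> [h1 h2]; split; [exact: (DeriveDef h1 erefl)|exact: (DeriveDef h2 erefl)].
Qed.

Lemma line_near v z t (A : set V) : nbhs (z + mkC t 0 *: v) A ->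
  \forall s \near t, A (z + mkC s 0 *: v).
Proof.
move=> /nbhs_enormP[r r0 h].
have p : 0 < enorm v + 1 by rewrite ltr_wpDl ?enorm_ge0.
have d0 : 0 < r / (enorm v + 1) by rewrite divr_gt0.
apply/nbhs_ballP; exists (r / (enorm v + 1)) => // s; rewrite /ball /= => st.
apply: h; rewrite opprD addrACA subrr add0r -scalerBl enormZ.
have -> : mkC s 0 - mkC t 0 = mkC (s - t) 0 :> C by apply: cext; rewrite !cE ?subr0.
rewrite cabs_mkC distrC.
apply: le_lt_trans (_ : _ <= `|t - s| * (enorm v + 1)) _.
  by rewrite ler_wpM2l// lerDl.
by rewrite -ltr_pdivlMr.
Qed.

Lemma line0E F v z : line F v z 0 = F z.
Proof. by rewrite /line mkC00 scale0r addr0. Qed.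

Lemma is_rderive_near F G v z d : (\forall w \near z, F w = G w) ->
  is_rderive F v z d -> is_rderive G v z d.
Proof.
move=> FG; apply: is_cderive_near.
apply: (@line_near v z 0 [set w | F w = G w]).
rewrite mkC00 scale0r addr0; exact: FG.
Qed.

Lemma is_rderive_eq F v z d d' : is_rderive F v z d -> d = d' -> is_rderive F v z d'.
Proof. by move=> + <-. Qed.

Lemma rderive_near F G v z : (\forall w \near z, F w = G w) ->
  rderivable F v z -> rderivable G v z /\ rderive v G z = rderive v F z.
Proof. by move=> h /rderivableP/(is_rderive_near h)/is_rderiveP. Qed.

Lemma is_rderive_cst (c : C) v z : is_rderive (fun _ => c) v z 0.
Proof. exact: is_cderive_cst. Qed.
Lemma is_rderiveD F G v z d d' : is_rderive F v z d -> is_rderive G v z d' ->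
  is_rderive (fun w => F w + G w) v z (d + d').
Proof. exact: is_cderiveD. Qed.
Lemma is_rderiveM F G v z d d' : is_rderive F v z d -> is_rderive G v z d' ->
  is_rderive (fun w => F w * G w) v z (d * G z + F z * d').
Proof.
move=> hF hG; have := is_cderiveM hF hG; rewrite !line0E; exact.
Qed.
Lemma is_rderiveV F v z d : F z != 0 -> is_rderive F v z d ->
  is_rderive (fun w => (F w)^-1) v z (- d / F z ^+ 2).
Proof.
move=> F0 hF; have := @is_cderiveV _ _ _ _ _ hF; rewrite !line0E; exact.
Qed.
Lemma is_rderiveJ F v z d : is_rderive F v z d ->
  is_rderive (fun w => (F w)^*) v z d^*.
Proof. exact: is_cderiveJ. Qed.
Lemma is_rderive_cpow F v z d (s : R) : 0 < cRe (F z) -> is_rderive F v z d ->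
  is_rderive (fun w => cpow (F w) s) v z (mkC s 0 * cpow (F z) s * (F z)^-1 * d).
Proof.
move=> F0 hF; have := @is_cderive_cpow _ _ _ _ s _ hF; rewrite !line0E; exact.
Qed.
Lemma is_rderive_hdot u v z : is_rderive (hdot^~ u) v z (hdot v u).
Proof.
apply/is_cderiveP => e e0; exists 1 => // s _.
have E r : line (hdot^~ u) v z r = hdot z u + mkC r 0 * hdot v u.
  by rewrite /line hdotDl hdotZl.
rewrite !E.
rewrite (addr0 s).
rewrite mkC00.
set a := hdot z u; set b := hdot v u; set c := mkC s 0.
have -> : a + c * b - (a + 0 * b) - c * b = 0 by ring.
by rewrite cabs0 mulr_ge0// ltW.
Qed.

Lemma line_shift F v z t s : line F v (z + mkC t 0 *: v) s = line F v z (s + t).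
Proof.
rewrite /line -addrA -scalerDl; congr (F (_ + _ *: _)).
by apply: cext; rewrite !cE ?addr0// addrC.
Qed.

Lemma is_rderive_along F v z t d : is_rderive F v (z + mkC t 0 *: v) d ->
  is_cderive (line F v z) t d.
Proof.
move=> H; have h := (is_cderiveP (line F v (z + mkC t 0 *: v)) 0 d).1 H.
apply/is_cderiveP => e /h[r r0 hr]; exists r; first exact: r0.
move=> s /hr.
by rewrite (addr0 s) (line_shift F v z t s) (line_shift F v z t 0) (add0r t).
Qed.

Lemma is_rderive_scale F v z d (c : R) : is_rderive F v z d ->
  is_rderive F (mkC c 0 *: v) z (mkC c 0 * d).
Proof.
move=> H; have h := (is_cderiveP (line F v z) 0 d).1 H.
apply/is_cderiveP => e e0.
have p : 0 < `|c| + 1 by rewrite ltr_wpDl.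
have [r r0 hr] := h (e / (`|c| + 1)) (divr_gt0 e0 p).
exists (r / (`|c| + 1)); first by rewrite divr_gt0.
move=> s hs; have := hr (s * c).
have -> : line F (mkC c 0 *: v) z (s + 0) = line F v z (s * c + 0).
  by rewrite (addr0 s) (addr0 (s * c)) /line scalerA; congr (F (_ + _ *: _)); apply: cext; rewrite !cE; ring.
rewrite !line0E mulrA.
have -> : mkC s 0 * mkC c 0 = mkC (s * c) 0 :> C by apply: cext; rewrite !cE; ring.
rewrite normrM => h1; apply: le_trans (h1 _) _.
  apply: le_lt_trans (_ : _ <= `|s| * (`|c| + 1)) _; first by rewrite ler_wpM2l// lerDl.
  by rewrite -ltr_pdivlMr.
rewrite mulrAC ler_pdivrMr// [leRHS]mulrDr mulr1 -!mulrA lerDl.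
by rewrite mulr_ge0// ltW.
Qed.

(** A mean value inequality. The mean value theorem is applied to the real and imaginary parts,
    whose intermediate points differ, whence the factor 2. With d0 = 0 it gives Lipschitz bounds;
    with d0 the derivative at z it gives first-order expansions. *)
Lemma segment_bound F v z (D : R -> C) (d0 : C) (M : R) :
  (forall s : R, 0 <= s <= 1 -> is_rderive F v (z + mkC s 0 *: v) (D s)) ->
  (forall s : R, 0 <= s <= 1 -> cabs (D s - d0) <= M) ->
  cabs (F (z + v) - F z - d0) <= 2 * M.
Proof.
move=> hD hM.
have hc (s : R) : 0 <= s <= 1 -> is_cderive (line F v z) s (D s).
  by move=> /hD; exact: is_rderive_along.
have E1 : line F v z 1 = F (z + v) by rewrite /line mkC10 scale1r.
have key (g : R -> R) (dg : R -> R) :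
    (forall s : R, 0 <= s <= 1 -> is_derive s (1 : R) g (dg s)) ->
    exists2 s, 0 <= s <= 1 & g 1 - g 0 = dg s.
  move=> h; have [s s01 ->] := @MVT R g dg 0 1 ltr01
    (fun x hx => h x (ltac:(by move: hx; rewrite in_itv/= => /andP[/ltW -> /ltW ->])))
    (ltac:(apply: continuous_in_subspaceT => x; rewrite inE /= in_itv /= => /h;
           exact: is_derive_continuous)).
  exists s; last by rewrite (subr0 1) mulr1.
  by move: s01; rewrite in_itv/= => /andP[/ltW -> /ltW ->].
have [s1 s1I e1] := key _ _ (fun s hs => (hc s hs).1).
have [s2 s2I e2] := key _ _ (fun s hs => (hc s hs).2).
rewrite line0E E1 in e1 e2.
apply: le_trans (cabs_le _) _; rewrite !cReB !cImB e1 e2 -cReB -cImB.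
have := le_trans (cRe_le _) (hM _ s1I); have := le_trans (cIm_le _) (hM _ s2I).
lra.
Qed.

(** Existence of both derivatives does not make them additive in the direction; continuity of the
    derivative along v does, on moving first by s w and then by s v. *)
Lemma is_rderive_add F v w z dw :
  (\forall y \near z, rderivable F v y) -> {for z, continuous (rderive v F)} ->
  is_rderive F w z dw -> is_rderive F (v + w) z (rderive v F z + dw).
Proof.
move=> /nbhs_enormP[r1 r10 h1] /continuousVP hc H.
have hw := (is_cderiveP (line F w z) 0 dw).1 H.
apply/is_cderiveP => e e0.
have e4 : 0 < e / 4 by rewrite divr_gt0.
have [r2 r20 h2] := hc _ e4; have [r3 r30 h3] := hw _ (divr_gt0 e0 (ltr0Sn R 1)).
pose m := enorm v + enorm w + 1.
have m0 : 0 < m by rewrite ltr_wpDl ?addr_ge0 ?enorm_ge0.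
exists (Num.min (Num.min r1 r2 / m) r3).
  by rewrite lt_min r30 divr_gt0// lt_min r10.
move=> s; rewrite lt_min => /andP[]; rewrite ltr_pdivlMr// lt_min => /andP[sr1 sr2] sr3.
have hs (a : R) : 0 <= a <= 1 ->
    enorm (z + mkC s 0 *: w + mkC a 0 *: (mkC s 0 *: v) - z) <= `|s| * m.
  move=> /andP[a0 a1]; rewrite addrAC (addrC z) addrK.
  apply: le_trans (ler_enormD _ _) _; rewrite !enormZ !cabs_mkC (ger0_norm a0).
  rewrite /m !mulrDr mulr1 addrC -addrA lerD//.
    by rewrite ler_piMl// mulr_ge0 ?enorm_ge0.
  by rewrite lerDl.
(* On the second leg the derivative stays within e/4 of its value at z, so the factor 2 of
   [segment_bound] leaves e/2 for this leg and e/2 for the first one. *)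
have hA : cabs (F (z + mkC s 0 *: w + mkC s 0 *: v) - F (z + mkC s 0 *: w) -
    mkC s 0 * rderive v F z) <= 2 * (`|s| * (e / 4)).
  apply: (segment_bound (D := fun a => mkC s 0 *
    rderive v F (z + mkC s 0 *: w + mkC a 0 *: (mkC s 0 *: v)))).
    move=> a /hs ha; apply/is_rderive_scale/rderivableP/h1.
    exact: le_lt_trans ha sr1.
  move=> a /hs ha; rewrite -mulrBr cabsM cabs_mkC ler_wpM2l// ltW// h2//.
  exact: le_lt_trans ha sr2.
have := h3 s sr3; rewrite !line0E (addr0 s) => hB.
rewrite /line.
have -> : F (z + mkC s 0 *: (v + w)) - F z - mkC s 0 * (rderive v F z + dw) =
   (F (z + mkC s 0 *: w + mkC s 0 *: v) - F (z + mkC s 0 *: w) - mkC s 0 * rderive v F z)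
   + (F (z + mkC s 0 *: w) - F z - mkC s 0 * dw).
  by rewrite scalerDr (addrC (_ *: v)) addrA; ring.
apply: le_trans (ler_cabsD _ _) _; move: hA hB; rewrite /line => hA hB.
apply: le_trans (lerD hA hB) _; lra.
Qed.

End Directional.

Section ContinuityRules.
Context {R : realType} {n : nat}.
Local Notation C := (Cplx R).
Local Notation V := (Cn R n).
Implicit Types (z w v u : V) (F G : V -> C).

Lemma continuousD F G z : {for z, continuous F} -> {for z, continuous G} ->
  {for z, continuous (fun w => F w + G w)}.
Proof. by move=> hF hG; exact (@cvgD C C V (nbhs z) (nbhs_filter z) F G _ _ hF hG). Qed.
Lemma continuousM F G z : {for z, continuous F} -> {for z, continuous G} ->
  {for z, continuous (fun w => F w * G w)}.
Proof. by move=> hF hG; exact (@cvgM C V (nbhs z) (nbhs_filter z) F G _ _ hF hG). Qed.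
Lemma continuousV F z : F z != 0 -> {for z, continuous F} ->
  {for z, continuous (fun w => (F w)^-1)}.
Proof. by move=> F0 hF; exact (@cvgV C V (nbhs z) (nbhs_filter z) F _ F0 hF). Qed.
Lemma continuousJ F z : {for z, continuous F} ->
  {for z, continuous (fun w => (F w)^*)}.
Proof.
move=> /continuousVP h; apply/continuousVP => e /h[d d0 hd]; exists d => // w /hd.
by rewrite -raddfB /= cabsJ.
Qed.
Lemma continuous_near F G z : (\forall w \near z, F w = G w) ->
  {for z, continuous F} -> {for z, continuous G}.
Proof.
move=> FG; rewrite /prop_for /continuous_at -(nbhs_singleton FG).
by apply: cvg_trans; apply: (@near_eq_cvg _ _ (nbhs z) (nbhs_filter z)); apply: filterS FG => w ->.
Qed.
Lemma continuous_Re_gt F z (a : R) : {for z, continuous F} -> a < cRe (F z) ->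
  \forall w \near z, a < cRe (F w).
Proof.
move=> /continuousVP h az; have e0 : 0 < cRe (F z) - a by rewrite subr_gt0.
have [d d0 hd] := h _ e0; apply/nbhs_enormP; exists d => // w /hd.
have := cRe_le (F w - F z); rewrite cReB ler_norml => /andP[h1 _]; lra.
Qed.

Lemma continuous_cpow F z (s : R) : 0 < cRe (F z) -> {for z, continuous F} ->
  {for z, continuous (fun w => cpow (F w) s)}.
Proof.
move=> F0 hF; have hn := continuous_Re_gt hF F0.
apply: (@continuous_near (fun w => mkC
    (expR (s / 2 * ln (cRe (F w) ^+ 2 + cIm (F w) ^+ 2)) * cos (s * atan (cIm (F w) / cRe (F w))))
    (expR (s / 2 * ln (cRe (F w) ^+ 2 + cIm (F w) ^+ 2)) * sin (s * atan (cIm (F w) / cRe (F w)))))).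
  by apply: filterS hn => w /cpowE ->.
have FF : Filter (nbhs z) := nbhs_filter z.
have hr : cRe (F w) @[w --> nbhs z] --> cRe (F z) := @cvg_cRe _ _ (nbhs z) FF F _ hF.
have hi : cIm (F w) @[w --> nbhs z] --> cIm (F z) := @cvg_cIm _ _ (nbhs z) FF F _ hF.
have [a a0 b0] : exists2 a, a = cRe (F z) & 0 < a by exists (cRe (F z)).
set b := cIm (F z) in hi; rewrite -a0 in hr.
have N0 : 0 < a ^+ 2 + b ^+ 2 by rewrite ltr_pwDl ?sqr_ge0// exprn_gt0.
have hN : (cRe (F w) ^+ 2 + cIm (F w) ^+ 2) @[w --> nbhs z] --> a ^+ 2 + b ^+ 2.
  exact (@cvgD R R V (nbhs z) FF (fun w => cRe (F w) ^+ 2) (fun w => cIm (F w) ^+ 2) _ _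
    (@cvgM R V (nbhs z) FF _ _ _ _ hr hr) (@cvgM R V (nbhs z) FF _ _ _ _ hi hi)).
have hL := @continuous_cvg V R R (nbhs z) FF _ (@ln R) _ (continuous_ln N0) hN.
have hE := @continuous_cvg V R R (nbhs z) FF _ (@expR R) _ (@continuous_expR R _)
  (@cvgMl_tmp R V (nbhs z) FF _ (s / 2) _ hL).
have hQ := @cvgM R V (nbhs z) FF _ _ _ _ hi (@cvgV R V (nbhs z) FF _ _ (lt0r_neq0 b0) hr).
have hT := @continuous_cvg V R R (nbhs z) FF _ (@atan R) _ (@continuous_atan R _) hQ.
have hA := @cvgMl_tmp R V (nbhs z) FF _ s _ hT.
have hC := @continuous_cvg V R R (nbhs z) FF _ (@cos R) _ (@continuous_cos R _) hA.
have hS := @continuous_cvg V R R (nbhs z) FF _ (@sin R) _ (@continuous_sin R _) hA.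
apply: (@cvg_cReIm _ _ (nbhs z)); rewrite !cE -a0.
  exact (@cvgM R V (nbhs z) FF _ _ _ _ hE hC).
exact (@cvgM R V (nbhs z) FF _ _ _ _ hE hS).
Qed.

End ContinuityRules.

(** * Smooth families of functions *)

Section Families.
Context {R : realType} {n : nat} {P : Type}.
Local Notation C := (Cplx R).
Local Notation V := (Cn R n).
Implicit Types (A : set P) (U W : set V) (z w v u : V) (F G : P -> V -> C).

Definition loc_bounded A G z := exists M : R, \forall w \near z,
  forall p, A p -> cabs (G p w) <= M.

(* Derivatives up to order k exist, are continuous, and are locally bounded
   uniformly in the parameter p: this is what makes differentiation under the
   integral sign and constants independent of p possible. *)
Fixpoint Cfamily k A U G : Prop :=
  [/\ forall p z, A p -> U z -> {for z, continuous (G p)},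
      forall z, U z -> loc_bounded A G z &
      if k is k'.+1 then
        forall v, (forall p z, A p -> U z -> rderivable (G p) v z) /\
          Cfamily k' A U (fun p => rderive v (G p))
      else True].

Lemma Cfamily_cont k A U G : Cfamily k A U G ->
  forall p z, A p -> U z -> {for z, continuous (G p)}.
Proof. by case: k => [|k] []. Qed.
Lemma Cfamily_bound k A U G : Cfamily k A U G ->
  forall z, U z -> loc_bounded A G z.
Proof. by case: k => [|k] []. Qed.
Lemma Cfamily_der k A U G : Cfamily k.+1 A U G ->
  forall v p z, A p -> U z -> is_rderive (G p) v z (rderive v (G p) z).
Proof. by move=> [_ _ h] v p z Ap Uz; apply: rderivableP; exact: (h v).1. Qed.
Lemma Cfamily_rderive k A U G : Cfamily k.+1 A U G ->
  forall v, Cfamily k A U (fun p => rderive v (G p)).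
Proof. by move=> [_ _ h] v; exact: (h v).2. Qed.

Lemma CfamilyS k A U G : Cfamily k.+1 A U G -> Cfamily k A U G.
Proof.
elim: k G => [|k IH] G [h1 h2 h3]; split => // v.
by split; [exact: (h3 v).1|apply: IH; exact: (h3 v).2].
Qed.

Lemma Cfamily_subset k A B U W G : A `<=` B -> W `<=` U ->
  Cfamily k B U G -> Cfamily k A W G.
Proof.
move=> AB WU; elim: k G => [|k IH] G [h1 h2 h3]; split => //.
- by move=> p z /AB Bp /WU Uz; exact: h1.
- move=> z /WU /h2[M hM]; exists M; apply: filterS hM => w hw p /AB; exact: hw.
- by move=> p z /AB Bp /WU Uz; exact: h1.
- move=> z /WU /h2[M hM]; exists M; apply: filterS hM => w hw p /AB; exact: hw.
- move=> v; split; last by apply: IH; exact: (h3 v).2.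
  by move=> p z /AB Bp /WU Uz; exact: (h3 v).1.
Qed.

Lemma open_near U z : open U -> U z -> \forall w \near z, U w.
Proof. by move=> oU Uz; exact: open_nbhs_nbhs. Qed.

Lemma loc_bounded_near A F G z :
  (\forall w \near z, forall p, A p -> F p w = G p w) ->
  loc_bounded A F z -> loc_bounded A G z.
Proof.
move=> h [M hM]; exists M; apply: filterS2 h hM => w e hw p Ap.
by rewrite -e// hw.
Qed.

Lemma Cfamily_eq k A U F G : open U ->
  (forall p z, A p -> U z -> F p z = G p z) -> Cfamily k A U F -> Cfamily k A U G.
Proof.
move=> oU; elim: k F G => [|k IH] F G FG [h1 h2 h3].
all: have FGn p z : A p -> U z -> \forall w \near z, F p w = G p w.
1,3: by move=> Ap Uz; apply: filterS (open_near oU Uz) => w; exact: FG.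
all: split.
- by move=> p z Ap Uz; apply: continuous_near (h1 p z Ap Uz); exact: FGn.
- move=> z Uz; apply: loc_bounded_near (h2 z Uz).
  by apply: filterS (open_near oU Uz) => w Uw p Ap; exact: FG.
- by [].
- by move=> p z Ap Uz; apply: continuous_near (h1 p z Ap Uz); exact: FGn.
- move=> z Uz; apply: loc_bounded_near (h2 z Uz).
  by apply: filterS (open_near oU Uz) => w Uw p Ap; exact: FG.
- move=> v; split.
    by move=> p z Ap Uz; exact: (rderive_near (FGn p z Ap Uz) ((h3 v).1 p z Ap Uz)).1.
  apply: IH (h3 v).2 => p z Ap Uz.
  by rewrite (rderive_near (FGn p z Ap Uz) ((h3 v).1 p z Ap Uz)).2.
Qed.

Lemma Cfamily_cst k A U (c : P -> C) (M : R) : open U ->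
  (forall p, A p -> cabs (c p) <= M) -> Cfamily k A U (fun p _ => c p).
Proof.
move=> oU; elim: k c M => [|k IH] c M hM; split.
- by move=> p z _ _; exact: continuous_cst.
- by move=> z _; exists M; apply: filterE => w; exact: hM.
- by [].
- by move=> p z _ _; exact: continuous_cst.
- by move=> z _; exists M; apply: filterE => w; exact: hM.
- move=> v; split=> [p z Ap Uz|]; first by case: (is_rderiveP (is_rderive_cst (c p) v z)).
  apply: (@Cfamily_eq _ _ _ (fun _ _ => 0)) => //.
    by move=> p z Ap Uz; rewrite (is_rderive_val (is_rderive_cst (c p) v z)).
  by apply: (IH _ 0) => p _; rewrite cabs0.
Qed.

Lemma loc_boundedD A F G z : loc_bounded A F z -> loc_bounded A G z ->
  loc_bounded A (fun p w => F p w + G p w) z.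
Proof.
move=> [M hM] [N hN]; exists (M + N); apply: filterS2 hM hN => w h1 h2 p Ap.
by apply: le_trans (ler_cabsD _ _) _; rewrite lerD ?h1 ?h2.
Qed.

Lemma loc_boundedM A F G z : loc_bounded A F z -> loc_bounded A G z ->
  loc_bounded A (fun p w => F p w * G p w) z.
Proof.
move=> [M hM] [N hN]; exists (M * N); apply: filterS2 hM hN => w h1 h2 p Ap.
by rewrite cabsM ler_pM ?cabs_ge0 ?h1 ?h2.
Qed.

Lemma CfamilyD k A U F G : open U -> Cfamily k A U F -> Cfamily k A U G ->
  Cfamily k A U (fun p w => F p w + G p w).
Proof.
move=> oU; elim: k F G => [|k IH] F G hF hG; split.
- move=> p z Ap Uz; exact: continuousD (Cfamily_cont hF Ap Uz) (Cfamily_cont hG Ap Uz).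
- move=> z Uz; exact: loc_boundedD (Cfamily_bound hF Uz) (Cfamily_bound hG Uz).
- by [].
- move=> p z Ap Uz; exact: continuousD (Cfamily_cont hF Ap Uz) (Cfamily_cont hG Ap Uz).
- move=> z Uz; exact: loc_boundedD (Cfamily_bound hF Uz) (Cfamily_bound hG Uz).
- have D v p z Ap Uz := is_rderiveP (is_rderiveD (@Cfamily_der _ _ _ _ hF v p z Ap Uz)
    (@Cfamily_der _ _ _ _ hG v p z Ap Uz)).
  move=> v; split=> [p z Ap Uz|]; first by have [] := D v p z Ap Uz.
  apply: (Cfamily_eq oU _ (IH _ _ (Cfamily_rderive hF v) (Cfamily_rderive hG v))).
  by move=> p z Ap Uz; have [_ ->] := D v p z Ap Uz.
Qed.

Lemma CfamilyM k A U F G : open U -> Cfamily k A U F -> Cfamily k A U G ->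
  Cfamily k A U (fun p w => F p w * G p w).
Proof.
move=> oU; elim: k F G => [|k IH] F G hF hG; split.
- move=> p z Ap Uz; exact: continuousM (Cfamily_cont hF Ap Uz) (Cfamily_cont hG Ap Uz).
- move=> z Uz; exact: loc_boundedM (Cfamily_bound hF Uz) (Cfamily_bound hG Uz).
- by [].
- move=> p z Ap Uz; exact: continuousM (Cfamily_cont hF Ap Uz) (Cfamily_cont hG Ap Uz).
- move=> z Uz; exact: loc_boundedM (Cfamily_bound hF Uz) (Cfamily_bound hG Uz).
- have D v p z Ap Uz := is_rderiveP (is_rderiveM (@Cfamily_der _ _ _ _ hF v p z Ap Uz)
    (@Cfamily_der _ _ _ _ hG v p z Ap Uz)).
  move=> v; split=> [p z Ap Uz|]; first by have [] := D v p z Ap Uz.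
  apply: (Cfamily_eq oU _ (CfamilyD oU (IH _ _ (Cfamily_rderive hF v) (CfamilyS hG))
     (IH _ _ (CfamilyS hF) (Cfamily_rderive hG v)))).
  by move=> p z Ap Uz; have [_ ->] := D v p z Ap Uz.
Qed.

Lemma CfamilyJ k A U F : open U -> Cfamily k A U F ->
  Cfamily k A U (fun p w => (F p w)^*).
Proof.
have B G z : loc_bounded A G z -> loc_bounded A (fun p w => (G p w)^*) z.
  by move=> [M hM]; exists M; apply: filterS hM => w hw p Ap; rewrite cabsJ hw.
move=> oU; elim: k F => [|k IH] F hF; split.
- by move=> p z Ap Uz; exact: continuousJ (Cfamily_cont hF Ap Uz).
- by move=> z Uz; apply: B; exact: Cfamily_bound hF z Uz.
- by [].
- by move=> p z Ap Uz; exact: continuousJ (Cfamily_cont hF Ap Uz).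
- by move=> z Uz; apply: B; exact: Cfamily_bound hF z Uz.
- have D v p z Ap Uz := is_rderiveP (is_rderiveJ (@Cfamily_der _ _ _ _ hF v p z Ap Uz)).
  move=> v; split=> [p z Ap Uz|]; first by have [] := D v p z Ap Uz.
  apply: (Cfamily_eq oU _ (IH _ (Cfamily_rderive hF v))).
  by move=> p z Ap Uz; have [_ ->] := D v p z Ap Uz.
Qed.

(** The counterpart of [loc_bounded] from below: what inverses and powers need in order to remain
    families with uniform bounds. *)
Definition loc_away A (F : P -> V -> R) z := exists2 c : R, 0 < c &
  \forall w \near z, forall p, A p -> c <= F p w.

Lemma CfamilyV k A U F : open U ->
  (forall z, U z -> loc_away A (fun p w => cabs (F p w)) z) ->
  Cfamily k A U F -> Cfamily k A U (fun p w => (F p w)^-1).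
Proof.
move=> oU hA.
have F0 p z : A p -> U z -> F p z != 0.
  move=> Ap /hA[c c0 /nbhs_singleton hc]; rewrite -cabs_gt0.
  exact: lt_le_trans c0 (hc p Ap).
have B z : U z -> loc_bounded A (fun p w => (F p w)^-1) z.
  move=> /hA[c c0 hc]; exists c^-1; apply: filterS hc => w hw p Ap.
  by rewrite cabsV lef_pV2 ?posrE ?hw//; exact: lt_le_trans c0 (hw p Ap).
elim: k => [|k IH] hF; split.
- by move=> p z Ap Uz; apply: continuousV (F0 p z Ap Uz) (Cfamily_cont hF Ap Uz).
- exact: B.
- by [].
- by move=> p z Ap Uz; apply: continuousV (F0 p z Ap Uz) (Cfamily_cont hF Ap Uz).
- exact: B.
- have D v p z Ap Uz := is_rderiveP (is_rderiveV (F0 p z Ap Uz)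
    (@Cfamily_der _ _ _ _ hF v p z Ap Uz)).
  move=> v; split=> [p z Ap Uz|]; first by have [] := D v p z Ap Uz.
  have hV := IH (CfamilyS hF).
  have hm : Cfamily k A U (fun _ _ => -1).
    by apply: (@Cfamily_cst _ _ _ (fun _ => -1) 1) => // p _; rewrite cabsN cabs1.
  apply: (Cfamily_eq oU _ (CfamilyM oU (CfamilyM oU hm (Cfamily_rderive hF v))
     (CfamilyM oU hV hV))).
  by move=> p z Ap Uz; have [_ ->] := D v p z Ap Uz; rewrite mulN1r expr2 invfM.
Qed.

Lemma Cfamily_hdot k A U (a : P -> V) (M : R) : open U ->
  (forall p, A p -> enorm (a p) <= M) -> Cfamily k A U (fun p z => hdot z (a p)).
Proof.
move=> oU hM.
have B z : U z -> loc_bounded A (fun p w => hdot w (a p)) z.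
  move=> Uz; exists ((enorm z + 1) * M); apply/nbhs_enormP; exists 1 => // w hw p Ap.
  apply: le_trans (CauchySchwarz _ _) _; rewrite ler_pM ?enorm_ge0 ?hM//.
  by have := ler_enormD (w - z) z; rewrite subrK; lra.
case: k => [|k]; split.
- by move=> p z _ _; exact: continuous_hdot.
- exact: B.
- by [].
- by move=> p z _ _; exact: continuous_hdot.
- exact: B.
- move=> v; split=> [p z Ap Uz|]; first by case: (is_rderiveP (is_rderive_hdot (a p) v z)).
  apply: (@Cfamily_eq _ _ _ (fun p _ => hdot v (a p))) => //.
    by move=> p z Ap Uz; rewrite (is_rderive_val (is_rderive_hdot (a p) v z)).
  apply: (@Cfamily_cst _ _ _ _ (enorm v * M)) => // p Ap.
  by apply: le_trans (CauchySchwarz _ _) _; rewrite ler_wpM2l ?enorm_ge0 ?hM.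
Qed.

(** Whether x^s increases or decreases depends on the sign of s; the sum of the two end values
    serves in both cases. *)
Lemma powR_le_add (x a b s : R) : 0 < a -> a <= x <= b -> x `^ s <= a `^ s + b `^ s.
Proof.
move=> a0 /andP[ax xb]; have x0 := lt_le_trans a0 ax.
have [s0|s0] := leP 0 s.
  rewrite -[leLHS]add0r lerD ?powR_ge0//.
  by apply: ge0_ler_powR; rewrite ?nnegrE// ltW// (lt_le_trans x0).
rewrite -[leLHS]addr0 lerD ?powR_ge0//.
rewrite -[s]opprK (powRN x (- s)) (powRN a (- s)) lef_pV2 ?posrE ?powR_gt0//.
by apply: ge0_ler_powR; rewrite ?nnegrE ?oppr_ge0//; exact: ltW.
Qed.

Lemma Cfamily_cpow k A U F (s : R) : open U ->
  (forall z, U z -> loc_away A (fun p w => cRe (F p w)) z) ->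
  Cfamily k A U F -> Cfamily k A U (fun p w => cpow (F p w) s).
Proof.
move=> oU hA.
have hA' z : U z -> loc_away A (fun p w => cabs (F p w)) z.
  move=> /hA[c c0 hc]; exists c => //; apply: filterS hc => w hw p Ap.
  exact: le_trans (hw p Ap) (cRe_normle _).
have F0 p z : A p -> U z -> 0 < cRe (F p z).
  move=> Ap /hA[c c0 /nbhs_singleton hc]; exact: lt_le_trans c0 (hc p Ap).
have B z : U z -> loc_bounded A F z -> loc_bounded A (fun p w => cpow (F p w) s) z.
  move=> /hA'[c c0 hc] [M hM]; exists (c `^ s + M `^ s).
  apply: filterS2 hc hM => w h1 h2 p Ap.
  by rewrite cabs_cpow powR_le_add// h1 ?h2.
elim: k => [|k IH] hF; split.
- by move=> p z Ap Uz; apply: continuous_cpow (F0 p z Ap Uz) (Cfamily_cont hF Ap Uz).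
- by move=> z Uz; apply: B => //; exact: Cfamily_bound hF z Uz.
- by [].
- by move=> p z Ap Uz; apply: continuous_cpow (F0 p z Ap Uz) (Cfamily_cont hF Ap Uz).
- by move=> z Uz; apply: B => //; exact: Cfamily_bound hF z Uz.
- have D v p z Ap Uz := is_rderiveP (is_rderive_cpow s (F0 p z Ap Uz)
    (@Cfamily_der _ _ _ _ hF v p z Ap Uz)).
  move=> v; split=> [p z Ap Uz|]; first by have [] := D v p z Ap Uz.
  have hs : Cfamily k A U (fun _ _ => mkC s 0).
    by apply: (@Cfamily_cst _ _ _ (fun _ => mkC s 0) `|s|) => // p _; rewrite cabs_mkC.
  apply: (Cfamily_eq oU _ (CfamilyM oU (CfamilyM oU (CfamilyM oU hs (IH (CfamilyS hF)))
    (CfamilyV oU hA' (CfamilyS hF))) (Cfamily_rderive hF v))).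
  by move=> p z Ap Uz; have [_ ->] := D v p z Ap Uz.
Qed.

End Families.

Section SmoothFamilies.
Context {R : realType} {n : nat} {P : Type}.
Local Notation C := (Cplx R).
Local Notation V := (Cn R n).
Implicit Types (A : set P) (U W : set V) (z w v u : V) (F G : P -> V -> C).

(** A single U serves all k: smoothness at z then holds at every point of U, which neighbourhoods
    shrinking with k would not give. *)
Definition smooth_family A z G := exists U : set V,
  [/\ open U, U z & forall k, Cfamily k A U G].

Lemma smooth_family_near A z G : smooth_family A z G ->
  \forall w \near z, smooth_family A w G.
Proof.
move=> [U [oU Uz hU]]; apply: filterS (open_near oU Uz) => w Uw.
by exists U.
Qed.

Lemma smooth_family_eq A z F G :
  (\forall w \near z, forall p, A p -> F p w = G p w) ->
  smooth_family A z F -> smooth_family A z G.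
Proof.
move=> /nbhs_enormP[r r0 h] [U [oU Uz hU]].
have [W [oW Wz WU]] : exists W : set V, [/\ open W, W z & W `<=` U `&` [set w | enorm (w - z) < r]].
  have : nbhs z (U `&` [set w | enorm (w - z) < r]).
    by apply: filterI; [exact: open_near|exact: nbhs_enorm].
  by rewrite nbhsE => -[W [oW Wz] hW]; exists W.
exists W; split => // k; apply: (@Cfamily_eq _ _ _ k A W F) => //.
  by move=> p w Ap /WU[_ /h]; exact.
by apply: Cfamily_subset (hU k) => // w /WU[].
Qed.

Lemma smooth_family_op2 A z F G H :
  (forall k U, open U -> Cfamily k A U F -> Cfamily k A U G -> Cfamily k A U H) ->
  smooth_family A z F -> smooth_family A z G -> smooth_family A z H.
Proof.
move=> h [U [oU Uz hU]] [W [oW Wz hW]]; exists (U `&` W); split => //.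
  exact: openI.
move=> k; apply: h; first exact: openI.
  by apply: Cfamily_subset (hU k) => // ? [].
by apply: Cfamily_subset (hW k) => // ? [].
Qed.

Lemma smooth_familyD A z F G : smooth_family A z F -> smooth_family A z G ->
  smooth_family A z (fun p w => F p w + G p w).
Proof. by apply: smooth_family_op2 => k U; exact: CfamilyD. Qed.
Lemma smooth_familyM A z F G : smooth_family A z F -> smooth_family A z G ->
  smooth_family A z (fun p w => F p w * G p w).
Proof. by apply: smooth_family_op2 => k U; exact: CfamilyM. Qed.
Lemma smooth_familyJ A z F : smooth_family A z F ->
  smooth_family A z (fun p w => (F p w)^*).
Proof.
by move=> hF; apply: (smooth_family_op2 _ hF hF) => k U oU h _; exact: CfamilyJ.
Qed.
Lemma smooth_family_cst A z (c : P -> C) (M : R) :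
  (forall p, A p -> cabs (c p) <= M) -> smooth_family A z (fun p _ => c p).
Proof.
move=> h; exists setT; split => //; first exact: openT.
by move=> k; apply: Cfamily_cst h; exact: openT.
Qed.
Lemma smooth_family_hdot A z (a : P -> V) (M : R) :
  (forall p, A p -> enorm (a p) <= M) -> smooth_family A z (fun p w => hdot w (a p)).
Proof.
move=> h; exists setT; split => //; first exact: openT.
by move=> k; apply: Cfamily_hdot h; exact: openT.
Qed.

Lemma loc_away_near A (F : P -> V -> R) z : loc_away A F z ->
  \forall w \near z, loc_away A F w.
Proof.
move=> [c c0 /nbhs_enormP[r r0 h]]; have r2 : 0 < r / 2 by rewrite divr_gt0.
apply/nbhs_enormP; exists (r / 2) => // w hw; exists c => //.
apply/nbhs_enormP; exists (r / 2) => // u hu; apply: h.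
have := ler_enormD (u - w) (w - z); rewrite addrA subrK.
by move: hw hu; lra.
Qed.

Lemma open_subnear z (A : set V) : nbhs z A -> exists W : set V,
  [/\ open W, W z & W `<=` A].
Proof. by rewrite nbhsE => -[W [oW Wz] h]; exists W. Qed.

Lemma smooth_familyV A z F : loc_away A (fun p w => cabs (F p w)) z ->
  smooth_family A z F -> smooth_family A z (fun p w => (F p w)^-1).
Proof.
move=> /loc_away_near/open_subnear[W [oW Wz hW]] [U [oU Uz hU]].
exists (U `&` W); split => //; first exact: openI.
move=> k; apply: CfamilyV; first exact: openI.
  by move=> w [_ /hW].
by apply: Cfamily_subset (hU k) => // ? [].
Qed.

Lemma smooth_family_cpow A z F (s : R) : loc_away A (fun p w => cRe (F p w)) z ->
  smooth_family A z F -> smooth_family A z (fun p w => cpow (F p w) s).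
Proof.
move=> /loc_away_near/open_subnear[W [oW Wz hW]] [U [oU Uz hU]].
exists (U `&` W); split => //; first exact: openI.
move=> k; apply: Cfamily_cpow; first exact: openI.
  by move=> w [_ /hW].
by apply: Cfamily_subset (hU k) => // ? [].
Qed.

Lemma smooth_family_sum A z (I : Type) (s : seq I) (Q : pred I) (F : I -> P -> V -> C) :
  (forall i, Q i -> smooth_family A z (F i)) ->
  smooth_family A z (fun p w => \sum_(i <- s | Q i) F i p w).
Proof.
move=> h; elim: s => [|i s IH].
  apply: (@smooth_family_eq _ _ (fun _ _ => 0)).
    by apply: filterE => w p _; rewrite big_nil.
  by apply: (@smooth_family_cst _ _ _ 0) => p _; rewrite cabs0.
have [Qi|Qi] := boolP (Q i); last first.
  by apply: smooth_family_eq IH; apply: filterE => w p _; rewrite big_cons (negbTE Qi).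
apply: smooth_family_eq (smooth_familyD (h i Qi) IH).
by apply: filterE => w p _; rewrite big_cons Qi.
Qed.

Lemma smooth_family_exp A z F k : smooth_family A z F ->
  smooth_family A z (fun p w => F p w ^+ k).
Proof.
move=> h; elim: k => [|k IH].
  by apply: (@smooth_family_cst _ _ (fun _ => 1) 1) => p _; rewrite cabs1.
apply: smooth_family_eq (smooth_familyM h IH).
by apply: filterE => w p _; rewrite exprS.
Qed.

Lemma smooth_family_prod A z (I : Type) (s : seq I) (F : I -> P -> V -> C) :
  (forall i, smooth_family A z (F i)) ->
  smooth_family A z (fun p w => \prod_(i <- s) F i p w).
Proof.
move=> h; elim: s => [|i s IH].
  apply: (@smooth_family_eq _ _ (fun _ _ => 1)).
    by apply: filterE => w p _; rewrite big_nil.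
  by apply: (@smooth_family_cst _ _ _ 1) => p _; rewrite cabs1.
apply: smooth_family_eq (smooth_familyM (h i) IH).
by apply: filterE => w p _; rewrite big_cons.
Qed.

Lemma smooth_family_rderive A z G v : smooth_family A z G ->
  smooth_family A z (fun p => rderive v (G p)).
Proof.
by move=> [U [oU Uz hU]]; exists U; split => // k; exact: Cfamily_rderive (hU k.+1) v.
Qed.

Lemma smooth_family_is_rderive A z G v p : smooth_family A z G -> A p ->
  is_rderive (G p) v z (rderive v (G p) z).
Proof. by move=> [U [oU Uz hU]] Ap; exact: (Cfamily_der (hU 1%N)). Qed.

Lemma smooth_family_continuous A z G p : smooth_family A z G -> A p ->
  {for z, continuous (G p)}.
Proof. by move=> [U [oU Uz hU]] Ap; exact: (Cfamily_cont (hU 0%N)). Qed.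

End SmoothFamilies.

(** * Smoothness of a single function at a point *)

Section SmoothPoint.
Context {R : realType} {n : nat}.
Local Notation C := (Cplx R).
Local Notation V := (Cn R n).
Implicit Types (U W : set V) (z w v u : V) (F G : V -> C).

Definition smooth_at z F := smooth_family [set: unit] z (fun _ => F).

Lemma smooth_at_const {P : Type} (A : set P) z F : smooth_at z F ->
  smooth_family A z (fun _ => F).
Proof.
move=> [U [oU Uz hU]]; exists U; split => // k.
elim: k F hU => [|k IH] F hU.
  split => //.
    by move=> p w _ Uw; exact: (Cfamily_cont (hU 0%N) (p := tt)).
  move=> w Uw; have [M hM] := Cfamily_bound (hU 0%N) Uw.
  by exists M; apply: filterS hM => u hu p _; exact: (hu tt).
split.
- by move=> p w _ Uw; exact: (Cfamily_cont (hU 0%N) (p := tt)).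
- move=> w Uw; have [M hM] := Cfamily_bound (hU 0%N) Uw.
  by exists M; apply: filterS hM => u hu p _; exact: (hu tt).
- move=> v; split.
    move=> p w _ Uw.
    by have [] := is_rderiveP (Cfamily_der (hU 1%N) v (p := tt) I Uw).
  by apply: IH => j; exact: Cfamily_rderive (hU j.+1) v.
Qed.

Lemma smooth_at_of_family {P : Type} (A : set P) z (G : P -> V -> C) p :
  A p -> smooth_family A z G -> smooth_at z (G p).
Proof.
move=> Ap [U [oU Uz hU]]; exists U; split => // k.
elim: k G hU => [|k IH] G hU; split => //.
- by move=> _ w _ Uw; exact: (Cfamily_cont (hU 0%N)).
- move=> w Uw; have [M hM] := Cfamily_bound (hU 0%N) Uw.
  by exists M; apply: filterS hM => u hu _ _; exact: hu.
- by move=> _ w _ Uw; exact: (Cfamily_cont (hU 0%N)).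
- move=> w Uw; have [M hM] := Cfamily_bound (hU 0%N) Uw.
  by exists M; apply: filterS hM => u hu _ _; exact: hu.
- move=> v; split.
    by move=> _ w _ Uw; have [] := is_rderiveP (Cfamily_der (hU 1%N) v Ap Uw).
  by apply: (IH (fun p => rderive v (G p))) => j; exact: Cfamily_rderive (hU j.+1) v.
Qed.

(** For one function the local bounds required by [Cfamily] follow from the continuity of its
    derivatives. The induction treats all iterated derivatives, that is all lists s, at once. *)
Lemma smooth_on_at U F z : open U -> smooth_on U F -> U z -> smooth_at z F.
Proof.
move=> oU hF Uz; exists U; split => // k.
suff h s : Cfamily k [set: unit] U (fun _ => rderives s F) by exact: (h [::]).
elim: k s => [|k IH] s.
all: have hc w : U w -> {for w, continuous (rderives s F)}.
1,3: by move=> Uw; exact: (hF (size s) s w _ Uw).1.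
all: have hb w : U w -> loc_bounded [set: unit] (fun _ => rderives s F) w.
1,3: move=> /hc/continuousVP/(_ _ ltr01)[d d0 hd]; exists (cabs (rderives s F w) + 1).
1,2: apply/nbhs_enormP; exists d => // u /hd hu _ _.
1,2: have := ler_cabsD (rderives s F u - rderives s F w) (rderives s F w).
1,2: by rewrite subrK; move: hu; lra.
all: split => //.
- by move=> _ w _; exact: hc.
- by move=> _ w _; exact: hc.
move=> v; split; last exact: (IH (v :: s)).
by move=> _ w _ Uw; exact: (hF (size s).+1 s w _ Uw).2.
Qed.

Lemma smooth_at_on F U : (forall z, U z -> smooth_at z F) -> smooth_on U F.
Proof.
move=> h k s z _ Uz; have [W [oW Wz hW]] := h z Uz.
have hs : forall j, Cfamily j [set: unit] W (fun _ => rderives s F).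
  elim: s => [|v s IH] j; first exact: hW.
  exact: Cfamily_rderive (IH j.+1) v.
split; first exact: (Cfamily_cont (hs 0%N) (p := tt)).
by move=> _ v; have [] := is_rderiveP (Cfamily_der (hs 1%N) v (p := tt) I Wz).
Qed.

Lemma smooth_at_open F : open [set z | smooth_at z F].
Proof. by rewrite openE => z hz; exact: smooth_family_near. Qed.

End SmoothPoint.

(** * Weighted operators and orders *)

Section WeightedOperators.
Context {R : realType} {n : nat}.
Local Notation C := (Cplx R).
Local Notation V := (Cn R n).
Implicit Types (z w v u : V) (F G : V -> C).

Lemma rderive_near_eq F G v z : (\forall w \near z, F w = G w) ->
  rderive v F z = rderive v G z.
Proof.
move=> FG.
have h : nbhs (z + mkC 0 0 *: v) [set w | F w = G w].
  by rewrite mkC00 scale0r addr0.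
have h' := line_near h.
apply: cext; apply: near_eq_derive; apply: filterS h' => s e.
  by rewrite /line /= e.
by rewrite /line /= e.
Qed.

(* A first order operator is a sum of directional derivatives with coefficients
   that are smooth up to the boundary. Since a tangential field maps the kernel
   1 - z.zeta^* to O(d(z, zeta)^(1/2)), the last condition turns the weight into
   the order lost by the operator. *)
Record wop := WOp {
  widx : finType ;
  wcoef : widx -> V -> C ;
  wdir : widx -> V ;
  wt : R ;
  wcoef_smooth : forall i z, cball z -> smooth_at z (wcoef i) ;
  wt_ge : 2^-1 <= wt ;
  wt_le : wt <= 1 ;
  wkern : exists2 c : R, 0 <= c & forall zeta z, sphere zeta -> cball z ->
    cabs (\sum_i wcoef i z * rderive (wdir i) (kern zeta) z) <=
      c * dist z zeta `^ (1 - wt)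
}.

Definition wapply (D : wop) F z : C := \sum_i wcoef i z * rderive (wdir (w := D) i) F z.
Definition wapplys (L : seq wop) F : V -> C := foldr wapply F L.
Definition wts (L : seq wop) : R := \sum_(D <- L) wt D.

(** The last entry acts first. Inductions on a product therefore use [rcons]: the Leibniz rule is
    applied to the innermost operator, and the others act on the outcome. *)
Lemma wapplys_rcons L D F : wapplys (rcons L D) F = wapplys L (wapply D F).
Proof. by rewrite /wapplys foldr_rcons. Qed.
Lemma wts_rcons L D : wts (rcons L D) = wts L + wt D.
Proof. by rewrite /wts -cats1 big_cat big_seq1. Qed.
Lemma wts_ge0 L : 0 <= wts L.
Proof. by apply: sumr_ge0 => D _; exact: le_trans (wt_ge D). Qed.

Lemma nearW z (Q : V -> Prop) : (\forall w \near z, Q w) ->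
  \forall w \near z, \forall u \near w, Q u.
Proof.
move=> /open_subnear[W [oW Wz hW]]; apply: filterS (open_near oW Wz) => w Ww.
by apply: filterS (open_near oW Ww).
Qed.

Lemma wapply_near D F G z : (\forall w \near z, F w = G w) ->
  \forall w \near z, wapply D F w = wapply D G w.
Proof.
move=> /nearW; apply: filterS => w h.
by apply: eq_bigr => i _; rewrite (rderive_near_eq _ h).
Qed.
Lemma wapplys_near L F G z : (\forall w \near z, F w = G w) ->
  \forall w \near z, wapplys L F w = wapplys L G w.
Proof. by move=> h; elim: L => //= D L; exact: wapply_near. Qed.
Lemma wapplys_near_eq L F G z : (\forall w \near z, F w = G w) ->
  wapplys L F z = wapplys L G z.
Proof. by move=> /(wapplys_near L)/nbhs_singleton. Qed.

Lemma smooth_family_wapply {P : Type} (A : set P) D z (G : P -> V -> C) : cball z ->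
  smooth_family A z G -> smooth_family A z (fun p => wapply D (G p)).
Proof.
move=> bz hG; apply: smooth_family_sum => i _; apply: smooth_familyM.
  exact/smooth_at_const/wcoef_smooth.
exact: smooth_family_rderive.
Qed.
Lemma smooth_at_wapply D z F : cball z -> smooth_at z F -> smooth_at z (wapply D F).
Proof. exact: smooth_family_wapply. Qed.
Lemma smooth_at_wapplys L z F : cball z -> smooth_at z F -> smooth_at z (wapplys L F).
Proof. by move=> bz h; elim: L => //= D L; exact: smooth_at_wapply. Qed.

Lemma smooth_at_is_rderive z F v : smooth_at z F -> is_rderive F v z (rderive v F z).
Proof. by move=> h; exact: (smooth_family_is_rderive v h (p := tt) I). Qed.
Lemma smooth_at_near z F : smooth_at z F -> \forall w \near z, smooth_at w F.
Proof. exact: smooth_family_near. Qed.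
Lemma smooth_at_continuous z F : smooth_at z F -> {for z, continuous F}.
Proof. by move=> h; exact: (smooth_family_continuous h (p := tt) I). Qed.
Lemma smooth_atD z F G : smooth_at z F -> smooth_at z G ->
  smooth_at z (fun w => F w + G w).
Proof. exact: smooth_familyD. Qed.
Lemma smooth_atM z F G : smooth_at z F -> smooth_at z G ->
  smooth_at z (fun w => F w * G w).
Proof. exact: smooth_familyM. Qed.
Lemma smooth_at_cst z (c : C) : smooth_at z (fun _ => c).
Proof. exact: (@smooth_family_cst _ _ _ _ _ (fun _ => c) (cabs c)). Qed.
Lemma smooth_at_eq z F G : (\forall w \near z, F w = G w) -> smooth_at z F -> smooth_at z G.
Proof. by move=> h; apply: smooth_family_eq; apply: filterS h => w e p _. Qed.
Lemma loc_away_continuous {P : Type} (A : set P) z (F : V -> R) : {for z, continuous F} ->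
  0 < F z -> loc_away A (fun _ => F) z.
Proof.
move=> /continuousVRP h F0; have e0 : 0 < F z / 2 by rewrite divr_gt0.
have [d d0 hd] := h _ e0; exists (F z / 2) => //; apply/nbhs_enormP; exists d => // w /hd.
by rewrite ltr_norml => /andP[h1 _] _ _; lra.
Qed.
Lemma smooth_atV z F : F z != 0 -> smooth_at z F -> smooth_at z (fun w => (F w)^-1).
Proof.
move=> F0 h; apply: smooth_familyV => //.
apply: (@loc_away_continuous _ _ _ (fun w => cabs (F w))); last by rewrite cabs_gt0.
exact/continuous_cabs/smooth_at_continuous.
Qed.

Lemma wapplyD D F G z : smooth_at z F -> smooth_at z G ->
  wapply D (fun w => F w + G w) z = wapply D F z + wapply D G z.
Proof.
move=> hF hG; rewrite /wapply -big_split; apply: eq_bigr => i _ /=.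
rewrite (is_rderive_val (is_rderiveD (smooth_at_is_rderive _ hF) (smooth_at_is_rderive _ hG))).
by rewrite mulrDr.
Qed.
Lemma wapplyM D F G z : smooth_at z F -> smooth_at z G ->
  wapply D (fun w => F w * G w) z = wapply D F z * G z + F z * wapply D G z.
Proof.
move=> hF hG; rewrite /wapply mulr_suml mulr_sumr -big_split; apply: eq_bigr => i _ /=.
rewrite (is_rderive_val (is_rderiveM (smooth_at_is_rderive _ hF) (smooth_at_is_rderive _ hG))).
by rewrite mulrDr mulrA mulrCA.
Qed.
Lemma wapply_cst D (c : C) z : wapply D (fun _ => c) z = 0.
Proof.
by apply: big1 => i _; rewrite (is_rderive_val (is_rderive_cst _ _ _)) mulr0.
Qed.
Lemma wapplyV D F z : F z != 0 -> smooth_at z F ->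
  wapply D (fun w => (F w)^-1) z = - (wapply D F z * ((F z)^-1 * (F z)^-1)).
Proof.
move=> F0 hF; rewrite /wapply mulr_suml -sumrN; apply: eq_bigr => i _ /=.
rewrite (is_rderive_val (is_rderiveV F0 (smooth_at_is_rderive _ hF))).
by rewrite expr2 invfM mulNr mulrN mulrA.
Qed.
Lemma wapply_cpow D F z (s : R) : 0 < cRe (F z) -> smooth_at z F ->
  wapply D (fun w => cpow (F w) s) z =
    mkC s 0 * cpow (F z) s * (F z)^-1 * wapply D F z.
Proof.
move=> F0 hF; rewrite /wapply mulr_sumr; apply: eq_bigr => i _ /=.
rewrite (is_rderive_val (is_rderive_cpow s F0 (smooth_at_is_rderive _ hF))).
by rewrite mulrCA.
Qed.
Lemma wapplysD L F G z : cball z -> smooth_at z F -> smooth_at z G ->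
  wapplys L (fun w => F w + G w) z = wapplys L F z + wapplys L G z.
Proof.
elim/last_ind: L F G z => // L D IH F G z bz hF hG; rewrite !wapplys_rcons.
rewrite -IH//; [|exact: smooth_at_wapply..].
apply: wapplys_near_eq; apply: filterS2 (smooth_at_near hF) (smooth_at_near hG) => w.
exact: wapplyD.
Qed.

End WeightedOperators.

Lemma powRDp (R : realType) (x r s : R) : 0 < x -> x `^ (r + s) = x `^ r * x `^ s.
Proof.
move=> x0; apply: powRD; apply/implyP => _; exact: lt0r_neq0.
Qed.

(** * Calculus of orders in a gauge *)

Section Order.
Context {R : realType} {n : nat} {P : Type}.
Local Notation C := (Cplx R).
Local Notation V := (Cn R n).
Local Notation wop := (@wop R n).
Variables (dom : P -> V -> Prop) (g : P -> V -> R).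
Hypothesis dom_cball : forall p z, dom p z -> cball z.
Hypothesis g_gt0 : forall p z, dom p z -> 0 < g p z.
Hypothesis g_le2 : forall p z, dom p z -> g p z <= 2.
Implicit Types (z w : V) (M : P -> V -> R) (m : R) (F G : P -> V -> C) (L : seq wop).

(* F has order m in the gauge g, with prefactor M, when every product L of at most
   k operators gives L F = O(M g^(m - w(L))).  By the Leibniz rule orders add up
   under products. *)
Definition order_upto k M m F :=
  (forall p z, dom p z -> smooth_at z (F p)) /\
  forall L, (size L <= k)%N -> exists2 c : R, 0 <= c & forall p z, dom p z ->
    cabs (wapplys L (F p) z) <= c * M p z * g p z `^ (m - wts L).

Lemma order_upto_smooth k M m F p z : order_upto k M m F -> dom p z -> smooth_at z (F p).
Proof. by move=> [h _]; exact: h. Qed.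

Lemma order_upto_bound k M m F : order_upto k M m F ->
  exists2 c : R, 0 <= c & forall p z, dom p z -> cabs (F p z) <= c * M p z * g p z `^ m.
Proof.
move=> [_ /(_ [::] (leq0n _))[c c0 h]]; exists c => // p z dz.
by have := h p z dz; rewrite /wts big_nil subr0.
Qed.

Lemma order_uptoS k M m F : order_upto k.+1 M m F -> order_upto k M m F.
Proof. by move=> [h1 h2]; split=> // L hL; apply: h2; exact: leqW. Qed.

Lemma order_upto_wapply k M m F D : order_upto k.+1 M m F ->
  order_upto k M (m - wt D) (fun p => wapply D (F p)).
Proof.
move=> [h1 h2]; split=> [p z dz|L hL].
  exact: smooth_at_wapply (dom_cball dz) (h1 p z dz).
have [|c c0 h] := h2 (rcons L D); first by rewrite size_rcons.
exists c => // p z dz; have := h p z dz.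
by rewrite wapplys_rcons wts_rcons opprD addrAC addrA.
Qed.

(** The form in which orders are proved: a bound on F itself, and an order lowered by [wt D] for
    each D F. The equation k = k'.+1 makes the last condition void at k = 0. *)
Lemma order_upto_intro k M m F :
  (forall p z, dom p z -> smooth_at z (F p)) ->
  (exists2 c : R, 0 <= c & forall p z, dom p z -> cabs (F p z) <= c * M p z * g p z `^ m) ->
  (forall D k', k = k'.+1 -> order_upto k' M (m - wt D) (fun p => wapply D (F p))) ->
  order_upto k M m F.
Proof.
move=> hs [c c0 hc] hD; split=> //; elim/last_ind => [|L D _].
  by move=> _; exists c => // p z dz; rewrite /wts big_nil subr0 hc.
rewrite size_rcons; case: k hD => // k hD hL.
have [_ /(_ L hL) [d d0 h]] := hD D k erefl.
exists d => // p z dz; have := h p z dz.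
by rewrite wapplys_rcons wts_rcons opprD addrAC addrA.
Qed.

Lemma order_upto_eq k M m F G :
  (forall p z, dom p z -> \forall w \near z, F p w = G p w) ->
  order_upto k M m F -> order_upto k M m G.
Proof.
move=> FG [h1 h2]; split=> [p z dz|L /h2[c c0 h]].
  exact: smooth_at_eq (FG p z dz) (h1 p z dz).
by exists c => // p z dz; rewrite -(wapplys_near_eq _ (FG p z dz)) h.
Qed.

(** As g <= 2, a higher power of g is bounded by a lower one; this is how an order may be
    decreased. *)
Lemma powR_gauge m m' p z : dom p z -> m' <= m ->
  g p z `^ m <= 2 `^ (m - m') * g p z `^ m'.
Proof.
move=> dz mm; have g0 := g_gt0 dz.
rewrite -{1}(subrK m' m) (powRDp (m - m') m' g0).
rewrite ler_wpM2r ?powR_ge0//; apply: ge0_ler_powR; rewrite ?nnegrE ?subr_ge0//.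
  exact: ltW.
exact: g_le2 dz.
Qed.

Lemma order_upto_weaken k M M' m m' F : m' <= m ->
  (forall p z, dom p z -> 0 <= M p z) ->
  (exists2 d : R, 0 <= d & forall p z, dom p z -> M p z <= d * M' p z) ->
  order_upto k M m F -> order_upto k M' m' F.
Proof.
move=> mm M0 [d d0 hd] [h1 h2]; split=> // L /h2[c c0 h].
exists (c * d * 2 `^ (m - m')); first by rewrite !mulr_ge0// powR_ge0.
move=> p z dz; apply: le_trans (h p z dz) _.
have e : m - m' = (m - wts L) - (m' - wts L) by ring.
apply: le_trans (_ : _ <= c * (d * M' p z) * (2 `^ (m - m') * g p z `^ (m' - wts L))) _.
  rewrite ler_pM ?powR_ge0// ?mulr_ge0 ?M0//.
    by rewrite ler_wpM2l// hd.
  by rewrite e powR_gauge// lerB.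
by rewrite le_eqVlt; apply/orP; left; apply/eqP; ring.
Qed.

Lemma order_uptoD k M m F G : order_upto k M m F -> order_upto k M m G ->
  order_upto k M m (fun p w => F p w + G p w).
Proof.
move=> [f1 f2] [g1 g2]; split=> [p z dz|L hL].
  exact: smooth_atD (f1 p z dz) (g1 p z dz).
have [c c0 hc] := f2 L hL; have [d d0 hd] := g2 L hL.
exists (c + d); first by rewrite addr_ge0.
move=> p z dz; rewrite wapplysD; [|exact: dom_cball dz|exact: f1|exact: g1].
by apply: le_trans (ler_cabsD _ _) _; rewrite !mulrDl lerD ?hc ?hd.
Qed.

Lemma order_uptoM k M M' m m' F G :
  (forall p z, dom p z -> 0 <= M p z) -> (forall p z, dom p z -> 0 <= M' p z) ->
  order_upto k M m F -> order_upto k M' m' G ->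
  order_upto k (fun p z => M p z * M' p z) (m + m') (fun p w => F p w * G p w).
Proof.
move=> M0 M0'; elim: k m m' F G => [|k IH] m m' F G hF hG.
all: apply: order_upto_intro.
1,4: by move=> p z dz; apply: smooth_atM (order_upto_smooth hF dz) (order_upto_smooth hG dz).
1,3: have [c c0 hc] := order_upto_bound hF; have [d d0 hd] := order_upto_bound hG.
1,2: exists (c * d); first exact: mulr_ge0.
1,2: move=> p z dz; rewrite cabsM powRDp ?(g_gt0 dz)//.
1,2: apply: le_trans (ler_pM _ _ (hc p z dz) (hd p z dz)) _; rewrite ?cabs_ge0//.
1,2: by rewrite le_eqVlt; apply/orP; left; apply/eqP; ring.
- by [].
move=> D _ [<-].
have h1 := IH _ _ _ _ (order_upto_wapply D hF) (order_uptoS hG).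
have h2 := IH _ _ _ _ (order_uptoS hF) (order_upto_wapply D hG).
rewrite addrAC in h1; rewrite addrA in h2.
apply: order_upto_eq (order_uptoD h1 h2) => p z dz /=.
apply: filterS2 (smooth_at_near (order_upto_smooth hF dz))
  (smooth_at_near (order_upto_smooth hG dz)) => w hf hg.
by rewrite wapplyM.
Qed.

Lemma order_upto_cst k M m (c : P -> C) :
  (exists2 d : R, 0 <= d & forall p z, dom p z -> cabs (c p) <= d * M p z * g p z `^ m) ->
  (forall p z, dom p z -> 0 <= M p z) ->
  order_upto k M m (fun p _ => c p).
Proof.
move=> hc M0; apply: order_upto_intro => //.
  by move=> p z dz; exact: smooth_at_cst.
move=> D k' _; split=> [p z dz|L hL].
  by apply: smooth_at_wapply (dom_cball dz) _; exact: smooth_at_cst.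
exists 0 => // p z dz; rewrite -wapplys_rcons.
have -> : wapplys (rcons L D) (fun _ => c p) z = 0; last by rewrite cabs0 !mul0r.
elim: L {hL} z {dz} => [|D' L IH] z /=; first exact: wapply_cst.
apply: big1 => i _; rewrite (@rderive_near_eq _ _ _ (fun _ => 0)); last by apply: filterE.
by rewrite (is_rderive_val (is_rderive_cst _ _ _)) mulr0.
Qed.

(** The derivatives of b are bounded on the compact ball, and a bounded function is O(g^(-w(L)))
    because g <= 2 and w(L) >= 0. *)
Lemma order_upto_smooth_coef k (b : V -> C) : (forall z, cball z -> smooth_at z b) ->
  order_upto k (fun _ _ => 1) 0 (fun _ => b).
Proof.
move=> hb; split=> [p z /dom_cball|L _]; first exact: hb.
have [|M M0 hM] := @compact_cabs_bounded _ _ (wapplys L b).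
  by move=> z hz; apply/smooth_at_continuous/smooth_at_wapplys => //; exact: hb.
exists (M * 2 `^ (wts L)); first by rewrite mulr_ge0 ?powR_ge0// ltW.
move=> p z dz; apply: le_trans (hM _ (dom_cball dz)) _.
rewrite mulr1 -mulrA ler_peMr ?(ltW M0)//.
have := @powR_gauge 0 (- wts L) p z dz; rewrite powRr0 opprK !add0r; apply.
by rewrite oppr_le0 wts_ge0.
Qed.

(** Induction through D(1/F) = - DF (1/F)^2: the three factors have orders m - wt D, -m, -m and
    prefactors M, 1/M, 1/M. *)
Lemma order_uptoV k M m F : (forall p z, dom p z -> 0 < M p z) ->
  (exists2 d : R, 0 < d & forall p z, dom p z -> d * M p z * g p z `^ m <= cabs (F p z)) ->
  order_upto k M m F ->
  order_upto k (fun p z => (M p z)^-1) (- m) (fun p w => (F p w)^-1).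
Proof.
move=> M0 [d d0 hd]; have F0 p z : dom p z -> F p z != 0.
  move=> dz; rewrite -cabs_gt0; apply: lt_le_trans (hd p z dz).
  by rewrite !mulr_gt0 ?M0// powR_gt0 ?g_gt0.
have M0' p z : dom p z -> 0 <= M p z by move=> /M0 /ltW.
have V0 p z : dom p z -> 0 <= (M p z)^-1 by move=> /M0' ?; rewrite invr_ge0.
elim: k => [|k IH] hF.
all: apply: order_upto_intro.
1,4: by move=> p z dz; apply: smooth_atV (F0 p z dz) (order_upto_smooth hF dz).
1,3: exists d^-1; first by rewrite invr_ge0 ltW.
1,2: move=> p z dz; rewrite cabsV powRN -!invfM lef_pV2 ?posrE ?cabs_gt0 ?F0//.
1,3: exact: hd.
1,2: by rewrite !mulr_gt0 ?M0// powR_gt0 ?g_gt0.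
- by [].
move=> D _ [<-].
have hI := IH (order_uptoS hF).
have h1 : order_upto k (fun _ _ => 1) 0 (fun _ _ => -1 : C).
  by apply: order_upto_smooth_coef => z _; exact: smooth_at_cst.
have h2 := order_uptoM M0' (fun p z dz => mulr_ge0 (V0 p z dz) (V0 p z dz))
  (order_upto_wapply D hF) (order_uptoM V0 V0 hI hI).
have h3 := order_uptoM (fun _ _ _ => ler01)
  (fun p z dz => mulr_ge0 (M0' p z dz) (mulr_ge0 (V0 p z dz) (V0 p z dz))) h1 h2.
apply: (@order_upto_eq _ _ _ _ _ _ (order_upto_weaken _ _ _ h3)).
- move=> p z dz.
  have hs := order_upto_smooth hF dz.
  (* The formula for D(1/F) is needed on a neighbourhood, since further operators act on it, and
     nearby points w may leave [dom p]; continuity keeps F nonzero there. *)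
  have hn : \forall w \near z, F p w != 0.
    have /loc_away_near := @loc_away_continuous _ _ unit setT z _ (continuous_cabs (smooth_at_continuous hs))
      (ltac:(by rewrite cabs_gt0; exact: F0)).
    apply: filterS => w [c c0 /nbhs_singleton /(_ tt I)]; rewrite -cabs_gt0.
    exact: lt_le_trans.
  apply: filterS2 hn (smooth_at_near hs) => w w0 hw.
  by rewrite wapplyV// mulN1r.
- by rewrite le_eqVlt; apply/orP; left; apply/eqP; ring.
- by move=> p z dz; rewrite mul1r mulr_ge0 ?mulr_ge0 ?V0 ?M0'.
- exists 1 => // p z dz; rewrite !mul1r mulrA divff ?mul1r//.
  by rewrite gt_eqF// M0.
Qed.

Definition order M m F := forall k, order_upto k M m F.

Lemma order_bound L M m F : order M m F -> exists2 c : R, 0 <= c &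
  forall p z, dom p z -> cabs (wapplys L (F p) z) <= c * M p z * g p z `^ (m - wts L).
Proof. by move=> /(_ (size L))[_ /(_ L (leqnn _))]. Qed.
Lemma order_smooth M m F p z : order M m F -> dom p z -> smooth_at z (F p).
Proof. by move=> /(_ 0%N)/order_upto_smooth; exact. Qed.

Lemma order1M m m' F G : order (fun _ _ => 1) m F -> order (fun _ _ => 1) m' G ->
  order (fun _ _ => 1) (m + m') (fun p w => F p w * G p w).
Proof.
move=> hF hG k.
have := order_uptoM (fun _ _ _ => ler01) (fun _ _ _ => ler01) (hF k) (hG k).
apply: order_upto_weaken => [//|p z _|]; first by rewrite mulr1.
by exists 1 => // p z _; rewrite !mulr1.
Qed.

Lemma order1_le m m' F : m' <= m -> order (fun _ _ => 1) m F -> order (fun _ _ => 1) m' F.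
Proof.
move=> mm h k; apply: order_upto_weaken (h k) => //.
by exists 1 => // p z _; rewrite mulr1.
Qed.

Lemma order_sum M m (I : eqType) (s : seq I) (F : I -> P -> V -> C) :
  (forall p z, dom p z -> 0 <= M p z) ->
  (forall i, i \in s -> order M m (F i)) ->
  order M m (fun p w => \sum_(i <- s) F i p w).
Proof.
move=> M0; elim: s => [|i s IH] h k.
  apply: (@order_upto_eq _ _ _ (fun _ _ => 0)).
    by move=> p z _; apply: filterE => w; rewrite big_nil.
  apply: order_upto_cst => //; exists 0 => // p z _.
  by rewrite cabs0 !mul0r.
apply: (@order_upto_eq _ _ _ (fun p w => F i p w + \sum_(i <- s) F i p w)).
  by move=> p z _; apply: filterE => w; rewrite big_cons.
apply: order_uptoD; first by apply: h; rewrite mem_head.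
by apply: IH => j js; apply: h; rewrite in_cons js orbT.
Qed.

Lemma order1_exp m F k : order (fun _ _ => 1) m F ->
  order (fun _ _ => 1) (m * k%:R) (fun p w => F p w ^+ k).
Proof.
move=> hF; elim: k => [|k IH].
  move=> j; rewrite mulr0; apply: (@order_upto_eq _ _ _ (fun _ _ => 1)).
    by move=> p z _; apply: filterE => w; rewrite expr0.
  by apply: order_upto_smooth_coef => z _; exact: smooth_at_cst.
have -> : m * k.+1%:R = m + m * k%:R by rewrite -natr1; ring.
move=> j; apply: order_upto_eq (order1M hF IH j).
by move=> p z _; apply: filterE => w; rewrite exprS.
Qed.

Lemma order1_prod (I : Type) (s : seq I) (m : I -> R) (F : I -> P -> V -> C) :
  (forall i, order (fun _ _ => 1) (m i) (F i)) ->
  order (fun _ _ => 1) (\sum_(i <- s) m i) (fun p w => \prod_(i <- s) F i p w).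
Proof.
move=> h; elim: s => [|i s IH] k.
  rewrite big_nil; apply: (@order_upto_eq _ _ _ (fun _ _ => 1)).
    by move=> p z _; apply: filterE => w; rewrite big_nil.
  by apply: order_upto_smooth_coef => z _; exact: smooth_at_cst.
rewrite big_cons; apply: order_upto_eq (order1M (h i) IH k).
by move=> p z _; apply: filterE => w; rewrite big_cons.
Qed.

(** Operators act on the b_i only, whose derivatives are bounded on the ball, while the c_i carry
    the parameter and are bounded: the constants are uniform in p. *)
Lemma order1_separated (I : finType) (b : I -> V -> C) (c : I -> P -> C) (M : R) :
  (forall i z, cball z -> smooth_at z (b i)) ->
  (forall i p z, dom p z -> cabs (c i p) <= M) ->
  order (fun _ _ => 1) 0 (fun p w => \sum_i b i w * c i p).
Proof.
move=> hb hc; apply: (order_sum (fun _ _ _ => ler01)) => i _ k.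
have h1 : order_upto k (fun _ _ => 1) 0 (fun p _ => c i p).
  apply: order_upto_cst => //; exists `|M| => // p z dz.
  by rewrite powRr0 !mulr1; apply: le_trans (hc i p z dz) (ler_norm _).
have h2 : order_upto k (fun _ _ => 1) 0 (fun _ => b i).
  by apply: order_upto_smooth_coef; exact: hb.
have := order_uptoM (fun _ _ _ => ler01) (fun _ _ _ => ler01) h2 h1.
rewrite addr0; apply: order_upto_weaken => //.
by exists 1 => // p z _; rewrite !mulr1.
Qed.

End Order.

Lemma wapply_sum (R : realType) (n : nat) (D : @wop R n) (I : Type) (s : seq I)
    (F : I -> Cn R n -> Cplx R) z : (forall i, smooth_at z (F i)) ->
  wapply D (fun w => \sum_(i <- s) F i w) z = \sum_(i <- s) wapply D (F i) z.
Proof.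
move=> h; elim: s => [|i s IH].
  rewrite big_nil (_ : (fun w => _) = fun _ => 0) ?wapply_cst//.
  by apply/funext => w; rewrite big_nil.
rewrite big_cons -IH -wapplyD//.
  by congr wapply; apply/funext => w; rewrite big_cons.
by apply: (@smooth_family_sum _ _ _ setT z I s predT (fun i _ => F i)) => j _; exact: h.
Qed.

(** * Orders of the kernel and of its powers *)

Section KernelOrder.
Context {R : realType} {n : nat} {P : Type}.
Local Notation C := (Cplx R).
Local Notation V := (Cn R n).
Local Notation wop := (@wop R n).
Variables (dom : P -> V -> Prop) (zeta : P -> V).
Hypothesis dom_cball : forall p z, dom p z -> cball z.
Hypothesis dom_sphere : forall p z, dom p z -> sphere (zeta p).
Hypothesis dom_gt0 : forall p z, dom p z -> 0 < dist z (zeta p).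
Implicit Types (z w v : V) (m : R).
Local Notation g := (fun p z => dist z (zeta p)).
Local Notation ord := (order dom g (fun _ _ => 1)).

(** Combines |z - u|^2 <= 2 Re K with d(z, u) <= |z - u|. The square is far from the size d of |K|,
    but it keeps K off the cut of the principal branch even when z lies on the sphere. *)
Lemma Re_kern_ge z u : cball z -> sphere u -> dist z u ^+ 2 / 2 <= cRe (kern u z).
Proof.
move=> bz su; rewrite ler_pdivrMr// mulrC; apply: le_trans (enorm_sqr_le_Re bz su).
by rewrite ler_pXn2r ?nnegrE ?dist_ge0 ?enorm_ge0// dist_le_enorm.
Qed.

Lemma Re_kern_gt0 p z : dom p z -> 0 < cRe (kern (zeta p) z).
Proof.
move=> dz; apply: lt_le_trans (Re_kern_ge (dom_cball dz) (dom_sphere dz)).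
by rewrite divr_gt0// exprn_gt0// dom_gt0.
Qed.

Lemma dom_le2 p z : dom p z -> dist z (zeta p) <= 2.
Proof.
by move=> dz; rewrite dist_le2//; [exact: dom_cball dz|exact/sphere_cball/(dom_sphere dz)].
Qed.

Lemma smooth_family_kern {Q : Type} (A : set Q) z (a : Q -> V) (M : R) :
  (forall p, A p -> enorm (a p) <= M) -> smooth_family A z (fun p => kern (a p)).
Proof.
move=> h; have h1 := @smooth_family_cst _ _ _ A z (fun _ => 1) 1 (fun _ _ => ltac:(by rewrite cabs1)).
have h2 := @smooth_family_cst _ _ _ A z (fun _ => -1) 1 (fun _ _ => ltac:(by rewrite cabsN cabs1)).
apply: smooth_family_eq (smooth_familyD h1 (smooth_familyM h2 (smooth_family_hdot z h))).
by apply: filterE => w p _; rewrite mulN1r.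
Qed.

Lemma smooth_at_kern u z : smooth_at z (kern u).
Proof. by apply: (@smooth_family_kern unit setT z (fun _ => u) (enorm u)). Qed.

Lemma is_rderive_kern u v z : is_rderive (kern u) v z (- hdot v u).
Proof.
have h := is_rderiveD (is_rderive_cst 1 v z)
  (is_rderiveM (is_rderive_cst (-1) v z) (is_rderive_hdot u v z)).
apply: is_rderive_near (is_rderive_eq h _).
  by apply: filterE => w; rewrite mulN1r.
by rewrite mul0r add0r add0r mulN1r.
Qed.

(** Only the function itself has to be estimated. One derivative lowers the order to m - wt D <= 0,
    as m <= 1/2 <= wt D, and order 0 is automatic because D F is again separated with bounded
    coefficients. *)
Lemma order_half (I : finType) (b : I -> V -> C) (c : I -> P -> C) (M m : R) :
  m <= 2^-1 ->
  (forall i z, cball z -> smooth_at z (b i)) ->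
  (forall i p z, dom p z -> cabs (c i p) <= M) ->
  (exists2 d : R, 0 <= d & forall p z, dom p z ->
    cabs (\sum_i b i z * c i p) <= d * dist z (zeta p) `^ m) ->
  ord m (fun p w => \sum_i b i w * c i p).
Proof.
move=> m2 hb hc [d d0 hd] k.
have hs p z : dom p z -> smooth_at z (fun w => \sum_i b i w * c i p).
  by move=> dz; apply: (order_smooth (order1_separated dom_cball dom_gt0 dom_le2 hb hc)) dz.
apply: order_upto_intro hs _ _ => //.
  by exists d => // p z dz; rewrite mulr1 hd.
move=> D k' _.
have hD : ord 0 (fun p w => \sum_i wapply D (b i) w * c i p).
  by apply: (order1_separated dom_cball dom_gt0 dom_le2) hc => i z bz; apply: smooth_at_wapply => //; exact: hb.
have mD : m - wt D <= 0 by rewrite subr_le0 (le_trans m2)// wt_ge.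
apply: order_upto_eq (order1_le dom_gt0 dom_le2 mD hD k') => p z dz.
have hs' : \forall w \near z, forall i, smooth_at w (b i).
  have h : forall i : I, \forall w \near z, smooth_at w (b i).
    by move=> i; apply: smooth_at_near; apply: hb; exact: dom_cball dz.
  exact: (filter_forall (nbhs_filter z) h).
apply: filterS hs' => w hw.
rewrite wapply_sum; last by move=> i; apply: smooth_atM => //; exact: smooth_at_cst.
apply: eq_bigr => i _; rewrite wapplyM//; last exact: smooth_at_cst.
by rewrite wapply_cst mulr0 addr0.
Qed.

(** [wkern] estimates one derivative of K, with exponent 1 - wt D <= 1/2. That derivative is
    separated in z and zeta, so [order_half] supplies all further ones. *)
Lemma order_kern : ord 1 (fun p => kern (zeta p)).
Proof.
move=> k; apply: order_upto_intro.
- by move=> p z _; exact: smooth_at_kern.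
- by exists 1 => // p z dz; rewrite !mul1r powRr1// dist_ge0.
- move=> D k' _; have [c c0 hc] := wkern D.
  have E p z : wapply D (kern (zeta p)) z =
      \sum_i wcoef (w := D) i z * - hdot (wdir (w := D) i) (zeta p).
    by apply: eq_bigr => i _; rewrite (is_rderive_val (is_rderive_kern _ _ _)).
  have h : ord (1 - wt D) (fun p w => \sum_i wcoef (w := D) i w *
      - hdot (wdir (w := D) i) (zeta p)).
    apply: (@order_half _ _ _ (\sum_i enorm (wdir (w := D) i))).
    + by have := wt_ge D; lra.
    + by move=> i z; exact: wcoef_smooth.
    + move=> i p z dz; rewrite cabsN; apply: le_trans (CauchySchwarz _ _) _.
      rewrite (dom_sphere dz) mulr1 (bigD1 i)//= lerDl.
      by apply: sumr_ge0 => j _; exact: enorm_ge0.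
    + exists c => // p z dz; rewrite -E.
      exact: hc (dom_sphere dz) (dom_cball dz).
  by apply: order_upto_eq (h k') => p z _; apply: filterE => w; rewrite E.
Qed.

Lemma order_kernV : ord (-1) (fun p w => (kern (zeta p) w)^-1).
Proof.
move=> k; have := order_uptoV dom_cball dom_gt0 dom_le2 (fun _ _ _ => ltr01) _ (order_kern k).
move=> h; apply: (order_upto_weaken dom_gt0 dom_le2 _ _ _ (h _)) => //.
- by exists 1 => // p z _; rewrite invr1 mulr1.
- by exists 1 => // p z dz; rewrite !mul1r powRr1// dist_ge0.
Qed.

Lemma order_cst (c : C) : ord 0 (fun _ _ => c).
Proof.
by move=> k; apply: (order_upto_smooth_coef dom_cball dom_gt0 dom_le2) => z _; exact: smooth_at_cst.
Qed.

Lemma loc_away_Re_kern p z : dom p z ->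
  loc_away setT (fun (_ : unit) w => cRe (kern (zeta p) w)) z.
Proof.
move=> dz; apply: (@loc_away_continuous _ _ _ _ _ (fun w => cRe (kern (zeta p) w))).
  apply/continuousVRP => e e0.
  have /continuousVP/(_ e e0)[d d0 hd] := smooth_at_continuous (smooth_at_kern (zeta p) z).
  by exists d => // w /hd; apply: le_lt_trans; rewrite -cReB cRe_le.
exact: Re_kern_gt0.
Qed.

(** Induction through D(K^s) = s K^s K^(-1) DK, which leaves the exponent s unchanged; the orders s,
    -1 and 1 - wt D add up to s - wt D. *)
Lemma order_kern_cpow (s : R) : ord s (fun p w => cpow (kern (zeta p) w) s).
Proof.
have sm p z : dom p z -> smooth_at z (fun w => cpow (kern (zeta p) w) s).
  by move=> dz; apply: smooth_family_cpow (loc_away_Re_kern dz) _; exact: smooth_at_kern.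
have bd : exists2 c : R, 0 <= c & forall p z, dom p z ->
    cabs (cpow (kern (zeta p) z) s) <= c * 1 * dist z (zeta p) `^ s.
  by exists 1 => // p z dz; rewrite cabs_cpow !mul1r.
elim=> [|k IH]; first exact: order_upto_intro.
apply: order_upto_intro sm bd _ => D _ [<-].
have hK : order_upto dom (fun p z => dist z (zeta p)) k (fun _ _ => 1) (1 - wt D)
    (fun p => wapply D (kern (zeta p))).
  exact: (order_upto_wapply dom_cball D (order_kern k.+1)).
have m01 : forall p z, dom p z -> (0 : R) <= 1 by [].
have h := order_uptoM dom_cball dom_gt0 (fun p z dz => mulr_ge0 (m01 p z dz) (mulr_ge0 (m01 p z dz) (m01 p z dz))) m01
  (order_uptoM dom_cball dom_gt0 m01 (fun p z dz => mulr_ge0 (m01 p z dz) (m01 p z dz))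
    (order_cst (mkC s 0) k) (order_uptoM dom_cball dom_gt0 m01 m01 IH (order_kernV k))) hK.
apply: order_upto_eq (order_upto_weaken dom_gt0 dom_le2 _ _ _ h).
- move=> p z dz; have := continuous_Re_gt (smooth_at_continuous (smooth_at_kern (zeta p) z)) (Re_kern_gt0 dz).
  apply: filterS => w w0; rewrite wapply_cpow//; last exact: smooth_at_kern.
  by rewrite !mulrA.
- by rewrite le_eqVlt; apply/orP; left; apply/eqP; ring.
- by move=> p z _; rewrite !mulr1.
- by exists 1 => // p z _; rewrite !mulr1.
Qed.

End KernelOrder.

(** * Integrals depending on a parameter *)

Section ComplexIntegral.
Context {R : realType} {d : measure_display} {T : measurableType d}.
Variable mu : probability T R.
Variable E : set T.
Hypothesis mE : measurable E.
Local Notation C := (Cplx R).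
Implicit Types (f h : T -> C) (c : C).

Definition cmeas f := measurable_fun E (fun t => cRe (f t)) /\
  measurable_fun E (fun t => cIm (f t)).
Definition bounded_on f := exists M : R, forall t, E t -> cabs (f t) <= M.

Lemma cmeas_eq f h : (forall t, E t -> f t = h t) -> cmeas f -> cmeas h.
Proof.
move=> fh [h1 h2]; split.
  by apply: eq_measurable_fun h1 => t /set_mem Et; rewrite fh.
by apply: eq_measurable_fun h2 => t /set_mem Et; rewrite fh.
Qed.

Lemma cmeasD f h : cmeas f -> cmeas h -> cmeas (fun t => f t + h t).
Proof.
move=> [f1 f2] [h1 h2]; split.
  by under eq_fun do rewrite cReD; exact: measurable_funD.
by under eq_fun do rewrite cImD; exact: measurable_funD.
Qed.
Lemma cmeasM f h : cmeas f -> cmeas h -> cmeas (fun t => f t * h t).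
Proof.
move=> [f1 f2] [h1 h2]; split.
  under eq_fun do rewrite cReM.
  by apply: measurable_funB; exact: measurable_funM.
under eq_fun do rewrite cImM.
by apply: measurable_funD; exact: measurable_funM.
Qed.
Lemma cmeas_cst c : cmeas (fun _ => c).
Proof. by split; exact: measurable_cst. Qed.

Lemma cmeas_sum (I : Type) (s : seq I) (F : I -> T -> C) :
  (forall i, cmeas (F i)) -> cmeas (fun t => \sum_(i <- s) F i t).
Proof.
move=> h; elim: s => [|i s IH].
  by apply: cmeas_eq (cmeas_cst 0) => t _; rewrite big_nil.
by apply: cmeas_eq (cmeasD (h i) IH) => t _; rewrite big_cons.
Qed.

Lemma cmeas_lim (F : nat -> T -> C) f : (forall k, cmeas (F k)) ->
  (forall t, E t -> F k t @[k --> \oo] --> f t) -> cmeas f.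
Proof.
move=> hF hl; split.
  apply: (@measurable_fun_cvg _ _ _ _ (fun k t => cRe (F k t))).
    by move=> k; exact: (hF k).1.
  by move=> t Et; apply: cvg_cRe; exact: hl.
apply: (@measurable_fun_cvg _ _ _ _ (fun k t => cIm (F k t))).
  by move=> k; exact: (hF k).2.
by move=> t Et; apply: cvg_cIm; exact: hl.
Qed.

Lemma bounded_integrable (f : T -> R) : measurable_fun E f ->
  (exists M : R, forall t, E t -> `|f t| <= M) -> mu.-integrable E (EFin \o f).
Proof.
move=> mf [M hM]; apply: measurable_bounded_integrable => //.
  by apply: le_lt_trans (probability_le1 mu mE) _; rewrite ltry.
exists M; split; first by rewrite num_real.
by move=> x Mx t Et; apply: le_trans (hM t Et) (ltW Mx).
Qed.

Lemma integrable_cRe f : cmeas f -> bounded_on f ->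
  mu.-integrable E (EFin \o (fun t => cRe (f t))).
Proof.
move=> [h _] [M hM]; apply: bounded_integrable => //; exists M => t Et.
exact: le_trans (cRe_le _) (hM t Et).
Qed.
Lemma integrable_cIm f : cmeas f -> bounded_on f ->
  mu.-integrable E (EFin \o (fun t => cIm (f t))).
Proof.
move=> [_ h] [M hM]; apply: bounded_integrable => //; exists M => t Et.
exact: le_trans (cIm_le _) (hM t Et).
Qed.

Lemma bounded_onD f h : bounded_on f -> bounded_on h -> bounded_on (fun t => f t + h t).
Proof.
move=> [M hM] [N hN]; exists (M + N) => t Et.
by apply: le_trans (ler_cabsD _ _) _; rewrite lerD ?hM ?hN.
Qed.
Lemma bounded_onZ c f : bounded_on f -> bounded_on (fun t => c * f t).
Proof.
by move=> [M hM]; exists (cabs c * M) => t Et; rewrite cabsM ler_wpM2l ?cabs_ge0 ?hM.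
Qed.

Lemma eq_cintegral f h : (forall t, E t -> f t = h t) ->
  cintegral mu E f = cintegral mu E h.
Proof.
by move=> fh; rewrite /cintegral; congr mkC; apply: eq_Rintegral => t /set_mem Et; rewrite fh.
Qed.

Lemma cintegralD f h : cmeas f -> bounded_on f -> cmeas h -> bounded_on h ->
  cintegral mu E (fun t => f t + h t) = cintegral mu E f + cintegral mu E h.
Proof.
move=> mf bf mh bh; apply: cext; rewrite /cintegral !cE.
  under eq_Rintegral do rewrite cReD.
  by rewrite RintegralD//; exact: integrable_cRe.
under eq_Rintegral do rewrite cImD.
by rewrite RintegralD//; exact: integrable_cIm.
Qed.

Lemma cintegralZ c f : cmeas f -> bounded_on f ->
  cintegral mu E (fun t => c * f t) = c * cintegral mu E f.
Proof.
move=> mf bf; have ir := integrable_cRe mf bf; have ii := integrable_cIm mf bf.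
have irZ r := integrable_cRe (cmeasM (cmeas_cst (mkC r 0)) mf) (bounded_onZ (mkC r 0) bf).
have iiZ r := integrable_cIm (cmeasM (cmeas_cst (mkC r 0)) mf) (bounded_onZ (mkC r 0) bf).
have eR r : (fun t => cRe (mkC r 0 * f t)) = (fun t => r * cRe (f t)).
  by apply/funext => t; rewrite !cE mul0r subr0.
have eI r : (fun t => cIm (mkC r 0 * f t)) = (fun t => r * cIm (f t)).
  by apply/funext => t; rewrite !cE mul0r addr0.
apply: cext; rewrite /cintegral !cE.
  under eq_Rintegral do rewrite cReM.
  rewrite RintegralB ?RintegralZl//.
    by have := irZ (cRe c); rewrite eR.
  by have := iiZ (cIm c); rewrite eI.
under eq_Rintegral do rewrite cImM.
rewrite RintegralD ?RintegralZl//.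
  by have := iiZ (cRe c); rewrite eI.
by have := irZ (cIm c); rewrite eR.
Qed.

Lemma cintegral0 : cintegral mu E (fun _ => 0) = 0.
Proof.
apply: cext; rewrite /cintegral !cE; rewrite /Rintegral integral0_eq//.
Qed.

Lemma cintegral_sum (I : Type) (s : seq I) (F : I -> T -> C) :
  (forall i, cmeas (F i)) -> (forall i, bounded_on (F i)) ->
  cintegral mu E (fun t => \sum_(i <- s) F i t) = \sum_(i <- s) cintegral mu E (F i).
Proof.
move=> mF bF; elim: s => [|i s IH].
  rewrite big_nil -[RHS]cintegral0; apply: eq_cintegral => t _.
  by rewrite big_nil.
rewrite big_cons -IH -cintegralD//.
- by apply: eq_cintegral => t _; rewrite big_cons.
- exact: cmeas_sum.
- elim: s {IH} => [|j s IH].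
    by exists 0 => t _; rewrite big_nil cabs0.
  have [M hM] := bounded_onD (bF j) IH.
  by exists M => t Et; rewrite big_cons; exact: hM.
Qed.

(** The real and imaginary integrals are bounded separately, which costs the factor 2. *)
Lemma cabs_cintegral_le f (g : T -> R) : cmeas f -> bounded_on f ->
  mu.-integrable E (EFin \o g) ->
  (forall t, E t -> cabs (f t) <= g t) ->
  cabs (cintegral mu E f) <= 2 * \int[mu]_(t in E) g t.
Proof.
move=> mf bf ig hg.
have ir := integrable_cRe mf bf; have ii := integrable_cIm mf bf.
apply: le_trans (cabs_le _) _; rewrite /cintegral !cE.
have h1 : `|\int[mu]_(t in E) cRe (f t)| <= \int[mu]_(t in E) g t.
  apply: le_trans (le_normr_Rintegral mE ir) _.
  apply: le_Rintegral => //; first exact: integrable_norm ir.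
  by move=> t Et; apply: le_trans (cRe_le _) (hg t Et).
have h2 : `|\int[mu]_(t in E) cIm (f t)| <= \int[mu]_(t in E) g t.
  apply: le_trans (le_normr_Rintegral mE ii) _.
  apply: le_Rintegral => //; first exact: integrable_norm ii.
  by move=> t Et; apply: le_trans (cIm_le _) (hg t Et).
lra.
Qed.

Lemma cabs_cintegral_cst f (M : R) : cmeas f -> 0 <= M ->
  (forall t, E t -> cabs (f t) <= M) -> cabs (cintegral mu E f) <= 2 * M.
Proof.
move=> mf M0 hM; have bf : bounded_on f by exists M.
apply: le_trans (cabs_cintegral_le mf bf _ hM) _.
  by apply: bounded_integrable; [exact: measurable_cst|exists M => t _; rewrite ger0_norm].
rewrite ler_pM2l// Rintegral_cst// ler_piMr//.
rewrite -lee_fin fineK ?fin_num_measure//; exact: probability_le1.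
Qed.

End ComplexIntegral.

(** * The real differential in coordinates *)

Section RealLinear.
Context {R : realType} {n : nat}.
Local Notation C := (Cplx R).
Local Notation V := (Cn R n).
Implicit Types (z w v u : V) (F : V -> C).

Lemma vec_decomp v : v = \sum_(j < n.+1)
  (mkC (cRe (v 0 j)) 0 *: (ebase j : V) + mkC (cIm (v 0 j)) 0 *: ('i *: (ebase j : V))).
Proof.
rewrite {1}(row_sum_delta v); apply: eq_bigr => j _.
rewrite scalerA -scalerDl; congr (_ *: _).
by apply: cext; rewrite !cE; ring.
Qed.

Definition rgrad F v z : C := \sum_(j < n.+1)
  (mkC (cRe (v 0 j)) 0 * rderive (ebase j) F z +
   mkC (cIm (v 0 j)) 0 * rderive ('i *: (ebase j : V)) F z).

(** Continuity of the directional derivatives makes them real linear in the direction, by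
    [is_rderive_add] along the real basis e_j, i e_j. Finitely many directions then control all of
    them. *)
Lemma is_rderive_rgrad F z :
  (forall v, \forall y \near z, rderivable F v y) ->
  (forall v, {for z, continuous (rderive v F)}) ->
  forall v, is_rderive F v z (rgrad F v z).
Proof.
move=> hd hc v.
have step (a : R) u (w : V) dw : is_rderive F w z dw ->
    is_rderive F (mkC a 0 *: u + w) z (mkC a 0 * rderive u F z + dw).
  move=> hw; have h := is_rderive_scale a (rderivableP (nbhs_singleton (hd u))).
  rewrite -(is_rderive_val h); apply: is_rderive_add => //; exact: hd.
have z0 : is_rderive F 0 z 0.
  apply/is_cderiveP => e e0; exists 1 => // s _.
  rewrite /line !scaler0 mulr0 subrr subr0 cabs0.
  by rewrite mulr_ge0// ltW.
rewrite {1}(vec_decomp v) /rgrad.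
apply: (big_rec2 (fun x y => is_rderive F x z y)); first exact: z0.
move=> j y1 y2 _ hx.
rewrite -(addrA (mkC (cRe (v 0 j)) 0 *: (ebase j : V))).
rewrite -(addrA (mkC (cRe (v 0 j)) 0 * rderive (ebase j) F z)).
exact: step (step _ _ _ _ hx).
Qed.

Lemma cabs_rgrad_le F v z (M : R) :
  (forall j, cabs (rderive (ebase j) F z) <= M) ->
  (forall j, cabs (rderive ('i *: (ebase j : V)) F z) <= M) ->
  cabs (rgrad F v z) <= 2 * n.+1%:R * M * enorm v.
Proof.
move=> h1 h2; apply: le_trans (ler_cabs_sum _ _ _) _.
have key (a b N : R) (x y : C) : `|a| <= N -> `|b| <= N -> cabs x <= M -> cabs y <= M ->
    cabs (mkC a 0 * x + mkC b 0 * y) <= 2 * M * N.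
  move=> ha hb hx hy; apply: le_trans (ler_cabsD _ _) _.
  rewrite (cabsM (mkC a 0)) (cabsM (mkC b 0)) (cabs_mkC a) (cabs_mkC b).
  have := ler_pM (normr_ge0 a) (cabs_ge0 x) ha hx.
  by have := ler_pM (normr_ge0 b) (cabs_ge0 y) hb hy; lra.
apply: (@le_trans _ _ (\sum_(j < n.+1) (2 * M * enorm v))).
  apply: ler_sum => j _; apply: key (h1 j) (h2 j).
    exact: le_trans (cRe_le _) (cabs_coord_le _ _).
  exact: le_trans (cIm_le _) (cabs_coord_le _ _).
rewrite sumr_const card_ord -[leLHS]mulr_natl.
by rewrite le_eqVlt; apply/orP; left; apply/eqP; ring.
Qed.

Lemma segment_in_ball z w (r s : R) : enorm (w - z) < r -> 0 <= s <= 1 ->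
  enorm (z + mkC s 0 *: (w - z) - z) < r.
Proof.
move=> h /andP[s0 s1]; rewrite addrAC subrr add0r enormZ cabs_mkC ger0_norm//.
by apply: le_lt_trans h; rewrite ler_piMl ?enorm_ge0.
Qed.

End RealLinear.

(** * Differentiation under the integral sign *)

Section ParametricIntegral.
Context {R : realType} {n : nat} {d : measure_display} {T : measurableType d}.
Variable mu : probability T R.
Variable E : set T.
Hypothesis mE : measurable E.
Local Notation C := (Cplx R).
Local Notation V := (Cn R n).
Local Notation wop := (@wop R n).
Local Notation cmeas := (cmeas E).
Implicit Types (z w v u : V) (U : set V) (G : T -> V -> C).

(** The bounds in [Cfamily] concern one direction at a time; through [rgrad] the 2(n+1) basis
    directions give one constant for all increments w - z and all t. *)
Lemma Cfamily_lipschitz U G z : open U -> U z -> Cfamily 1 E U G ->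
  exists M r : R, [/\ 0 <= M, 0 < r & forall w, enorm (w - z) < r -> U w /\
    forall t, E t -> cabs (G t w - G t z) <= M * enorm (w - z)].
Proof.
move=> oU Uz hG.
have hb v : loc_bounded E (fun t => rderive v (G t)) z.
  exact: (Cfamily_bound (Cfamily_rderive hG v) Uz).
have [M hM] := @choice 'I_n.+1 R (fun j Mj => \forall w \near z, forall t, E t ->
  cabs (rderive (ebase j) (G t) w) <= Mj) (fun j => hb (ebase j)).
have [N hN] := @choice 'I_n.+1 R (fun j Mj => \forall w \near z, forall t, E t ->
  cabs (rderive ('i *: (ebase j : V)) (G t) w) <= Mj) (fun j => hb ('i *: (ebase j : V))).
pose K : R := \sum_j (`|M j| + `|N j|).
have K0 : 0 <= K by apply: sumr_ge0 => j _; rewrite addr_ge0.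
have MK j : M j <= K /\ N j <= K.
  have : `|M j| + `|N j| <= K.
    by rewrite /K (bigD1 j)//= lerDl; apply: sumr_ge0 => i _; rewrite addr_ge0.
  have := ler_norm (M j); have := ler_norm (N j).
  by have := normr_ge0 (M j); have := normr_ge0 (N j); split; lra.
have [r r0 hr] := (nbhs_enormP z _).1
  (@filterI _ (nbhs z) (nbhs_filter z) _ _
    (@filterI _ (nbhs z) (nbhs_filter z) _ _ (open_near oU Uz)
      (filter_forall (nbhs_filter z) hM)) (filter_forall (nbhs_filter z) hN)).
exists (2 * (2 * n.+1%:R * K)), r; split => //; first by rewrite !mulr_ge0.
move=> w hw; split; first by have [[]] := hr w hw.
move=> t Et; have := @segment_bound _ _ (G t) (w - z) z
  (fun s => rgrad (G t) (w - z) (z + mkC s 0 *: (w - z))) 0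
  (2 * n.+1%:R * K * enorm (w - z)).
rewrite subr0 (addrC z (w - z)) (subrK z w) mulrA; apply.
  move=> s hs; have [[Us _] _] := hr _ (segment_in_ball hw hs).
  apply: is_rderive_rgrad => v.
    apply: filterS (open_near oU Us) => y Uy.
    exact: (is_rderiveP (Cfamily_der hG v Et Uy)).1.
  exact: (Cfamily_cont (Cfamily_rderive hG v) Et Us).
move=> s hs; have [[Us h1] h2] := hr _ (segment_in_ball hw hs).
rewrite subr0; apply: cabs_rgrad_le => j.
  by apply: le_trans (h1 j t Et) (MK j).1.
by apply: le_trans (h2 j t Et) (MK j).2.
Qed.

(** A derivative is the pointwise limit of difference quotients with steps c / (k+1), where c is so
    small that the shifted points remain in U. *)
Lemma rderive_cmeas U G z v : open U -> U z -> Cfamily 1 E U G ->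
  (forall w, U w -> cmeas (fun t => G t w)) -> cmeas (fun t => rderive v (G t) z).
Proof.
move=> oU Uz hG mG.
have /nbhs_enormP[r r0 hr] := open_near oU Uz.
have p : 0 < enorm v + 1 by rewrite ltr_wpDl ?enorm_ge0.
pose c := r / (enorm v + 1); have c0 : 0 < c by rewrite divr_gt0.
pose h (k : nat) : R := c / k.+1%:R.
have h0 k : 0 < h k by rewrite divr_gt0.
have hU k : U (z + mkC (h k) 0 *: v).
  apply: hr; rewrite addrAC subrr add0r enormZ cabs_mkC gtr0_norm//.
  apply: (@le_lt_trans _ _ (c * enorm v)).
    have k1 : 1 <= k.+1%:R :> R by rewrite ler1n.
    by rewrite ler_wpM2r ?enorm_ge0// /h ler_pdivrMr// ler_peMr//; exact: ltW.
  by rewrite /c mulrAC ltr_pdivrMr// ltr_pM2l// ltrDl.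
apply: (@cmeas_lim _ _ _ _ (fun k t => mkC (h k)^-1 0 * (G t (z + mkC (h k) 0 *: v) + -1 * G t z))).
  move=> k; apply: cmeasM; first exact: cmeas_cst.
  by apply: cmeasD; [exact: mG|apply: cmeasM; [exact: cmeas_cst|exact: mG]].
move=> t Et; apply/cvg_cabsP => e e0.
have e2 : 0 < e / 2 by rewrite divr_gt0.
have [dl dl0 hd] := (is_cderiveP _ _ _).1 (Cfamily_der hG v Et Uz) _ e2.
have [N _ hN] : \forall k \near \oo, c / dl < k.+1%:R.
  have [m _ hm] := @near_infty_natSinv_lt R (PosNum (divr_gt0 dl0 c0)).
  exists m => // k /hm /=.
  rewrite -[in X in X -> _]invf_div ltf_pV2 ?posrE ?divr_gt0//; exact.
exists N => // k /hN hk /=.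
have hkd : `|h k| < dl by rewrite gtr0_norm// /h ltr_pdivrMr// mulrC -ltr_pdivrMr.
have := hd _ hkd; rewrite (addr0 (h k)) line0E /line mulN1r gtr0_norm// => hh.
have -> : mkC (h k)^-1 0 * (G t (z + mkC (h k) 0 *: v) - G t z) - rderive v (G t) z =
    mkC (h k)^-1 0 * (G t (z + mkC (h k) 0 *: v) - G t z - mkC (h k) 0 * rderive v (G t) z).
  have e1 : mkC (h k)^-1 0 * mkC (h k) 0 = 1 :> C.
    by apply: cext; rewrite !cE ?mulVf ?gt_eqF//; ring.
  rewrite -[rderive v (G t) z in LHS]mul1r -e1.
  move: (mkC (h k)^-1 0) (mkC (h k) 0) (G t z) (G t _) (rderive v (G t) z) => a b x y dd.
  by ring.
rewrite cabsM cabs_mkC gtr0_norm ?invr_gt0// mulrC ltr_pdivrMr//.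
by apply: le_lt_trans hh _; rewrite ltr_pM2r//; lra.
Qed.

(** A bound on second derivatives uniform in t makes the first-order remainder O(s^2) uniformly in
    t, and this remainder is integrated directly. Hence [Cfamily 2] for one derivative. *)
Lemma integral_is_rderive U G z v : open U -> U z -> Cfamily 2 E U G ->
  (forall w, U w -> cmeas (fun t => G t w)) ->
  is_rderive (fun w => cintegral mu E (fun t => G t w)) v z
    (cintegral mu E (fun t => rderive v (G t) z)).
Proof.
move=> oU Uz hG mG.
have mD := rderive_cmeas v oU Uz (CfamilyS hG) mG.
have bG w : U w -> bounded_on E (fun t => G t w).
  by move=> Uw; have [M /nbhs_singleton hM] := Cfamily_bound hG Uw; exists M.
have bD : bounded_on E (fun t => rderive v (G t) z).
  by have [M /nbhs_singleton hM] := Cfamily_bound (Cfamily_rderive hG v) Uz; exists M.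
have [M hM] := Cfamily_bound (Cfamily_rderive (Cfamily_rderive hG v) v) Uz.
have [r r0 hr] := (nbhs_enormP z _).1
  (@filterI _ (nbhs z) (nbhs_filter z) _ _ (open_near oU Uz) hM).
have p : 0 < enorm v + 1 by rewrite ltr_wpDl ?enorm_ge0.
have hball (s a : R) : `|s| < r / (enorm v + 1) -> 0 <= a <= 1 ->
    enorm (z + mkC (s * a) 0 *: v - z) < r.
  move=> hs /andP[a0 a1]; rewrite addrAC subrr add0r enormZ cabs_mkC normrM (ger0_norm a0).
  apply: (@le_lt_trans _ _ (`|s| * (enorm v + 1))); last by rewrite -ltr_pdivlMr.
  by rewrite -mulrA ler_wpM2l// (le_trans (ler_piMl (enorm_ge0 _) a1))// lerDl.
have first_order (s : R) t : `|s| < r / (enorm v + 1) -> E t ->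
    cabs (rderive v (G t) (z + mkC s 0 *: v) - rderive v (G t) z) <= 2 * (`|s| * `|M|).
  move=> hs Et; have := @segment_bound _ _ (rderive v (G t)) (mkC s 0 *: v) z
    (fun a => mkC s 0 * rderive v (rderive v (G t)) (z + mkC (s * a) 0 *: v)) 0
    (`|s| * `|M|).
  rewrite subr0; apply=> a ha; have [Ua hMa] := hr _ (hball s a hs ha).
    rewrite scalerA mkC0M (mulrC a); apply: is_rderive_scale.
    exact: Cfamily_der (Cfamily_rderive hG v) _ _ _ Et Ua.
  rewrite subr0 cabsM cabs_mkC ler_wpM2l//.
  by apply: le_trans (hMa t Et) (ler_norm _).
have second_order (s : R) t : `|s| < r / (enorm v + 1) -> E t ->
    cabs (G t (z + mkC s 0 *: v) - G t z - mkC s 0 * rderive v (G t) z) <=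
    2 * (`|s| * (2 * (`|s| * `|M|))).
  move=> hs Et; apply: (@segment_bound _ _ (G t) (mkC s 0 *: v) z
    (fun a => mkC s 0 * rderive v (G t) (z + mkC (s * a) 0 *: v))) => a ha.
    have [Ua _] := hr _ (hball s a hs ha).
    rewrite scalerA mkC0M (mulrC a); apply: is_rderive_scale.
    exact: Cfamily_der hG _ _ _ Et Ua.
  have sa : `|s * a| <= `|s|.
    by move: ha => /andP[a0 a1]; rewrite normrM (ger0_norm a0) ler_piMr.
  rewrite -mulrBr cabsM cabs_mkC ler_wpM2l//.
  apply: le_trans (first_order (s * a) t (le_lt_trans sa hs) Et) _.
  by rewrite ler_pM2l// ler_wpM2r.
apply/is_cderiveP => e e0.
(* 8 = 2 * 2 * 2: the mean value inequality is used twice and [cabs_cintegral_cst] once; the added 1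
   makes K positive. *)
pose K : R := 8 * `|M| + 1; have K0 : 0 < K by rewrite ltr_wpDl ?mulr_ge0.
exists (Num.min (r / (enorm v + 1)) (e / K)); first by rewrite lt_min !divr_gt0.
move=> s; rewrite lt_min => /andP[hs1 hs2]; rewrite (addr0 s) line0E /line.
have Us : U (z + mkC s 0 *: v).
  by have [] := hr (z + mkC s 0 *: v); first by have := hball s 1 hs1; rewrite mulr1; apply; rewrite ler01 lexx.
have mA := mG _ Us; have bA := bG _ Us.
have mB := cmeasM (cmeas_cst E (-1)) (mG _ Uz); have bB := bounded_onZ (-1) (bG _ Uz).
have mC := cmeasM (cmeas_cst E (- mkC s 0)) mD; have bC := bounded_onZ (- mkC s 0) bD.
have mBC := cmeasD mB mC; have bBC := bounded_onD bB bC.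
have -> : cintegral mu E (fun t => G t (z + mkC s 0 *: v)) -
     cintegral mu E (fun t => G t z) - mkC s 0 * cintegral mu E (fun t => rderive v (G t) z) =
    cintegral mu E (fun t => G t (z + mkC s 0 *: v) + ((-1) * G t z + (- mkC s 0) * rderive v (G t) z)).
  rewrite (cintegralD mu mE mA bA mBC bBC) (cintegralD mu mE mB bB mC bC).
  rewrite (cintegralZ mu mE (-1) (mG _ Uz) (bG _ Uz)) (cintegralZ mu mE (- mkC s 0) mD bD).
  by ring.
apply: (@le_trans _ _ (2 * (2 * (`|s| * (2 * (`|s| * `|M|)))))).
  apply: cabs_cintegral_cst => //.
  - exact: cmeasD mA mBC.
  - by move=> t Et; rewrite mulN1r mulNr addrA second_order.
have -> : 2 * (2 * (`|s| * (2 * (`|s| * `|M|)))) = (8 * `|M| * `|s|) * `|s| by ring.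
rewrite ler_wpM2r//.
apply: (@le_trans _ _ (K * `|s|)); first by rewrite ler_wpM2r// /K lerDl.
by rewrite mulrC -ler_pdivlMr// ltW.
Qed.

Lemma integral_continuous U G z : open U -> U z -> Cfamily 1 E U G ->
  (forall w, U w -> cmeas (fun t => G t w)) ->
  {for z, continuous (fun w => cintegral mu E (fun t => G t w))}.
Proof.
move=> oU Uz hG mG.
have bG w : U w -> bounded_on E (fun t => G t w).
  by move=> Uw; have [M /nbhs_singleton hM] := Cfamily_bound hG Uw; exists M.
have [M [r [M0 r0 h]]] := Cfamily_lipschitz oU Uz hG.
apply/continuousVP => e e0.
have p : 0 < 2 * M + 1 by rewrite ltr_wpDl ?mulr_ge0.
exists (Num.min r (e / (2 * M + 1))); first by rewrite lt_min r0 divr_gt0.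
move=> w; rewrite lt_min => /andP[/h[Uw hw] he].
have -> : cintegral mu E (fun t => G t w) - cintegral mu E (fun t => G t z) =
    cintegral mu E (fun t => G t w + (-1) * G t z).
  rewrite cintegralD ?cintegralZ ?mulN1r//; try exact: mG; try exact: bG.
    by apply: cmeasM; [exact: cmeas_cst|exact: mG].
  by apply: bounded_onZ; exact: bG.
apply: (@le_lt_trans _ _ (2 * (M * enorm (w - z)))).
  apply: cabs_cintegral_cst => //.
  - by apply: cmeasD; [exact: mG|apply: cmeasM; [exact: cmeas_cst|exact: mG]].
  - by rewrite mulr_ge0 ?enorm_ge0.
  - by move=> t Et; rewrite mulN1r hw.
apply: (@le_lt_trans _ _ ((2 * M + 1) * enorm (w - z))).
  by rewrite mulrA ler_wpM2r ?enorm_ge0// lerDl.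
by rewrite mulrC -ltr_pdivlMr.
Qed.

(** Each derivative under the integral uses two orders of G, and the derived family has to satisfy
    the same hypothesis: all orders are assumed together. *)
Lemma integral_Cfamily U G k : open U -> (forall j, Cfamily j E U G) ->
  (forall w, U w -> cmeas (fun t => G t w)) ->
  Cfamily k [set: unit] U (fun _ w => cintegral mu E (fun t => G t w)).
Proof.
move=> oU; elim: k G => [|k IH] G hG mG.
all: have hb z : U z -> loc_bounded [set: unit]
    (fun _ w => cintegral mu E (fun t => G t w)) z.
1,3: move=> Uz; have [M hM] := Cfamily_bound (hG 0%N) Uz.
1,2: exists (2 * `|M|); apply: filterS2 (open_near oU Uz) hM => w Uw hM _ _.
1,2: apply: cabs_cintegral_cst => //; first exact: mG.
1,2: by move=> t Et; apply: le_trans (hM t Et) (ler_norm _).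
all: have hc z : U z -> {for z, continuous (fun w => cintegral mu E (fun t => G t w))}.
1,3: by move=> Uz; exact: integral_continuous oU Uz (hG 1%N) mG.
  by split=> [_ z _||//]; [exact: hc|exact: hb].
split=> [_ z _||v]; [exact: hc|exact: hb|split].
  by move=> _ z _ Uz; have [] := is_rderiveP (integral_is_rderive v oU Uz (hG 2%N) mG).
apply: (Cfamily_eq oU _ (IH (fun t => rderive v (G t)) _ _)).
- by move=> _ z _ Uz; rewrite (is_rderive_val (integral_is_rderive v oU Uz (hG 2%N) mG)).
- by move=> j; exact: Cfamily_rderive (hG j.+1) v.
- by move=> w Uw; exact: rderive_cmeas oU Uw (hG 1%N) mG.
Qed.

(** Measurability is required near z and not only at z, because derivatives are measurable as limits
    of difference quotients of nearby values. *)
Definition integrable_family z G := smooth_family E z G /\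
  \forall w \near z, cmeas (fun t => G t w).

Lemma integrable_family_open z G : integrable_family z G -> exists U : set V,
  [/\ open U, U z, forall k, Cfamily k E U G & forall w, U w -> cmeas (fun t => G t w)].
Proof.
move=> [[U [oU Uz hU]] /open_subnear[W [oW Wz hW]]].
exists (U `&` W); split => //; first exact: openI.
  by move=> k; apply: Cfamily_subset (hU k) => // ? [].
by move=> w [_ /hW].
Qed.

Lemma integrable_family_near z G : integrable_family z G ->
  \forall w \near z, integrable_family w G.
Proof. by move=> [/smooth_family_near h1 /nearW h2]; apply: filterS2 h1 h2 => w. Qed.

Lemma integrable_family_rderive z G v : integrable_family z G ->
  integrable_family z (fun t => rderive v (G t)).
Proof.
move=> h; split; first exact: smooth_family_rderive h.1.
have [U [oU Uz hU mU]] := integrable_family_open h.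
by apply: filterS (open_near oU Uz) => w Uw; exact: rderive_cmeas oU Uw (hU 1%N) mU.
Qed.

Lemma integrable_family_bounded z G : integrable_family z G -> bounded_on E (fun t => G t z).
Proof.
move=> [[U [oU Uz hU]] _]; have [M /nbhs_singleton hM] := Cfamily_bound (hU 0%N) Uz.
by exists M.
Qed.
Lemma integrable_family_cmeas z G : integrable_family z G -> cmeas (fun t => G t z).
Proof. by move=> [_ /nbhs_singleton]. Qed.

Lemma integral_smooth_at z G : integrable_family z G ->
  smooth_at z (fun w => cintegral mu E (fun t => G t w)).
Proof.
move=> /integrable_family_open[U [oU Uz hU mU]]; exists U; split => // k.
exact: integral_Cfamily.
Qed.

Lemma integral_rderive z G v : integrable_family z G ->
  rderive v (fun w => cintegral mu E (fun t => G t w)) z =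
  cintegral mu E (fun t => rderive v (G t) z).
Proof.
move=> /integrable_family_open[U [oU Uz hU mU]].
exact/is_rderive_val/(integral_is_rderive v oU Uz (hU 2%N) mU).
Qed.

Lemma integrable_family_wapply (D : wop) z G : cball z -> integrable_family z G ->
  integrable_family z (fun t => wapply D (G t)).
Proof.
move=> bz h; split; first exact: smooth_family_wapply bz h.1.
apply: filterS (integrable_family_near h) => w hw; apply: cmeas_sum => i.
apply: cmeasM; first exact: cmeas_cst.
exact: (integrable_family_cmeas (integrable_family_rderive (wdir i) hw)).
Qed.
Lemma integrable_family_wapplys (L : seq wop) z G : cball z -> integrable_family z G ->
  integrable_family z (fun t => wapplys L (G t)).
Proof. by move=> bz h; elim: L => //= D L; exact: integrable_family_wapply. Qed.

Lemma integral_wapply (D : wop) z G : integrable_family z G ->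
  wapply D (fun w => cintegral mu E (fun t => G t w)) z =
  cintegral mu E (fun t => wapply D (G t) z).
Proof.
move=> h; rewrite /wapply cintegral_sum.
- apply: eq_bigr => i _; rewrite integral_rderive// cintegralZ//.
    exact: (integrable_family_cmeas (integrable_family_rderive (wdir i) h)).
  exact: (integrable_family_bounded (integrable_family_rderive (wdir i) h)).
- exact: mE.
- move=> i; apply: cmeasM; first exact: cmeas_cst.
  exact: (integrable_family_cmeas (integrable_family_rderive (wdir i) h)).
- move=> i; apply: bounded_onZ.
  exact: (integrable_family_bounded (integrable_family_rderive (wdir i) h)).
Qed.

Lemma integral_wapplys (L : seq wop) z G : cball z -> integrable_family z G ->
  wapplys L (fun w => cintegral mu E (fun t => G t w)) z =
  cintegral mu E (fun t => wapplys L (G t) z).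
Proof.
elim/last_ind: L G => // L D IH G bz h; rewrite wapplys_rcons.
rewrite (wapplys_near_eq _ (_ : \forall w \near z, _ = cintegral mu E (fun t => wapply D (G t) w))).
  rewrite IH//; last exact: integrable_family_wapply.
  by apply: eq_cintegral => t _; rewrite wapplys_rcons.
by apply: filterS (integrable_family_near h) => w; exact: integral_wapply.
Qed.

End ParametricIntegral.

(** * Taylor polynomials and jets *)

Section Taylor.
Context {R : realType} {n : nat} {Q : Type}.
Local Notation C := (Cplx R).
Local Notation V := (Cn R n).
Local Notation idx := 'I_n.+1.
Implicit Types (y z v w : V) (A : set Q) (d : nat) (j : multiindex n).

Lemma horner_cvg0 (q : {poly C}) : q.[t] @[t --> (0 : C)^'] --> q.[0].
Proof.
elim/poly_ind: q => [|q c IH].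
  rewrite horner0; under eq_fun do rewrite horner0; exact: cvg_cst.
have e t : (q * 'X + c%:P).[t] = q.[t] * t + c by rewrite hornerD hornerM hornerX hornerC.
rewrite e; have -> : (fun t : C => (q * 'X + c%:P).[t]) = (fun t => q.[t] * t + c).
  by apply/funext => t; rewrite e.
have FF : Filter ((0 : C)^') by apply: within_filter.
have h1 : t @[t --> (0 : C)^'] --> (0 : C) by exact: cvg_within.
exact (@cvgD C C C _ FF _ _ _ _ (@cvgM C C _ FF _ _ _ _ IH h1) (cvg_cst c)).
Qed.

(** Jets are defined by the complex derivative ['D_u]. For a function polynomial on complex lines, p
    - p(0) = q X identifies the difference quotient with q(t), whose limit q(0) is p'(0). *)
Lemma derive_on_line (g : V -> C) y (u : V) (p : {poly C}) :
  (forall t : C, g (y + t *: u) = p.[t]) -> 'D_u g y = p^`().[0].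
Proof.
move=> h; have /factor_theorem[q hq] : root (p - (p.[0])%:P) 0.
  by rewrite rootE !hornerE subrr.
rewrite subr0 in hq; have hp : p = q * 'X + (p.[0])%:P by rewrite -hq subrK.
have -> : p^`().[0] = q.[0] by rewrite {1}hp derivD derivM derivX derivC addr0 hornerD !hornerM hornerX mulr0 add0r hornerC mulr1.
have hc : (t^-1 *: (g (t *: u + y) - g y) : C) @[t --> (0 : C)^'] --> (q.[0] : C).
  apply/cvg_cabsP => e e0.
  have H : \forall t \near (0 : C)^', cabs (q.[t] - q.[0]) < e.
    by apply: ((cvg_cabsP (horner q) q.[0]).2 _ e e0) => B; exact: horner_cvg0.
  have H0 : \forall t \near (0 : C)^', t != 0 by exact: nbhs_dnbhs_neq.
  apply: filterS2 H0 H => t t0.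
  have pt : p.[t] = q.[t] * t + p.[0].
    by rewrite {1}hp hornerD hornerM hornerX hornerC.
  rewrite (addrC (t *: u) y) h (_ : g y = p.[0]); last by rewrite -h scale0r addr0.
  by rewrite pt addrK /GRing.scale /= mulrC mulfK.
exact: cvg_lim hc.
Qed.

Definition lderive (u : V) (g : V -> C) : V -> C := fun z => 'D_u g z.

(* Affine coordinates generate these families; d bounds the degree on every
   complex line, and the constants are bounded uniformly in the parameter. *)
Inductive poly_family A : nat -> (Q -> V -> C) -> Prop :=
| poly_cst d (c : Q -> C) (M : R) : (forall p, A p -> cabs (c p) <= M) ->
    poly_family A d (fun p _ => c p)
| poly_hdot d (a : Q -> V) (M : R) : (forall p, A p -> enorm (a p) <= M) ->
    poly_family A d.+1 (fun p z => hdot z (a p))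
| poly_add d G H : poly_family A d G -> poly_family A d H ->
    poly_family A d (fun p z => G p z + H p z)
| poly_mul d d' G H : poly_family A d G -> poly_family A d' H ->
    poly_family A (d + d') (fun p z => G p z * H p z)
| poly_ext d G H : (forall p z, A p -> G p z = H p z) -> poly_family A d G ->
    poly_family A d H.

Lemma poly_family_line A d G : poly_family A d G -> forall p, A p -> forall y u,
  exists2 P : {poly C}, (size P <= d.+1)%N & forall t, G p (y + t *: u) = P.[t].
Proof.
elim=> {d G} [d c M hM|d a M hM|d G H _ hG _ hH|d d' G H _ hG _ hH|d G H GH _ hG] p Ap y u.
- exists (c p)%:P; last by move=> t; rewrite hornerC.
  exact: leq_trans (size_polyC_leq1 _) _.
- exists ((hdot y (a p))%:P + (hdot u (a p)) *: 'X).
    apply: leq_trans (size_polyD _ _) _; rewrite geq_max.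
    apply/andP; split; first exact: leq_trans (size_polyC_leq1 _) _.
    by apply: leq_trans (size_scale_leq _ _) _; rewrite size_polyX.
  by move=> t; rewrite hdotDl hdotZl !hornerE mulrC.
- have [P sP hP] := hG p Ap y u; have [P' sP' hP'] := hH p Ap y u.
  exists (P + P'); last by move=> t; rewrite hornerD -hP -hP'.
  by apply: leq_trans (size_polyD _ _) _; rewrite geq_max sP.
- have [P sP hP] := hG p Ap y u; have [P' sP' hP'] := hH p Ap y u.
  exists (P * P'); last by move=> t; rewrite hornerM -hP -hP'.
  apply: leq_trans (size_polyMleq _ _) _.
  by rewrite -subn1 leq_subLR; apply: leq_trans (leq_add sP sP') _; rewrite addSn addnS add1n.
- by have [P sP hP] := hG p Ap y u; exists P => // t; rewrite -GH.
Qed.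

Lemma poly_family_le A d d' G : (d <= d')%N -> poly_family A d G -> poly_family A d' G.
Proof.
move=> dd hG; have h1 : poly_family A (d' - d) (fun _ _ => 1).
  by apply: (@poly_cst _ _ (fun _ => 1) 1) => p _; rewrite cabs1.
by have := poly_mul h1 hG; rewrite subnK//; apply: poly_ext => p z _; rewrite mul1r.
Qed.

Lemma poly_family_derive A d G (u : Q -> V) (M : R) :
  (forall p, A p -> enorm (u p) <= M) -> poly_family A d G ->
  poly_family A d (fun p => lderive (u p) (G p)).
Proof.
move=> hu; elim=> {d G} [d c N hN|d a N hN|d G H pG hG pH hH|d d' G H pG hG pH hH|d G H GH pG hG].
- apply: (@poly_ext _ _ (fun _ _ => 0)).
    move=> p z Ap; rewrite /lderive (@derive_on_line _ _ _ (c p)%:P) ?derivC ?horner0//.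
    by move=> t; rewrite hornerC.
  by apply: (@poly_cst _ _ _ 0) => p _; rewrite cabs0.
- apply: (@poly_ext _ _ (fun p _ => hdot (u p) (a p))).
    move=> p z Ap; rewrite /lderive (@derive_on_line _ _ _ ((hdot z (a p))%:P + (hdot (u p) (a p)) *: 'X)).
      by rewrite derivD derivZ derivX derivC add0r hornerZ hornerC mulr1.
    by move=> t; rewrite hdotDl hdotZl !hornerE mulrC.
  apply: (@poly_cst _ _ _ (M * N)) => p Ap; apply: le_trans (CauchySchwarz _ _) _.
  by rewrite ler_pM ?enorm_ge0 ?hu ?hN.
- apply: poly_ext (poly_add hG hH) => p z Ap; rewrite /lderive.
  have [P _ hP] := poly_family_line pG Ap z (u p).
  have [P' _ hP'] := poly_family_line pH Ap z (u p).
  rewrite (derive_on_line hP) (derive_on_line hP') (@derive_on_line _ _ _ (P + P')).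
    by rewrite derivD hornerD.
  by move=> t; rewrite hornerD -hP -hP'.
- apply: poly_ext (poly_add (poly_mul hG pH) (poly_mul pG hH)) => p z Ap; rewrite /lderive.
  have [P _ hP] := poly_family_line pG Ap z (u p).
  have [P' _ hP'] := poly_family_line pH Ap z (u p).
  rewrite (derive_on_line hP) (derive_on_line hP') (@derive_on_line _ _ _ (P * P')).
    have eP : G p z = P.[0] by rewrite -hP scale0r addr0.
    have eP' : H p z = P'.[0] by rewrite -hP' scale0r addr0.
    by rewrite derivM hornerD !hornerM eP eP'.
  by move=> t; rewrite hornerM -hP -hP'.
- apply: poly_ext hG => p z Ap; rewrite (_ : G p = H p)//.
  by apply/funext => w; exact: GH.
Qed.

Lemma poly_family_bound A d G (r : R) : poly_family A d G ->
  exists2 M : R, 0 <= M & forall p z, A p -> enorm z <= r -> cabs (G p z) <= M.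
Proof.
elim=> {d G} [d c M hM|d a M hM|d G H _ [M M0 hM] _ [N N0 hN]
  |d d' G H _ [M M0 hM] _ [N N0 hN]|d G H GH _ [M M0 hM]].
- by exists `|M| => // p z Ap _; apply: le_trans (hM p Ap) (ler_norm _).
- exists (`|r| * `|M|); first by rewrite mulr_ge0.
  move=> p z Ap hz; apply: le_trans (CauchySchwarz _ _) _.
  rewrite ler_pM ?enorm_ge0//; first exact: le_trans hz (ler_norm _).
  exact: le_trans (hM p Ap) (ler_norm _).
- exists (M + N); first exact: addr_ge0.
  by move=> p z Ap hz; apply: le_trans (ler_cabsD _ _) _; rewrite lerD ?hM ?hN.
- exists (M * N); first exact: mulr_ge0.
  by move=> p z Ap hz; rewrite cabsM ler_pM ?cabs_ge0 ?hM ?hN.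
- by exists M => // p z Ap hz; rewrite -GH// hM.
Qed.

Lemma poly_family_exp A d G k : poly_family A d G -> poly_family A (d * k) (fun p z => G p z ^+ k).
Proof.
move=> hG; elim: k => [|k IH].
  apply: (@poly_ext _ _ (fun _ _ => 1)); first by move=> p z _; rewrite expr0.
  by apply: (@poly_cst _ _ (fun _ => 1) 1) => p _; rewrite cabs1.
by rewrite mulnS; apply: poly_ext (poly_mul hG IH) => p z _; rewrite exprS.
Qed.

Lemma poly_family_prod A (I : Type) (s : seq I) (d : I -> nat) (G : I -> Q -> V -> C) :
  (forall i, poly_family A (d i) (G i)) ->
  poly_family A (\sum_(i <- s) d i) (fun p z => \prod_(i <- s) G i p z).
Proof.
move=> hG; elim: s => [|i s IH].
  apply: (@poly_ext _ _ (fun _ _ => 1)); first by move=> p z _; rewrite big_nil.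
  by apply: (@poly_cst _ _ (fun _ => 1) 1) => p _; rewrite cabs1.
by rewrite big_cons; apply: poly_ext (poly_mul (hG i) IH) => p z _; rewrite big_cons.
Qed.

Lemma poly_family_lincomb A d (I : eqType) (s : seq I) (c : I -> Q -> C) (G : I -> Q -> V -> C) :
  (forall i, i \in s -> poly_family A d (G i)) ->
  forall p, A p -> forall y u, lderive u (fun z => \sum_(i <- s) c i p * G i p z) y =
    \sum_(i <- s) c i p * lderive u (G i p) y.
Proof.
move=> hG p Ap y u.
have : exists2 P : {poly C}, (forall t, \sum_(i <- s) c i p * G i p (y + t *: u) = P.[t]) &
    P^`().[0] = \sum_(i <- s) c i p * lderive u (G i p) y.
  elim: s hG => [|i s IH] hG.
    by exists 0; [move=> t|]; rewrite ?deriv0 horner0 big_nil.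
  have [|P hP eP] := IH; first by move=> k ks; apply: hG; rewrite in_cons ks orbT.
  have [P' _ hP'] := poly_family_line (hG i (mem_head _ _)) Ap y u.
  exists (c i p *: P' + P).
    by move=> t; rewrite big_cons hornerD hornerZ hP hP'.
  by rewrite big_cons derivD derivZ hornerD hornerZ eP /lderive (derive_on_line hP').
by move=> [P hP eP]; rewrite /lderive (derive_on_line hP) eP.
Qed.

Lemma iter_derive_on_line (g : V -> C) y (u : V) (P : {poly C}) k :
  (forall t, g (y + t *: u) = P.[t]) ->
  forall t, iter k (lderive u) g (y + t *: u) = (derivn k P).[t].
Proof.
move=> h; elim: k => [|k IH] t /=; first by rewrite h.
rewrite {1}/lderive (@derive_on_line _ _ _ ((derivn k P) \Po ('X + t%:P))).
  by rewrite deriv_comp hornerM horner_comp hornerD hornerX hornerC add0r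
    derivD derivX derivC addr0 (hornerC 1) mulr1.
by move=> s; rewrite -addrA -scalerDl IH horner_comp !hornerE addrC.
Qed.

(** The formula is exact because the restriction to a complex line has degree at most d; its
    coefficients are formal derivatives at 0. *)
Lemma taylor_line A d G : poly_family A d G -> forall p, A p -> forall y u t,
  G p (y + t *: u) =
  \sum_(k <- iota 0 d.+1) (k`!%:R)^-1 * t ^+ k * iter k (lderive u) (G p) y.
Proof.
move=> hG p Ap y u t; have [P sP hP] := poly_family_line hG Ap y u.
rewrite hP (horner_coef_wide _ sP) -(big_mkord xpredT (fun k => P`_k * t ^+ k)) /index_iota subn0.
apply: eq_bigr => k _; have := iter_derive_on_line k hP 0.
rewrite scale0r addr0 => ->; rewrite horner_coef0 coef_derivn addn0 ffactnn.
have f0 : (k`!%:R : C) != 0 by rewrite pnatr_eq0 -lt0n fact_gt0.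
rewrite -(mulr_natr P`_k k`!); move: (P`_k) (t ^+ k) (k`!%:R : C) f0 => a b c c0.
by field.
Qed.

Definition lderives (u : idx -> V) j (l : seq idx) (g : V -> C) : V -> C :=
  foldr (fun i h => iter (j i) (lderive (u i)) h) g l.

Lemma poly_family_iter A d G (u : Q -> V) (M : R) k :
  (forall p, A p -> enorm (u p) <= M) -> poly_family A d G ->
  poly_family A d (fun p => iter k (lderive (u p)) (G p)).
Proof. by move=> hu hG; elim: k => //= k IH; exact: poly_family_derive hu IH. Qed.

Lemma poly_family_lderives A d G (u : Q -> idx -> V) (M : R) j l :
  (forall p i, A p -> enorm (u p i) <= M) -> poly_family A d G ->
  poly_family A d (fun p => lderives (u p) j l (G p)).
Proof.
move=> hu hG; elim: l => //= i l IH.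
by apply: (@poly_family_iter _ _ _ (fun p => u p i) M) => // p; exact: hu.
Qed.

Lemma lderives_lincomb A d (I : eqType) (s : seq I) (c : I -> Q -> C) (G : I -> Q -> V -> C)
    (u : Q -> idx -> V) (M : R) j l :
  (forall p i, A p -> enorm (u p i) <= M) ->
  (forall i, i \in s -> poly_family A d (G i)) ->
  forall p, A p -> lderives (u p) j l (fun z => \sum_(i <- s) c i p * G i p z) =
    (fun z => \sum_(i <- s) c i p * lderives (u p) j l (G i p) z).
Proof.
move=> hu hG p Ap; elim: l => //= i l ->.
elim: (j i) => //= k ->; apply/funext => y.
apply: (@poly_family_lincomb A d I s c (fun a q => iter k (lderive (u q i))
  (lderives (u q) j l (G a q)))) => // a /hG hGa.
apply: (@poly_family_iter _ _ _ (fun q => u q i) M); first by move=> q; exact: hu.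
exact: (poly_family_lderives j l hu hGa).
Qed.

Definition mupd (i : idx) (k : nat) j : multiindex n :=
  [ffun x => if x == i then k else j x].

(** A box rather than a bound on the total degree, since [taylor_multi] expands up to degree d in
    each direction separately. *)
Fixpoint mindices (d : nat) (l : seq idx) : seq (multiindex n) :=
  if l is i :: l' then
    [seq mupd i k j | k <- iota 0 d.+1, j <- mindices d l'] else [:: [ffun=> 0%N]].

Arguments mindices : simpl never.

Lemma mindices_cons d i l : mindices d (i :: l) =
  [seq mupd i k j | k <- iota 0 d.+1, j <- mindices d l].
Proof. by []. Qed.

Lemma mindices_out d l j i : j \in mindices d l -> i \notin l -> j i = 0%N.
Proof.
elim: l j => [|a l IH] j; first by rewrite inE => /eqP ->; rewrite ffunE.
rewrite mindices_cons => /allpairsP[[k j'] /= [_ hj' ->]]; rewrite inE negb_or ffunE => /andP[/negbTE -> il].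
exact: IH.
Qed.

Lemma mem_mindices d l j : (forall i, i \notin l -> j i = 0%N) ->
  (forall i, (j i <= d)%N) -> j \in mindices d l.
Proof.
elim: l j => [|a l IH] j h0 hd.
  by rewrite inE; apply/eqP/ffunP => i; rewrite ffunE h0.
rewrite mindices_cons; apply/allpairsP; exists (j a, if a \in l then j else mupd a 0 j); split.
- by change (j a \in iota 0 d.+1); rewrite mem_iota add0n ltnS hd.
- have [al|al] /= := ifPn.
    by apply: IH => // i il; apply: h0; rewrite inE negb_or il andbT; apply: contraNneq il => ->.
  apply: IH => i; rewrite ffunE; case: eqP => // /eqP ia.
  by move=> il; apply: h0; rewrite inE negb_or ia.
- apply/ffunP => i /=; rewrite ffunE; case: eqP => [->//|/eqP ia].
  by case: ifP => // _; rewrite ffunE (negbTE ia).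
Qed.

Lemma mindices_uniq d l : uniq l -> uniq (mindices d l).
Proof.
elim: l => // a l IH /andP[al ul]; rewrite mindices_cons; apply: allpairs_uniq => //.
- exact: iota_uniq.
- exact: IH.
move=> _ _ /allpairsP[[k j] [_ hj ->]] /allpairsP[[k' j'] [_ hj' ->]] /= e.
have ek : k = k' by have := congr1 (fun f : multiindex n => f a) e; rewrite !ffunE eqxx.
congr (_, _) => //; apply/ffunP => i; have := congr1 (fun f : multiindex n => f i) e.
rewrite !ffunE; case: eqP => // -> _.
by rewrite (mindices_out hj al) (mindices_out hj' al).
Qed.

Lemma lderives_mupd u i k j l g : i \notin l ->
  lderives u (mupd i k j) l g = lderives u j l g.
Proof.
elim: l => //= a l IH; rewrite inE negb_or => /andP[ia il]; rewrite IH// ffunE.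
by rewrite eq_sym (negbTE ia).
Qed.

(** One direction at a time: after the expansion along the tail l, each coefficient is again
    polynomial on lines and is expanded along i. The derivatives thus come in the order in which
    [Djet] takes them. *)
Lemma taylor_multi A d G (u : Q -> idx -> V) (M : R) (t : idx -> C) l :
  (forall p i, A p -> enorm (u p i) <= M) -> poly_family A d G -> uniq l ->
  forall p, A p -> forall y, G p (y + \sum_(i <- l) t i *: u p i) =
  \sum_(j <- mindices d l) (\prod_(i <- l) (((j i)`!)%:R^-1 * t i ^+ j i)) *
     lderives (u p) j l (G p) y.
Proof.
move=> hu hG; elim: l => [|i l IH].
  by move=> _ p Ap y; rewrite big_seq1 !big_nil addr0 mul1r.
move=> /andP[il ul] p Ap y; rewrite big_cons addrA IH// mindices_cons.
rewrite big_allpairs_dep /= exchange_big /= big_seq [RHS]big_seq; apply: eq_bigr => j jl.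
rewrite (taylor_line (poly_family_lderives j l hu hG) Ap) mulr_sumr; apply: eq_bigr => k _.
have Ek : mupd i k j i = k by rewrite ffunE eqxx.
have El : \prod_(a <- l) (((mupd i k j a)`!)%:R^-1 * t a ^+ mupd i k j a) =
    \prod_(a <- l) (((j a)`!)%:R^-1 * t a ^+ j a) :> C.
  apply: eq_big_seq => a al; rewrite ffunE (_ : (a == i) = false)//.
  by apply/negP => /eqP ai; rewrite -ai al in il.
rewrite big_cons El Ek /= lderives_mupd// mulrA.
by rewrite (mulrC (\prod_(_ <- l) _)).
Qed.

End Taylor.

(** * Jets, their norm, and recentring of Taylor polynomials *)

Section Jets.
Context {R : realType} {n : nat}.
Local Notation C := (Cplx R).
Local Notation V := (Cn R n).
Local Notation idx := 'I_n.+1.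
Variables (E : set V) (e : V -> 'M[C]_(n, n.+1)) (alpha : R).
Hypothesis hES : E `<=` sphere.
Hypothesis he : tangent_frame E e.
Hypothesis E0 : E !=set0.
Implicit Types (zeta z w v : V) (j : multiindex n) (f : multiindex n -> V -> C).

Lemma fvec_max zeta : fvec e zeta ord_max = zeta.
Proof. by rewrite /fvec unlift_none. Qed.
Lemma fvec_lift zeta (i : 'I_n) : fvec e zeta (lift ord_max i) = row i (e zeta).
Proof. by rewrite /fvec liftK. Qed.

Lemma fvec_orthonormal zeta i i' : E zeta ->
  hdot (fvec e zeta i) (fvec e zeta i') = (i == i')%:R.
Proof.
move=> Ez; have [hz hr] := he.1 zeta Ez.
have zz : hdot zeta zeta = 1 by rewrite hdotzz (hES Ez) expr1n.
case: (unliftP ord_max i) => [k ->|->]; case: (unliftP ord_max i') => [k' ->|->].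
- by rewrite !fvec_lift hr (inj_eq lift_inj).
- by rewrite fvec_lift fvec_max hz eq_sym (negbTE (neq_lift _ _)).
- by rewrite fvec_lift fvec_max hdotC hz rmorph0 (negbTE (neq_lift _ _)).
- by rewrite fvec_max zz eqxx.
Qed.

Lemma enorm_fvec zeta i : E zeta -> enorm (fvec e zeta i) = 1.
Proof.
move=> Ez; have := fvec_orthonormal i i Ez; rewrite eqxx hdotzz => /mkC0_inj/eqP.
by rewrite sqrp_eq1 ?enorm_ge0// => /eqP.
Qed.

(** The frame vectors are the rows of a square matrix A with A B = 1, where B is its adjoint; then B
    A = 1 as well, which is the expansion in an orthonormal basis. *)
Lemma wcoord_decomp zeta z : E zeta ->
  z = zeta + \sum_(i <- enum idx) wcoord e zeta z i *: fvec e zeta i.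
Proof.
move=> Ez; pose A : 'M[C]_n.+1 := \matrix_(i, l) fvec e zeta i 0 l.
pose B : 'M[C]_n.+1 := \matrix_(l, i) (fvec e zeta i 0 l)^*.
have AB : A *m B = 1%:M.
  apply/matrixP => i i'; rewrite !mxE -(fvec_orthonormal i i' Ez) /hdot.
  by apply: eq_bigr => l _; rewrite !mxE.
have BA := mulmx1C AB.
apply/eqP; rewrite addrC -subr_eq; apply/eqP.
rewrite -{1}[z - zeta](mulmx1 (z - zeta : 'rV[C]_n.+1)) -BA mulmxA.
apply/rowP => l; rewrite big_enum /= summxE mxE; apply: eq_bigr => i _.
rewrite !mxE /wcoord /hdot; congr (_ * _); apply: eq_bigr => k _.
by rewrite !mxE.
Qed.

(** Every coordinate has weight at least 1/2, so omega(j) <= alpha forces the degree of j to be at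
    most 2 alpha. *)
Let d : nat := Num.truncn (2 * alpha).
(** An explicit list of the finitely many indices of a jet, which turns the sums over a set in
    [taylor] and [jet_norm] into ordinary finite sums. *)
Definition jet_indices : seq (multiindex n) :=
  [seq j <- mindices (Num.truncn (2 * alpha)) (enum idx) | (omega j : R) <= alpha].

Lemma omega_ge_sum j : (\sum_(i < n.+1) j i)%:R <= 2 * (omega j : R).
Proof.
rewrite /omega (bigD1 ord_max)//= natrD natr_sum.
have := ler0n R (j ord_max); set s := \sum_(i < _ | _) _; lra.
Qed.

Lemma omega_degree j : (omega j : R) <= alpha -> (\sum_(i < n.+1) j i <= d)%N.
Proof.
move=> h; have := omega_ge_sum j => h2.
have h3 : (\sum_(i < n.+1) j i)%:R <= 2 * alpha by lra.
by have := le_truncn h3; rewrite natrK.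
Qed.

Lemma mem_jet_indices j : (j \in jet_indices) = ((omega j : R) <= alpha).
Proof.
rewrite mem_filter; case: (boolP (_ <= _)) => //= h.
apply: mem_mindices => i; first by rewrite mem_enum.
by apply: leq_trans (omega_degree h); rewrite (bigD1 i)//= leq_addr.
Qed.

Lemma jet_indices_uniq : uniq jet_indices.
Proof. by apply/filter_uniq/mindices_uniq/enum_uniq. Qed.

Lemma jet_indices_set : [set j | (omega j : R) <= alpha] = [set` jet_indices].
Proof. by apply/seteqP; split=> j /=; rewrite mem_jet_indices. Qed.

Definition wmonomial j zeta z : C := \prod_(i < n.+1) wcoord e zeta z i ^+ j i.

Lemma taylorE f zeta z : taylor e alpha f zeta z =
  \sum_(j <- jet_indices) (mfact j)%:R^-1 * f j zeta * wmonomial j zeta z.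
Proof.
by rewrite /taylor jet_indices_set -fsbig_seq//; exact: jet_indices_uniq.
Qed.

Definition jnorm f : R := fine (jet_norm e alpha f E).

(** All the suprema are nonnegative because E is nonempty (over the empty set they would be -oo), so
    each one is at most their finite sum. *)
Lemma jet_norm_term f j : A_jet e alpha f E -> (omega j : R) <= alpha ->
  (ereal_sup [set (cabs (f j zeta))%:E | zeta in E] <= (jnorm f)%:E)%E /\
  (ereal_sup [set (cabs (jet_diff e alpha f j p.1 p.2)
                      / dist p.1 p.2 `^ (alpha - (omega j : R)))%:E
               | p in E `*` E] <= (jnorm f)%:E)%E.
Proof.
move=> [_ fin] hj; have [x Ex] := E0.
pose s1 j := ereal_sup [set (cabs (f j zeta))%:E | zeta in E].
pose s2 j := ereal_sup [set (cabs (jet_diff e alpha f j p.1 p.2)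
                      / dist p.1 p.2 `^ (alpha - (omega j : R)))%:E
               | p in E `*` E].
have s1_ge0 i : (0 <= s1 i)%E.
  by apply: (@le_trans _ _ (cabs (f i x))%:E); [rewrite lee_fin cabs_ge0|apply: ereal_sup_ubound; exists x].
have s2_ge0 i : (0 <= s2 i)%E.
  apply: (@le_trans _ _ (cabs (jet_diff e alpha f i x x) / dist x x `^ (alpha - (omega i : R)))%:E).
    by rewrite lee_fin divr_ge0 ?cabs_ge0 ?powR_ge0.
  by apply: ereal_sup_ubound; exists (x, x).
have s_ge0 i : (0 <= s1 i + s2 i)%E by rewrite adde_ge0.
have E1 : jet_norm e alpha f E = (\sum_(i <- jet_indices) (s1 i + s2 i))%E.
  by rewrite /jet_norm jet_indices_set -fsbig_seq//; exact: jet_indices_uniq.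
have N0 : (0 <= jet_norm e alpha f E)%E by rewrite E1 sume_ge0.
have -> : (jnorm f)%:E = jet_norm e alpha f E by rewrite fineK// ge0_fin_numE.
have h : (s1 j + s2 j <= jet_norm e alpha f E)%E.
  rewrite E1 (bigD1_seq j) ?jet_indices_uniq ?mem_jet_indices//=.
  by rewrite leeDl// sume_ge0.
by split; apply: le_trans h; rewrite -/(s1 j) -/(s2 j); [rewrite leeDl|rewrite leeDr].
Qed.

Lemma jnorm_ge0 f : 0 <= jnorm f.
Proof.
rewrite /jnorm fine_ge0// /jet_norm jet_indices_set -fsbig_seq ?jet_indices_uniq//.
have [x Ex] := E0; apply: sume_ge0 => i _; apply: adde_ge0.
  by apply: (@le_trans _ _ (cabs (f i x))%:E); [rewrite lee_fin cabs_ge0|apply: ereal_sup_ubound; exists x].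
apply: (@le_trans _ _ (cabs (jet_diff e alpha f i x x) / dist x x `^ (alpha - (omega i : R)))%:E).
  by rewrite lee_fin divr_ge0 ?cabs_ge0 ?powR_ge0.
by apply: ereal_sup_ubound; exists (x, x).
Qed.

Lemma jet_bound f j zeta : A_jet e alpha f E -> (omega j : R) <= alpha -> E zeta ->
  cabs (f j zeta) <= jnorm f.
Proof.
move=> hf hj Ez; have [h _] := jet_norm_term hf hj.
rewrite -lee_fin; apply: le_trans h; apply: ereal_sup_ubound; by exists zeta.
Qed.

Lemma dist_gt0_sphere zeta z : sphere zeta -> cball z -> z != zeta -> 0 < dist z zeta.
Proof.
move=> hs hz zz; rewrite lt0r dist_ge0 andbT; apply: contra_neq zz => d0.
have := enorm_sqr_le hz hs; rewrite d0 mulr0 => h.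
apply/eqP; rewrite -subr_eq0; apply/eqP/enorm_eq0/eqP.
by rewrite -sqrf_eq0 eq_le h sqr_ge0.
Qed.

Lemma jet_diff_bound f j z0 zeta : A_jet e alpha f E -> (omega j : R) <= alpha ->
  E z0 -> E zeta -> z0 != zeta ->
  cabs (jet_diff e alpha f j z0 zeta) <= jnorm f * dist z0 zeta `^ (alpha - (omega j : R)).
Proof.
move=> hf hj Ez0 Ez zz; have [_ h] := jet_norm_term hf hj.
have d0 : 0 < dist z0 zeta.
  by apply: dist_gt0_sphere => //; [exact: hES|exact/sphere_cball/hES].
rewrite -ler_pdivrMr ?powR_gt0// -lee_fin; apply: le_trans h.
by apply: ereal_sup_ubound; exists (z0, zeta).
Qed.

(** The first point of a pair is the centre of the monomials, the second the point whose frame gives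
    the directions of derivation. *)
Let A : set (V * V) := [set p | E p.1 /\ E p.2].

Lemma poly_family_wcoord i : poly_family A 1 (fun p z => wcoord e p.1 z i).
Proof.
apply: (@poly_ext _ _ _ _ _ (fun p z => hdot z (fvec e p.1 i) + - hdot p.1 (fvec e p.1 i))).
  by move=> p z _; rewrite /wcoord hdotBl.
apply: poly_add; first by apply: (@poly_hdot _ _ _ _ _ _ 1) => p [Ep _]; rewrite enorm_fvec.
apply: (@poly_cst _ _ _ _ _ _ 1) => p [Ep _]; rewrite cabsN.
apply: le_trans (CauchySchwarz _ _) _.
by rewrite enorm_fvec// (hES Ep) mulr1.
Qed.

Lemma poly_family_wmonomial a : (omega a : R) <= alpha ->
  poly_family A d (fun p z => wmonomial a p.1 z).
Proof.
move=> ha; apply: (poly_family_le (omega_degree ha)).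
have := @poly_family_prod _ _ _ A _ (enum idx) (fun i => 1 * a i)%N (fun i p z => wcoord e p.1 z i ^+ a i).
move=> /(_ (fun i => poly_family_exp (a i) (poly_family_wcoord i))).
have -> : (\sum_(i <- enum idx) 1 * a i)%N = (\sum_(i < n.+1) a i)%N.
  by rewrite big_enum; apply: eq_bigr => i _; rewrite mul1n.
by apply: poly_ext => p z _; rewrite /wmonomial big_enum.
Qed.

(** The coefficient of w(., zeta)^j in T_zeta f - T_{z0} f; weights above alpha arise from
    recentring. For z0 = zeta the difference vanishes, and this case is set apart because the
    quotients in [jet_norm] degenerate there. *)
Definition tcoef f j z0 zeta : C := (mfact j)%:R^-1 *
  (if z0 == zeta then 0 else if (omega j : R) <= alpha then jet_diff e alpha f j z0 zeta
   else - Djet e j zeta (taylor e alpha f z0) zeta).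

Lemma Djet_taylor f j z0 zeta : E z0 -> E zeta ->
  Djet e j zeta (taylor e alpha f z0) zeta = \sum_(a <- jet_indices)
    ((mfact a)%:R^-1 * f a z0) *
      lderives (fvec e zeta) j (enum idx) (wmonomial a z0) zeta.
Proof.
move=> Ez0 Ez.
have hu : forall p i, A p -> enorm (fvec e p.2 i) <= 1.
  by move=> p i [_ Ep]; rewrite enorm_fvec.
have hG : forall a, a \in jet_indices -> poly_family A d (fun p z => wmonomial a p.1 z).
  by move=> a; rewrite mem_jet_indices; exact: poly_family_wmonomial.
have := @lderives_lincomb _ _ _ A d _ jet_indices (fun a p => (mfact a)%:R^-1 * f a p.1)
  (fun a p z => wmonomial a p.1 z) (fun p => fvec e p.2) 1 j (enum idx) hu hG (z0, zeta) (conj Ez0 Ez).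
move=> /(congr1 (fun g : V -> C => g zeta)) /= <-.
rewrite /Djet -/(lderives (fvec e zeta) j (enum idx) (taylor e alpha f z0) zeta).
by congr (lderives _ _ _ _ _); apply/funext => z; rewrite taylorE.
Qed.

(** T_{z0} f is a polynomial of degree at most d, so its Taylor expansion at zeta is exact. The sum
    cannot be limited to omega(j) <= alpha: a tangential coordinate at z0 may have a normal
    component at zeta, of larger weight. *)
Lemma taylor_recenter f z0 zeta z : E z0 -> E zeta ->
  taylor e alpha f z0 z = \sum_(j <- mindices d (enum idx))
    (mfact j)%:R^-1 * Djet e j zeta (taylor e alpha f z0) zeta * wmonomial j zeta z.
Proof.
move=> Ez0 Ez; rewrite taylorE.
have hu : forall p i, A p -> enorm (fvec e p.2 i) <= 1.
  by move=> p i [_ Ep]; rewrite enorm_fvec.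
transitivity (\sum_(a <- jet_indices) (mfact a)%:R^-1 * f a z0 *
   \sum_(j <- mindices d (enum idx)) ((mfact j)%:R^-1 * wmonomial j zeta z) *
     lderives (fvec e zeta) j (enum idx) (wmonomial a z0) zeta).
  rewrite big_seq [RHS]big_seq; apply: eq_bigr => a; rewrite mem_jet_indices => ha.
  congr (_ * _); rewrite {1}(wcoord_decomp z Ez).
  rewrite (@taylor_multi _ _ _ A d (fun p z => wmonomial a p.1 z) (fun p => fvec e p.2) 1
    (wcoord e zeta z) (enum idx) hu (poly_family_wmonomial ha) (enum_uniq _) (z0, zeta) (conj Ez0 Ez)).
  apply: eq_bigr => j _; congr (_ * _).
  rewrite big_enum /= big_split /= /mfact natr_prod -prodfV; congr (_ * _).
rewrite (eq_bigr (fun a => \sum_(j <- mindices d (enum idx)) ((mfact j)%:R^-1 * wmonomial j zeta z) *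
   (((mfact a)%:R^-1 * f a z0) * lderives (fvec e zeta) j (enum idx) (wmonomial a z0) zeta))); last first.
  by move=> a _; rewrite mulr_sumr; apply: eq_bigr => j _; rewrite mulrCA.
rewrite exchange_big /=; apply: eq_bigr => j _.
by rewrite Djet_taylor// -mulr_sumr mulrAC.
Qed.

Lemma taylor_diff f z0 zeta z : E z0 -> E zeta ->
  taylor e alpha f zeta z - taylor e alpha f z0 z =
  \sum_(j <- mindices d (enum idx)) tcoef f j z0 zeta * wmonomial j zeta z.
Proof.
move=> Ez0 Ez; rewrite /tcoef; have [->|zz] := eqVneq z0 zeta.
  by rewrite subrr big1// => j _; rewrite mulr0 mul0r.
rewrite (taylor_recenter f z Ez0 Ez) taylorE big_filter.
rewrite big_mkcond -sumrB; apply: eq_bigr => j _.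
by case: ifP => hj; rewrite /jet_diff; ring.
Qed.

End Jets.

(** * Orders of monomials and of differences of Taylor polynomials *)

Section JetOrder.
Context {R : realType} {n : nat}.
Local Notation C := (Cplx R).
Local Notation V := (Cn R n).
Local Notation idx := 'I_n.+1.
Variables (E : set V) (e : V -> 'M[C]_(n, n.+1)) (alpha : R).
Hypothesis hES : E `<=` sphere.
Hypothesis he : tangent_frame E e.
Hypothesis E0 : E !=set0.
Implicit Types (z w v : V) (j : multiindex n) (f : multiindex n -> V -> C).
Local Notation jnorm := (jnorm E e alpha).

Lemma smooth_at_coord (l : idx) z : smooth_at z (fun w : V => w 0 l : C).
Proof.
have h := @smooth_family_hdot _ _ unit setT z (fun _ => ebase l : V) (enorm (ebase l : V)) (fun _ _ => lexx _).
apply: smooth_at_eq h; apply: filterE => w; rewrite /hdot (bigD1 l)//= big1 ?addr0.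
  by rewrite mxE !eqxx rmorph1 mulr1.
by move=> i il; rewrite mxE (negbTE il) andbF rmorph0 mulr0.
Qed.

(** A coordinate is affine in z: the left part of the index type carries the linear coefficients and
    ['I_1] the constant term, all bounded by 1 since zeta and the frame vectors are unit vectors. *)
Lemma wcoord_separated i : exists (b : idx + 'I_1 -> V -> C) (c : idx + 'I_1 -> V -> C),
  [/\ forall o z, smooth_at z (b o), forall o zeta, E zeta -> cabs (c o zeta) <= 1 &
      forall zeta z, wcoord e zeta z i = \sum_o b o z * c o zeta].
Proof.
exists (fun o z => if o is inl l then z 0 l else 1).
exists (fun o zeta => if o is inl l then (fvec e zeta i 0 l)^* else - hdot zeta (fvec e zeta i)).
split=> [[l|l] z|[l|l] zeta Ez|zeta z] /=.
- exact: smooth_at_coord.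
- exact: smooth_at_cst.
- by rewrite cabsJ -(enorm_fvec hES he i Ez) cabs_coord_le.
- rewrite cabsN; apply: le_trans (CauchySchwarz _ _) _.
  by rewrite (enorm_fvec hES he i Ez) (hES Ez) mulr1.
- by rewrite big_sumType /= big_ord1 mul1r /wcoord hdotBl.
Qed.

Section Monomial.
Context {P : Type}.
Variables (dom : P -> V -> Prop) (zeta : P -> V).
Hypothesis dom_cball : forall p z, dom p z -> cball z.
Hypothesis dom_E : forall p z, dom p z -> E (zeta p).
Hypothesis dom_gt0 : forall p z, dom p z -> 0 < dist z (zeta p).
Local Notation ord := (order dom (fun p z => dist z (zeta p)) (fun _ _ => 1)).

(** The normal coordinate is -K, of order 1. A tangential one is at most |z - zeta| <= (2 d(z,
    zeta))^(1/2), and from this [order_half] gives all its derivatives. *)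
Lemma order_wcoord i : ord (if i == ord_max then 1 else 2^-1)
  (fun p z => wcoord e (zeta p) z i).
Proof.
have dom_sphere : forall p z, dom p z -> sphere (zeta p) by move=> p z /dom_E; exact: hES.
case: eqP => [->|/eqP im].
  have h1 := order_kern dom_cball dom_sphere dom_gt0.
  have h0 := order_cst dom_cball dom_sphere dom_gt0 (-1).
  have dl2 := dom_le2 dom_cball dom_sphere.
  move=> k; have := order1M dom_cball dom_gt0 dl2 h0 h1 k; rewrite add0r.
  apply: order_upto_eq => p z dz; apply: filterE => w.
  rewrite mulN1r (kern_sphere _ (dom_sphere _ _ dz)) /wcoord fvec_max.
  by rewrite -hdotNl opprB.
have [b [c [hb hc Ew]]] := wcoord_separated i.
have h := @order_half _ _ _ dom zeta dom_cball dom_sphere dom_gt0 _ b (fun o p => c o (zeta p)) 1 2^-1 (lexx _).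
move=> k; apply: order_upto_eq (h _ _ _ k).
- by move=> p z _; apply: filterE => w; rewrite Ew.
- by move=> o z _; exact: hb.
- by move=> o p z /dom_E; exact: hc.
- exists (Num.sqrt 2); first exact: sqrtr_ge0.
  move=> p z dz; rewrite -Ew /wcoord; apply: le_trans (CauchySchwarz _ _) _.
  rewrite (enorm_fvec hES he i (dom_E dz)) mulr1 powR12_sqrt ?dist_ge0// -sqrtrM//.
  rewrite -[leLHS]ger0_norm ?enorm_ge0// -sqrtr_sqr ler_wsqrtr//.
  exact: enorm_sqr_le (dom_cball dz) (dom_sphere _ _ dz).
Qed.

Lemma order_wmonomial j : ord (omega j) (fun p z => wmonomial e j (zeta p) z).
Proof.
have dom_sphere : forall p z, dom p z -> sphere (zeta p) by move=> p z /dom_E; exact: hES.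
have dl2 := dom_le2 dom_cball dom_sphere.
have h1 i := order1_exp dom_cball dom_gt0 dl2 (j i) (order_wcoord i).
have := order1_prod dom_cball dom_gt0 dl2 (index_enum idx) h1.
have -> : \sum_(i <- index_enum idx) (if i == ord_max then 1 else 2^-1) * (j i)%:R = omega j :> R.
  rewrite (bigD1 ord_max)//= eqxx mul1r /omega; congr (_ + _).
  rewrite mulr_suml; apply: eq_bigr => i /negbTE ->; exact: mulrC.
by [].
Qed.

End Monomial.

(** The parameter is (f, (z0, zeta)); with f among the parameters, the constants of [order] are
    independent of the jet. The inequality d(z, z0) <= d(z, zeta) is what remains here of z0 being
    nearest to z. *)
Definition jet_dom (p : (multiindex n -> V -> C) * (V * V)) z :=
  [/\ A_jet e alpha p.1 E, E p.2.1 /\ E p.2.2, cball z, 0 < dist z p.2.1 &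
      dist z p.2.1 <= dist z p.2.2].

Lemma jet_dom_cball p z : jet_dom p z -> cball z. Proof. by case. Qed.
Lemma jet_dom_E p z : jet_dom p z -> E p.2.2. Proof. by case=> _ []. Qed.
Lemma jet_dom_sphere p z : jet_dom p z -> sphere p.2.2.
Proof. by move=> /jet_dom_E; exact: hES. Qed.
Lemma jet_dom_gt0 p z : jet_dom p z -> 0 < dist z p.2.2.
Proof. by case=> _ _ _; exact: lt_le_trans. Qed.
Lemma jet_dom_le2 p z : jet_dom p z -> dist z p.2.2 <= 2.
Proof. exact: dom_le2 jet_dom_cball jet_dom_sphere _ _. Qed.

(** For omega(j) <= alpha the jet norm yields the exponent alpha - omega(j). For omega(j) > alpha
    the coefficient is only bounded, exponent 0. The minimum covers both cases, and multiplication
    by w^j gives order at least alpha in each. *)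
Lemma tcoef_bound j : exists2 c : R, 0 <= c & forall p z, jet_dom p z ->
  cabs (tcoef e alpha p.1 j p.2.1 p.2.2) <=
    c * jnorm p.1 * dist z p.2.2 `^ (alpha - Num.min alpha (omega j)).
Proof.
have mf0 : 0 <= (mfact j)%:R^-1 :> R by rewrite invr_ge0.
have cmf (i : multiindex n) : cabs ((mfact i)%:R^-1 : C) = (mfact i)%:R^-1.
  by rewrite cabsV cabs_nat.
have [hj|hj] := leP (omega j : R) alpha.
  (* 6 = 4 + 2 from [quasi_triangle], as d(z, z0) <= d(z, zeta). *)
  exists ((mfact j)%:R^-1 * 6 `^ (alpha - omega j)).
    by rewrite mulr_ge0 ?powR_ge0.
  move=> [f [z0 zeta]] z [hf [Ez0 Ez] bz dz dle]; rewrite /tcoef /= hj cabsM cmf.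
  have [_|zz] := eqVneq z0 zeta.
    by rewrite cabs0 mulr0 !mulr_ge0 ?powR_ge0 ?jnorm_ge0.
  rewrite -!mulrA ler_wpM2l//; apply: le_trans (jet_diff_bound hES E0 hf hj Ez0 Ez zz) _.
  rewrite mulrCA ler_wpM2l ?jnorm_ge0// -powRM ?dist_ge0//.
  apply: ge0_ler_powR; rewrite ?nnegrE ?subr_ge0 ?mulr_ge0 ?dist_ge0//.
  by have := quasi_triangle bz (hES Ez0) (hES Ez); move: dle; rewrite /=; lra.
rewrite subrr.
pose A : set (V * V) := [set p | E p.1 /\ E p.2].
(* Derivatives of a monomial stay in a family of polynomials with coefficients bounded uniformly in
   z0 and zeta, hence are bounded on the unit ball. *)
have hb a : exists B : R, a \in jet_indices (n := n) alpha -> 0 <= B /\ forall z0 zeta, E z0 -> E zeta ->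
    cabs (lderives (fvec e zeta) j (enum idx) (wmonomial e a z0) zeta) <= B.
  have [ha|ha] := boolP (a \in jet_indices (n := n) alpha); last by exists 0.
  have hG : poly_family A (Num.truncn (2 * alpha)) (fun p z => wmonomial e a p.1 z).
    by apply: poly_family_wmonomial => //; rewrite -mem_jet_indices.
  have hu : forall p i, A p -> enorm (fvec e p.2 i) <= 1.
    by move=> p i [_ Ep]; rewrite (enorm_fvec hES he).
  have [B B0 hB] := poly_family_bound 1 (poly_family_lderives j (enum idx) hu hG).
  exists B => _; split => // z0 zeta Ez0 Ez; apply: (hB (z0, zeta)) => //=.
  by rewrite (hES Ez).
have [B hB] := @choice _ _ _ hb.
pose K : R := \sum_(a <- jet_indices (n := n) alpha) (mfact a)%:R^-1 * `|B a|.
have K0 : 0 <= K by apply: sumr_ge0 => a _; rewrite mulr_ge0.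
exists ((mfact j)%:R^-1 * K); first exact: mulr_ge0.
move=> [f [z0 zeta]] z [hf [Ez0 Ez] bz dz dle]; rewrite /tcoef /= powRr0 mulr1.
rewrite (leNgt (omega j : R) alpha) hj /= cabsM cmf -mulrA ler_wpM2l//.
case: ifP => _; first by rewrite cabs0 mulr_ge0 ?jnorm_ge0.
rewrite cabsN (Djet_taylor alpha hES he)//; apply: le_trans (ler_cabs_sum _ _ _) _.
rewrite /K mulr_suml big_seq [leRHS]big_seq; apply: ler_sum => a ha.
rewrite !cabsM cmf mulrAC -!mulrA ler_wpM2l ?invr_ge0//.
have [B0 hBa] := hB a ha.
apply: ler_pM; rewrite ?cabs_ge0//.
  by apply: le_trans (hBa _ _ Ez0 Ez) (ler_norm _).
by apply: jet_bound => //; rewrite -mem_jet_indices.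
Qed.

Lemma order_taylor_diff : order jet_dom (fun p z => dist z p.2.2) (fun p _ => jnorm p.1) alpha
  (fun p z => taylor e alpha p.1 p.2.2 z - taylor e alpha p.1 p.2.1 z).
Proof.
move=> k; apply: (@order_upto_eq _ _ _ _ _ _ _ _ (fun p z =>
  \sum_(j <- mindices (Num.truncn (2 * alpha)) (enum idx)) tcoef e alpha p.1 j p.2.1 p.2.2 * wmonomial e j p.2.2 z)).
  move=> p z [_ [Ez0 Ez] _ _ _]; apply: filterE => w.
  by rewrite (taylor_diff alpha hES he p.1 w Ez0 Ez).
apply: (order_sum jet_dom_cball) => [p z _|j _ {}k]; first exact: jnorm_ge0.
have h1 : order_upto jet_dom (fun p z => dist z p.2.2) k (fun p _ => jnorm p.1)
    (alpha - Num.min alpha (omega j)) (fun p _ => tcoef e alpha p.1 j p.2.1 p.2.2).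
  apply: (order_upto_cst jet_dom_cball) => [|p z _]; last exact: jnorm_ge0.
  exact: tcoef_bound.
have h2 := order_wmonomial jet_dom_cball jet_dom_E jet_dom_gt0 j k.
have := order_uptoM jet_dom_cball jet_dom_gt0 (fun p z _ => jnorm_ge0 e alpha E0 p.1)
  (fun _ _ _ => ler01) h1 h2.
apply: (order_upto_weaken jet_dom_gt0 jet_dom_le2).
- by rewrite -addrA lerDl addrC subr_ge0 ge_min lexx orbT.
- by move=> p z _; rewrite mulr1; exact: jnorm_ge0.
- by exists 1 => // p z _; rewrite mulr1 mul1r.
Qed.

Lemma taylor_bounded L : exists2 c : R, 0 <= c & forall f z0 z, A_jet e alpha f E -> E z0 ->
  cball z -> cabs (wapplys L (taylor e alpha f z0) z) <= c * jnorm f.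
Proof.
pose dom (p : (multiindex n -> V -> C) * V) z := [/\ A_jet e alpha p.1 E, E p.2 & cball z].
(* In the constant gauge 1, order 0 means that all derivatives are bounded. *)
pose g (_ : (multiindex n -> V -> C) * V) (_ : V) : R := 1.
have dc p z : dom p z -> cball z by case.
have g0 p z : dom p z -> 0 < g p z by [].
have g2 p z : dom p z -> g p z <= 2 by rewrite /g => _; lra.
have hw i : order dom g (fun _ _ => 1) 0 (fun p z => wcoord e p.2 z i).
  have [b [c [hb hc Ew]]] := wcoord_separated i.
  have h := @order1_separated _ _ _ dom g dc g0 g2 _ b (fun o p => c o p.2) 1 (fun o z _ => hb o z).
  move=> k; apply: order_upto_eq (h _ k).
    by move=> p z _; apply: filterE => w; rewrite Ew.
  by move=> o p z [_ Ez _]; exact: hc.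
have hm j : order dom g (fun _ _ => 1) 0 (fun p z => wmonomial e j p.2 z).
  have h1 i := order1_exp dc g0 g2 (j i) (hw i).
  have := order1_prod dc g0 g2 (index_enum idx) h1.
  by rewrite big1// => i _; rewrite mul0r.
suff h : order dom g (fun p _ => jnorm p.1) 0 (fun p z => taylor e alpha p.1 p.2 z).
  have [c c0 hc] := order_bound L h; exists c => // f z0 z hf Ez0 bz.
  by have := hc (f, z0) z; rewrite /g powR1 mulr1; apply.
move=> k; apply: (@order_upto_eq _ _ _ _ _ _ _ _ (fun p z =>
  \sum_(j <- jet_indices (n := n) alpha) ((mfact j)%:R^-1 * p.1 j p.2) * wmonomial e j p.2 z)).
  by move=> p z _; apply: filterE => w; rewrite taylorE.
apply: (order_sum dc) => [p z _|j jJ {}k]; first exact: jnorm_ge0.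
have h1 : order_upto dom g k (fun p _ => jnorm p.1) 0 (fun p _ => (mfact j)%:R^-1 * p.1 j p.2).
  apply: (order_upto_cst dc) => [|p z _]; last exact: jnorm_ge0.
  exists (mfact j)%:R^-1; first by rewrite invr_ge0.
  move=> p z [hf Ez _]; rewrite powRr0 mulr1 cabsM cabsV cabs_nat ler_wpM2l ?invr_ge0//.
  by apply: jet_bound => //; rewrite -mem_jet_indices.
have := order_uptoM dc g0 (fun p z _ => jnorm_ge0 e alpha E0 p.1)
  (fun _ _ _ => ler01) h1 (hm j k).
apply: (order_upto_weaken g0 g2).
- by rewrite addr0.
- by move=> p z _; rewrite mulr1; exact: jnorm_ge0.
- by exists 1 => // p z _; rewrite mulr1 mul1r.
Qed.

End JetOrder.

(** * Growth of the measure *)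

Section Growth.
Context {R : realType} {n : nat}.
Local Notation C := (Cplx R).
Local Notation V := (Cn R n).
Local Notation B := (borelCn R n).
Implicit Types (z w x : V) (r s : R).

Lemma borel_open (U : set V) : open U -> measurable (U : set B).
Proof. by move=> oU; apply: sub_sigma_algebra. Qed.
Lemma borel_closed (F : set V) : closed F -> measurable (F : set B).
Proof.
move=> cF; have oF : open (~` F : set V) by rewrite openC.
by rewrite -(setCK F); apply: measurableC; exact: borel_open.
Qed.
Lemma borel_dball x r : measurable (dball x r : set B).
Proof.
have -> : dball x r = cball `&` [set w | dist w x < r].
  by apply/seteqP; split=> w [h1 h2]; split => //; move: h2; rewrite /= distC.
apply: measurableI; first by apply: borel_closed; exact: cball_closed.
apply: borel_open; rewrite openE => w /= hw.
have /continuousVRP := @continuous_dist _ _ w x; move=> /(_ (r - dist w x)).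
rewrite subr_gt0 => /(_ hw)[dl dl0 h]; apply/nbhs_enormP; exists dl => // u /h.
by rewrite ltr_norml => /andP[_]; rewrite ltrBlDr subrK.
Qed.

Variables (E : set V) (upsilon : R) (mu : probability B R).
Hypothesis hES : E `<=` sphere.
Hypothesis mE : measurable (E : set B).
Hypothesis hU : upper_class upsilon E mu.
Hypothesis hD : doubling E mu.

Definition mball x r : R := fine (mu (dball x r)).
Lemma mballE x r : (mball x r)%:E = mu (dball x r).
Proof. by rewrite fineK// fin_num_measure//; exact: borel_dball. Qed.
Lemma mball_ge0 x r : 0 <= mball x r.
Proof. exact: fine_ge0. Qed.
Lemma mball_le1 x r : mball x r <= 1.
Proof. by rewrite -lee_fin mballE probability_le1//; exact: borel_dball. Qed.
Lemma le_mball x r r' : r <= r' -> mball x r <= mball x r'.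
Proof.
move=> rr; rewrite -lee_fin !mballE le_measure ?inE//; try exact: borel_dball.
by move=> w [h1 h2]; split => //; exact: lt_le_trans h2 rr.
Qed.
Lemma mball_large x r : E x -> 2 < r -> mball x r = 1.
Proof.
move=> Ex r2; apply/le_anti; rewrite mball_le1 /= -lee_fin mballE -hU.1.
rewrite le_measure ?inE//; first exact: borel_dball.
move=> w Ew; split; first by apply: sphere_cball; exact: hES.
by apply: le_lt_trans r2; apply: dist_le2; by apply: sphere_cball; exact: hES.
Qed.

Lemma mball_doubling : exists2 c : R, 0 < c & forall x r, E x -> 0 < r ->
  mball x (2 * r) <= c * mball x r.
Proof.
have [_ [c c0 h]] := hD; exists c => // x r Ex r0.
by rewrite -lee_fin EFinM !mballE h.
Qed.

(** If a ball were null, doubling would make all its dilates null; but a ball of radius above 2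
    contains E. *)
Lemma mball_gt0 x r : E x -> 0 < r -> 0 < mball x r.
Proof.
move=> Ex r0; rewrite lt0r mball_ge0 andbT; apply/eqP => m0.
have [c c0 h] := mball_doubling.
have hk k : mball x (2 ^+ k * r) = 0.
  elim: k => [|k IH]; first by rewrite mul1r.
  apply/le_anti; rewrite mball_ge0 andbT exprS -mulrA.
  by apply: le_trans (h _ _ Ex _) _; rewrite ?mulr_gt0 ?exprn_gt0// IH mulr0.
have [k hk2] : exists k : nat, 2 < 2 ^+ k * r.
  exists (Num.truncn (2 / r)).+1; rewrite -ltr_pdivrMr//.
  apply: lt_trans (truncnS_gt _) _.
  by rewrite -natrX ltr_nat ltn_expl.
by have := mball_large Ex hk2; rewrite hk => /eqP; rewrite eq_sym oner_eq0.
Qed.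

Lemma upper_fine : exists2 c : R, 0 < c & forall x r (k : R), E x -> 0 < r -> 1 < k -> k * r <= 1 ->
  mball x (k * r) <= c * k `^ upsilon * mball x r.
Proof.
have [_ [c c0 h]] := hU; exists c => // x r k Ex r0 k1 kr.
rewrite -lee_fin EFinM !mballE h//; by rewrite ltr_pMl.
Qed.

(** If upsilon < 0, the dilation k with k^upsilon = 1 / (c + 2) would give mu(B(x, 1)) <= c / (c +
    2) mu(B(x, 1/k)) < mu(B(x, 1)). *)
Lemma upsilon_ge0 : 0 <= upsilon.
Proof.
rewrite leNgt; apply/negP => u0; have [c c0 h] := upper_fine.
have [x Ex] : E !=set0.
  apply/set0P/eqP => E0; have := hU.1; rewrite E0 measure0 => /eqP.
  by rewrite eq_sym onee_eq0.
pose k := (c + 2) `^ (- upsilon)^-1.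
have k1 : 1 < k.
  have := @gt0_ltr_powR R (- upsilon)^-1; rewrite invr_gt0 oppr_gt0 => /(_ u0 1 (c + 2)).
  by rewrite powR1 !nnegrE; apply; lra.
have k0 : 0 < k := lt_trans ltr01 k1.
have := h x k^-1 k Ex; rewrite invr_gt0 k0 divff ?gt_eqF// => /(_ isT k1 (lexx _)) h1.
have h2 : mball x k^-1 <= mball x 1 by rewrite le_mball// invf_le1// ltW.
have m1 := mball_gt0 Ex ltr01.
have e : k `^ upsilon = (c + 2)^-1.
  rewrite /k -powRrM invrN mulNr mulVf ?lt_eqF// powRN powRr1//.
  by rewrite addr_ge0// ltW.
have h3 : c * (c + 2)^-1 < 1 by rewrite ltr_pdivrMr ?mul1r; lra.
have c2 : 0 <= c * (c + 2)^-1 by rewrite divr_ge0//; lra.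
move: h1; rewrite e => h1.
have := le_trans h1 (ler_wpM2l c2 h2); rewrite leNgt => /negP; apply.
by rewrite gtr_pMl.
Qed.

(** The class U_upsilon only covers k r <= 1. Beyond that the left side is at most 1, and doubling
    twice bounds mu(B(x, 1)) from below because B(x, 4) contains E. The four cases are k = 1, k r <=
    1, r < 1 < k r, and r >= 1. *)
Lemma mball_growth : exists2 c : R, 0 <= c & forall x r (k : R), E x -> 0 < r -> 1 <= k ->
  mball x (k * r) <= c * k `^ upsilon * mball x r.
Proof.
have [c c0 hc] := upper_fine; have [cd cd0 hd] := mball_doubling.
have u0 := upsilon_ge0.
have h1 x : E x -> 1 <= cd ^+ 2 * mball x 1.
  move=> Ex; have e4 : 2 * (2 * 1) = 4 :> R by ring.
  have := hd x (2 * 1) Ex; rewrite e4 mball_large ?ltr_nat//.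
  have p2 : 0 < 2 * 1 :> R by lra.
  move=> /(_ p2)/le_trans; apply.
  by rewrite expr2 -mulrA ler_wpM2l ?(ltW cd0)//; apply: hd.
exists (1 + c + cd ^+ 2 * c + cd ^+ 2).
  by rewrite !addr_ge0 ?mulr_ge0 ?exprn_ge0 ?ltW.
move=> x r k Ex r0 k1; have ku : 1 <= k `^ upsilon.
  by rewrite -(powRr0 k) ler_powR.
have m0 := mball_ge0 x r.
have q0 : 0 <= cd ^+ 2 by rewrite exprn_ge0 ?ltW.
have p0 : 0 <= k `^ upsilon * mball x r by rewrite mulr_ge0 ?powR_ge0.
suff : [\/ mball x (k * r) <= 1 * (k `^ upsilon * mball x r),
   mball x (k * r) <= c * (k `^ upsilon * mball x r),
   mball x (k * r) <= cd ^+ 2 * c * (k `^ upsilon * mball x r) |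
   mball x (k * r) <= cd ^+ 2 * (k `^ upsilon * mball x r)].
  have a2 : 0 <= c * (k `^ upsilon * mball x r) by rewrite mulr_ge0 ?(ltW c0).
  have a3 : 0 <= cd ^+ 2 * c * (k `^ upsilon * mball x r) by rewrite mulr_ge0// mulr_ge0 ?(ltW c0).
  have a4 : 0 <= cd ^+ 2 * (k `^ upsilon * mball x r) by rewrite mulr_ge0.
  by rewrite -mulrA 3!mulrDl mul1r; case; lra.
move: k1; rewrite le_eqVlt => /orP[/eqP <-|k1].
  by apply: Or41; rewrite powR1 !mul1r.
have [kr|kr] := leP (k * r) 1.
  by apply: Or42; rewrite mulrA; exact: hc.
have [r1|r1] := ltP r 1.
  apply: Or43; apply: le_trans (mball_le1 _ _) _; apply: le_trans (h1 x Ex) _.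
  rewrite -mulrA ler_wpM2l//.
  have := hc x r r^-1 Ex r0; rewrite invf_gt1// mulVf ?gt_eqF// => /(_ r1 (lexx _)).
  move=> /le_trans; apply; rewrite -mulrA; apply: ler_wpM2l; first exact: ltW.
  apply: ler_wpM2r => //; apply: (ge0_ler_powR u0); rewrite ?nnegrE.
  - by rewrite invr_ge0 ltW.
  - by apply: ltW; exact: lt_trans k1.
  - by rewrite -div1r ler_pdivrMr// ltW.
apply: Or44; apply: le_trans (mball_le1 _ _) _; apply: le_trans (h1 x Ex) _.
rewrite ler_wpM2l//; apply: le_trans (le_mball x r1) _.
by rewrite ler_peMl.
Qed.

Lemma dyadic_integral (a : nat -> R) (D : nat -> set V) (N : nat) :
  (forall k, 0 <= a k) -> (forall k, measurable (D k : set B)) ->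
  mu.-integrable (E : set B) (EFin \o (fun t : B => \sum_(k < N) a k * \1_(D k) t)) /\
  \int[mu]_(t in (E : set B)) (\sum_(k < N) a k * \1_(D k) t) <=
    \sum_(k < N) a k * fine (mu (D k)).
Proof.
move=> a0 mD.
have i1 k : mu.-integrable (E : set B) (EFin \o (fun t : B => \1_(D k) t)).
  apply: (bounded_integrable mu mE).
    apply: measurable_indic; exact: mD.
  by exists 1 => t _; rewrite indicE; case: (_ \in _); rewrite ?normr1 ?normr0.
have iZ k : mu.-integrable (E : set B) (EFin \o (fun t : B => a k * \1_(D k) t)).
  apply: (bounded_integrable mu mE).
    by apply: measurable_funM; [exact: measurable_cst|apply: measurable_indic; exact: mD].
  exists (a k) => t _; rewrite normrM (ger0_norm (a0 k)) indicE.
  by case: (_ \in _); rewrite ?normr1 ?normr0 ?mulr1 ?mulr0.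
elim: N => [|N [iN hN]].
  have -> : (fun t : B => \sum_(k < 0) a k * \1_(D k) t) = (fun _ => 0).
    by apply/funext => t; rewrite big_ord0.
  rewrite big_ord0 Rintegral_cst// mul0r; split => //.
  apply: (bounded_integrable mu mE); first exact: measurable_cst.
  by exists 0 => t _; rewrite normr0.
have -> : (fun t : B => \sum_(k < N.+1) a k * \1_(D k) t) =
    (fun t => \sum_(k < N) a k * \1_(D k) t + a N * \1_(D N) t).
  by apply/funext => t; rewrite big_ord_recr.
split; first by have := integrableD mE iN (iZ N); apply: eq_integrable.
rewrite RintegralD// big_ord_recr /= lerD// RintegralZl// ler_wpM2l//.
rewrite /Rintegral integral_indic//; apply: fine_le.
- by rewrite fin_num_measure//; exact: measurableI.
- by rewrite fin_num_measure.
- by apply: le_measure; rewrite ?inE//; first [exact: measurableI|exact: subIsetl].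
Qed.

(* Cover E by the balls B(z0, 9 2^k delta), on whose shells d(z, zeta) is about
   2^k delta; finitely many suffice as d <= 2, and their measures grow at most
   like 2^(k upsilon). *)
Lemma kernel_integral s : upsilon < s -> exists2 c : R, 0 <= c &
  forall z z0, cball z -> E z0 -> 0 < dist z z0 ->
    (forall zeta, E zeta -> dist z z0 <= dist z zeta) ->
  exists2 h : B -> R, mu.-integrable (E : set B) (EFin \o h) /\
      (forall zeta, E zeta -> dist z zeta `^ (- s) <= h zeta) &
      \int[mu]_(t in (E : set B)) h t <= c * dist z z0 `^ (- s) * mball z0 (3 * dist z z0).
Proof.
move=> us; have [c c0 hc] := mball_growth; have u0 := upsilon_ge0.
have s0 : 0 < s by exact: le_lt_trans us.
(* The ratio of the dyadic series: the mass grows like 2^(k upsilon) and the kernel decays like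
   2^(-k s). *)
pose rho : R := 2 `^ (upsilon - s).
have rho0 : 0 <= rho by exact: powR_ge0.
have rho1 : rho < 1.
  rewrite /rho -[upsilon - s]opprK powRN invf_lt1 ?powR_gt0//.
  have := @gt0_ltr_powR R (- (upsilon - s)); rewrite opprB subr_gt0 => /(_ us 1 2).
  by rewrite powR1 !nnegrE; apply; lra.
exists (c * 3 `^ upsilon * (1 - rho)^-1).
  by rewrite !mulr_ge0 ?powR_ge0// invr_ge0 subr_ge0 ltW.
move=> z z0 bz Ez0 dl0 hmin; set dl := dist z z0.
have [N hN] : exists N : nat, 2 < 2 ^+ N.+1 * dl.
  exists (Num.truncn (2 / dl)); rewrite -ltr_pdivrMr//.
  apply: lt_trans (truncnS_gt _) _.
  by rewrite -natrX ltr_nat ltn_expl.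
pose a (k : nat) : R := (2 ^+ k * dl) `^ (- s).
(* Where d(z, zeta) < 2^(k+1) delta, [quasi_triangle] gives d(z0, zeta) < 8 2^k delta. The radius 9
   2^k delta is written as a multiple of 3 delta, the radius of B_z. *)
pose D (k : nat) : set V := dball z0 (3 * 2 ^+ k * (3 * dl)).
have a0 k : 0 <= a k by exact: powR_ge0.
have p2 k : 0 < 2 ^+ k :> R by rewrite exprn_gt0.
have [ih hi] := @dyadic_integral a D N.+1 a0 (fun k => borel_dball _ _).
exists (fun t : B => \sum_(k < N.+1) a k * \1_(D k) t).
  split => // zeta Ezeta.
  have d2 : dist z zeta <= 2 by apply: dist_le2 => //; apply: sphere_cball; exact: hES.
  have ex : exists k, dist z zeta < 2 ^+ k.+1 * dl by exists N; exact: le_lt_trans hN.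
  case: (ex_minnP ex) => k hk kmin.
  have kN : (k < N.+1)%N by rewrite ltnS kmin//; exact: le_lt_trans hN.
  have klow : 2 ^+ k * dl <= dist z zeta.
    case: k hk kmin {kN} => [|k] hk kmin; first by rewrite mul1r hmin.
    by rewrite leNgt; apply/negP => /kmin; rewrite ltnn.
  have hD' : zeta \in D k.
    rewrite inE; split; first by apply: sphere_cball; exact: hES.
    have := quasi_triangle bz (hES Ez0) (hES Ezeta); rewrite -/dl.
    move: hk; rewrite exprS => hk.
    have h1 : dl <= 2 ^+ k * dl by rewrite ler_peMl ?exprn_ege1 ?ler1n// ltW.
    have h2 : 0 < 2 ^+ k * dl by rewrite mulr_gt0.
    have -> : 3 * 2 ^+ k * (3 * dl) = 9 * (2 ^+ k * dl) by ring.
    by move: hk; rewrite -mulrA; lra.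
  rewrite (bigD1 (Ordinal kN))//= indicE hD' mulr1 -[leLHS]addr0 lerD//.
    rewrite /a !powRN lef_pV2 ?posrE ?powR_gt0 ?mulr_gt0//; last first.
      exact: lt_le_trans (hmin _ Ezeta).
    apply: ge0_ler_powR; rewrite ?nnegrE ?(ltW s0) ?dist_ge0//.
    by rewrite mulr_ge0// ltW.
  by apply: sumr_ge0 => i _; rewrite mulr_ge0 ?a0// indicE; case: (_ \in _).
apply: le_trans hi _.
apply: (@le_trans _ _ (\sum_(k < N.+1) (c * 3 `^ upsilon * dl `^ (- s) * mball z0 (3 * dl)) * rho ^+ k)).
  apply: ler_sum => k _; rewrite -/(mball z0 (3 * 2 ^+ k * (3 * dl))).
  have h1 : 1 <= 3 * 2 ^+ k :> R.
    have : 1 <= 2 ^+ k :> R by rewrite exprn_ege1// ler1n.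
    by lra.
  have := hc z0 (3 * dl) (3 * 2 ^+ k) Ez0; rewrite mulr_gt0// => /(_ isT h1) h2.
  apply: le_trans (ler_wpM2l (a0 k) h2) _.
  have e2 : (2 ^+ k) `^ (upsilon - s) = rho ^+ k :> R.
    by rewrite /rho -(powR_mulrn k (powR_ge0 _ _)) -(powR_mulrn k (ler0n R 2)) -!powRrM mulrC.
  rewrite /a !powRM ?(ltW (p2 k)) ?(ltW dl0)//.
  rewrite -e2 powRDp ?p2//.
  by rewrite le_eqVlt; apply/orP; left; apply/eqP; ring.
rewrite -mulr_sumr.
have hgeo : \sum_(k < N.+1) rho ^+ k <= (1 - rho)^-1.
  have r0 : 0 < 1 - rho by rewrite subr_gt0.
  rewrite -div1r ler_pdivlMr// mulrC -opprB mulNr -subrX1 opprB.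
  by rewrite lerBlDr lerDl exprn_ge0.
have p : 0 <= c * 3 `^ upsilon * dl `^ (- s) * mball z0 (3 * dl).
  by rewrite !mulr_ge0 ?powR_ge0 ?mball_ge0.
apply: le_trans (ler_wpM2l p hgeo) _.
by rewrite le_eqVlt; apply/orP; left; apply/eqP; ring.
Qed.

End Growth.

(** * The extension operator *)

Section Operators.
Context {R : realType} {n : nat}.
Local Notation C := (Cplx R).
Local Notation V := (Cn R n).
Implicit Types (z w v u : V) (F : V -> C).

Section Field.
Variable X : vfield R n.

Let vidx : finType := ('I_n.+1 + 'I_n.+1)%type.
Let coef (o : vidx) z : C :=
  match o with inl j => mkC (cRe (X z 0 j)) 0 | inr j => mkC (cIm (X z 0 j)) 0 end.
Let dir (o : vidx) : V :=
  match o with inl j => ebase j | inr j => 'i *: (ebase j : V) end.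

Lemma vcoef_smooth_at j z : cball z -> smooth_at z (fun w => X w 0 j : C).
Proof.
by have [U [oU bU h]] := vcoef_smooth X => /bU Uz; exact: smooth_on_at oU (h j) Uz.
Qed.

Let coef_smooth o z : cball z -> smooth_at z (coef o).
Proof.
move=> bz; case: o => j.
  have h := vcoef_smooth_at j bz.
  apply: smooth_at_eq (smooth_atM (smooth_at_cst z (mkC 2^-1 0)) (smooth_atD h (smooth_familyJ h))).
  by apply: filterE => w; apply: cext; rewrite !cE; field.
have h := vcoef_smooth_at j bz.
apply: smooth_at_eq (smooth_atM (smooth_at_cst z (mkC 0 (- 2^-1))) (smooth_atD h
  (smooth_atM (smooth_at_cst z (-1)) (smooth_familyJ h)))).
by apply: filterE => w; apply: cext; rewrite !cE; field.
Qed.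

Lemma vcoef_bounded : exists2 M : R, 0 <= M & forall z, cball z -> enorm (X z) <= M.
Proof.
have h j : exists M : R, 0 < M /\ forall z, cball z -> cabs (X z 0 j) <= M.
  have [M M0 hM] := compact_cabs_bounded (fun z bz => smooth_at_continuous (vcoef_smooth_at j bz)).
  by exists M.
have [M hM] := @choice _ _ _ h.
have p : 0 < \sum_j M j + 1 by rewrite ltr_wpDl// sumr_ge0// => j _; exact: ltW (hM j).1.
exists (n.+1%:R * (\sum_j M j + 1)); first by rewrite mulr_ge0// ltW.
move=> z bz; apply: enorm_le_coord => j; apply: le_lt_trans ((hM j).2 z bz) _.
rewrite (bigD1 j)//= -addrA ltrDl ltr_wpDl// sumr_ge0// => i _; exact: ltW (hM i).1.
Qed.

(** A field with coefficients a_j is the real derivative along the vector a, so its components along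
    e_j and i e_j are Re a_j and Im a_j. *)
Lemma vapply_sum F z : vapply X F z = \sum_o coef o z * rderive (dir o) F z.
Proof.
rewrite big_sumType /= -big_split; apply: eq_bigr => j _ /=.
rewrite /d_dz /d_dzbar.
have key (x a b : C) : x * ((a - 'i * b) / 2) + x^* * ((a + 'i * b) / 2) =
    mkC (cRe x) 0 * a + mkC (cIm x) 0 * b.
  have -> : x * ((a - 'i * b) / 2) + x^* * ((a + 'i * b) / 2) =
     (x + x^*) / 2 * a + (- 'i * (x - x^*)) / 2 * b by ring.
  congr (_ * a + _ * b); apply: (mulIf (_ : (2 : C) != 0)); rewrite ?pnatr_eq0// divfK ?pnatr_eq0//.
    by apply: cext; rewrite !cE; ring.
  by apply: cext; rewrite !cE; ring.
exact: key.
Qed.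

(** The field maps K to minus [hdot (X z) zeta]. If X is complex-tangential, zeta may be replaced
    there by zeta - z, and the result is O(|z - zeta|) = O(d(z, zeta)^(1/2)). *)
Let coef_kern : exists2 c : R, 0 <= c & forall zeta z, sphere zeta -> cball z ->
    cabs (\sum_o coef o z * rderive (dir o) (kern zeta) z) <=
      c * dist z zeta `^ (1 - vweight X).
Proof.
have [M M0 hM] := vcoef_bounded.
have E zeta z : \sum_o coef o z * rderive (dir o) (kern zeta) z = - hdot (X z) zeta.
  rewrite (vec_decomp (X z)) hdot_suml big_sumType /= -big_split -sumrN.
  apply: eq_bigr => j _ /=; rewrite !(is_rderive_val (is_rderive_kern _ _ _)).
  by rewrite hdotDl !(hdotZl _ _ zeta); ring.
rewrite /vweight; case: asboolP => hX.
  exists (M * Num.sqrt 2); first by rewrite mulr_ge0.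
  move=> zeta z hz bz; rewrite E cabsN.
  have -> : hdot (X z) zeta = hdot (X z) (zeta - z) by rewrite hdotBr hX// subr0.
  apply: le_trans (CauchySchwarz _ _) _; rewrite -mulrA.
  apply: ler_pM => //; rewrite ?enorm_ge0 ?hM// enorm_distC.
  have -> : 1 - 2^-1 = 2^-1 :> R by field.
  rewrite powR12_sqrt ?dist_ge0// -sqrtrM//.
  rewrite -[leLHS]ger0_norm ?enorm_ge0// -sqrtr_sqr ler_wsqrtr//.
  exact: enorm_sqr_le.
exists M => // zeta z hz bz; rewrite E cabsN subrr powRr0 mulr1.
by apply: le_trans (CauchySchwarz _ _) _; rewrite hz mulr1 hM.
Qed.

Let vweight_ge : 2^-1 <= vweight X.
Proof. by rewrite /vweight; case: asboolP => // _; lra. Qed.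
Let vweight_le : vweight X <= 1.
Proof. by rewrite /vweight; case: asboolP => // _; lra. Qed.

Definition vfield_wop : wop := WOp coef_smooth vweight_ge vweight_le coef_kern.

Lemma vapplyE F : vapply X F = wapply vfield_wop F.
Proof. by apply/funext => z; exact: vapply_sum. Qed.

End Field.

Lemma opapplyE (XX : seq (vfield R n)) F : opapply XX F = wapplys (map vfield_wop XX) F.
Proof. by elim: XX => //= X XX IH; rewrite -vapplyE IH. Qed.
Lemma opweightE (XX : seq (vfield R n)) : opweight XX = wts (map vfield_wop XX).
Proof. by rewrite /opweight /wts big_map. Qed.

Section Direction.
Variable v : V.

Let dir_smooth (i : 'I_1) z : cball z -> smooth_at z ((fun _ _ => 1) i : V -> C).
Proof. by move=> _; exact: smooth_at_cst. Qed.
Let half_le1 : 2^-1 <= 1 :> R. Proof. by lra. Qed.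
Let dir_kern : exists2 c : R, 0 <= c & forall zeta z, sphere zeta -> cball z ->
    cabs (\sum_(i : 'I_1) ((fun _ _ => 1) i z : C) * rderive ((fun=> v) i) (kern zeta) z) <=
      c * dist z zeta `^ (1 - 1).
Proof.
exists (enorm v); first exact: enorm_ge0.
move=> zeta z hz bz; rewrite big_ord1 mul1r (is_rderive_val (is_rderive_kern _ _ _)) cabsN.
by rewrite subrr powRr0 mulr1; apply: le_trans (CauchySchwarz _ _) _; rewrite hz mulr1.
Qed.

(** A constant direction counts with weight 1; the estimates for operators then also cover the plain
    derivatives in [lipschitz_ball]. *)
Definition dir_wop : wop := WOp dir_smooth half_le1 (lexx 1) dir_kern.

Lemma rderiveE F : rderive v F = wapply dir_wop F.
Proof. by apply/funext => z; rewrite /wapply big_ord1 mul1r. Qed.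

End Direction.

Lemma rderivesE (s : seq V) F : rderives s F = wapplys (map dir_wop s) F.
Proof. by elim: s => //= v s IH; rewrite -rderiveE IH. Qed.
Lemma wts_dir (s : seq V) : wts (map dir_wop s) = (size s)%:R :> R.
Proof.
elim: s => [|v s IH]; first by rewrite /wts big_nil.
by move: IH; rewrite /wts /= big_cons => ->; rewrite -natr1 addrC.
Qed.

End Operators.

(** * Measurability and smoothness of the integrands *)

Section KernelFamilies.
Context {R : realType} {n : nat}.
Local Notation C := (Cplx R).
Local Notation V := (Cn R n).
Local Notation B := (borelCn R n).
Variables (E : set V) (e : V -> 'M[C]_(n, n.+1)) (alpha : R).
Hypothesis Eclosed : closed E.
Hypothesis hES : E `<=` sphere.
Hypothesis he : tangent_frame E e.
Hypothesis E0 : E !=set0.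
Implicit Types (z w v u : V) (f : multiindex n -> V -> C).
Local Notation cmeas := (@cmeas R _ B E).

Lemma measurable_within (g : V -> R) : {within E, continuous g} ->
  measurable_fun (E : set B) g.
Proof.
move=> /continuousP cg mE; apply: (measurability _ (RGenOpens.measurableE R)) => // _ [_ [a [b ->] <-]].
have [U oU hU] := (open_subspaceP _ _).1 (cg _ (@interval_open R (BRight a) (BLeft b) isT isT)).
have -> : E `&` g @^-1` `]a, b[%classic = E `&` U by rewrite setIC -hU setIC.
by apply: measurableI => //; exact: borel_open.
Qed.

Lemma cmeas_within (g : V -> C) : {within E, continuous g} -> cmeas g.
Proof.
move=> cg; split; apply: measurable_within => x.
  exact: (cvg_cRe (cg x)).
exact: (cvg_cIm (cg x)).
Qed.

Lemma cmeas_smooth_at (g : V -> C) : (forall zeta, E zeta -> smooth_at zeta g) -> cmeas g.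
Proof.
move=> h; apply: cmeas_within; apply: continuous_in_subspaceT => x /set_mem Ex.
exact: smooth_at_continuous (h x Ex).
Qed.

Lemma smooth_at_kern_right z zeta : smooth_at zeta (fun u => kern u z).
Proof.
apply: smooth_at_eq (smooth_familyJ (smooth_at_kern z zeta)).
by apply: filterE => u; rewrite /kern raddfB /= rmorph1 -hdotC.
Qed.

Lemma cmeas_kern_cpow w (s : R) : (forall zeta, E zeta -> 0 < cRe (kern zeta w)) ->
  cmeas (fun zeta => cpow (kern zeta w) s).
Proof.
move=> h; apply: cmeas_smooth_at => zeta Ez; apply: smooth_family_cpow; last first.
  exact: smooth_at_kern_right.
apply: (@loc_away_continuous _ _ _ _ _ (fun u => cRe (kern u w))); last exact: h.
apply/continuousVRP => d d0.
have /continuousVP/(_ d d0)[r r0 hr] := smooth_at_continuous (smooth_at_kern_right w zeta).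
by exists r => // u /hr; apply: le_lt_trans; rewrite -cReB cRe_le.
Qed.

Lemma cmeas_wmonomial j w : cmeas (fun zeta => wmonomial e j zeta w).
Proof.
apply: cmeas_smooth_at => zeta Ez; apply: (@smooth_family_prod _ _ unit) => i.
apply: (@smooth_family_exp _ _ unit).
have [U [oU Uz hU]] := he.2 zeta Ez.
have hf l : smooth_at zeta (fun u => fvec e u i 0 l : C).
  rewrite /fvec; case: unliftP => [i' _|_]; last exact: smooth_at_coord.
  apply: smooth_at_eq (smooth_on_at oU (hU i' l) Uz).
  by apply: filterE => u; rewrite mxE.
apply: (@smooth_family_sum _ _ unit) => l _; apply: smooth_atM; last exact: (smooth_familyJ (hf l)).
apply: smooth_at_eq (smooth_atD (smooth_at_cst zeta (w 0 l))
  (smooth_atM (smooth_at_cst zeta (-1)) (smooth_at_coord l zeta))).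
by apply: filterE => u; rewrite !mxE mulN1r.
Qed.

Lemma cmeas_taylor f w : A_jet e alpha f E -> cmeas (fun zeta => taylor e alpha f zeta w).
Proof.
(* The test on omega makes every summand measurable: [cmeas_sum] asks for all indices, while f_j is
   continuous only for omega(j) <= alpha. *)
move=> hf; have h : cmeas (fun zeta => \sum_(j <- jet_indices (n := n) alpha)
    if (omega j : R) <= alpha then (mfact j)%:R^-1 * f j zeta * wmonomial e j zeta w else 0).
  apply: cmeas_sum => j; have [hj|_] := boolP ((omega j : R) <= alpha); last exact: cmeas_cst.
  apply: cmeasM (cmeas_wmonomial j w); apply: cmeasM; first exact: cmeas_cst.
  by apply: cmeas_within; exact: hf.1.
apply: cmeas_eq h => zeta _; rewrite taylorE big_seq [RHS]big_seq; apply: eq_bigr => j.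
by rewrite mem_jet_indices => ->.
Qed.

Lemma smooth_family_wmonomial j z : smooth_family E z (wmonomial e j).
Proof.
apply: smooth_family_prod => i; apply: smooth_family_exp.
have [b [c [hb hc Ew]]] := wcoord_separated hES he i.
apply: (@smooth_family_eq _ _ _ _ _ (fun zeta w => \sum_o b o w * c o zeta)).
  by apply: filterE => w zeta _; rewrite Ew.
apply: smooth_family_sum => o _; apply: smooth_familyM; first exact: smooth_at_const.
exact: smooth_family_cst (hc o).
Qed.

Lemma integrable_family_taylor f z : A_jet e alpha f E ->
  integrable_family (E : set B) z (taylor e alpha f).
Proof.
move=> hf; split; last by apply: filterE => w; exact: cmeas_taylor.
apply: (@smooth_family_eq _ _ _ _ _ (fun zeta w => \sum_(j <- jet_indices (n := n) alpha)
  if (omega j : R) <= alpha then (mfact j)%:R^-1 * f j zeta * wmonomial e j zeta w else 0)).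
  apply: filterE => w zeta _; rewrite taylorE big_seq [RHS]big_seq; apply: eq_bigr => j.
  by rewrite mem_jet_indices => ->.
apply: smooth_family_sum => j _; have [hj|_] := boolP ((omega j : R) <= alpha); last first.
  by apply: (@smooth_family_cst _ _ _ _ _ _ 0) => zeta _; rewrite cabs0.
apply: smooth_familyM; last exact: smooth_family_wmonomial.
apply: (@smooth_family_cst _ _ _ _ _ _ ((mfact j)%:R^-1 * jnorm E e alpha f)) => zeta Ez.
by rewrite cabsM cabsV cabs_nat ler_wpM2l ?invr_ge0// jet_bound.
Qed.

(** An open condition that also makes sense outside the closed ball: derivatives at a boundary point
    involve the integrands on a full neighbourhood. *)
Definition Re_away z := exists2 c : R, 0 < c & forall zeta, E zeta -> c <= cRe (kern zeta z).

Lemma Re_away_gt0 z zeta : Re_away z -> E zeta -> 0 < cRe (kern zeta z).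
Proof. by move=> [c c0 h] /h; exact: lt_le_trans. Qed.

Lemma Re_away_near z : Re_away z -> \forall w \near z, Re_away w.
Proof.
move=> [c c0 h]; have c2 : 0 < c / 2 by rewrite divr_gt0.
apply/nbhs_enormP; exists (c / 2) => // w hw; exists (c / 2) => // zeta Ez.
have -> : kern zeta w = kern zeta z - hdot (w - z) zeta by rewrite /kern hdotBl; ring.
have := CauchySchwarz (w - z) zeta; rewrite (hES Ez) mulr1 => h1.
have := le_trans (cRe_normle _) h1; have := h zeta Ez; rewrite cReB; move: hw; lra.
Qed.

Lemma Re_away_loc z : Re_away z -> loc_away E (fun zeta w => cRe (kern zeta w)) z.
Proof.
move=> [c c0 h]; have c2 : 0 < c / 2 by rewrite divr_gt0.
exists (c / 2) => //; apply/nbhs_enormP; exists (c / 2) => // w hw zeta Ez.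
have -> : kern zeta w = kern zeta z - hdot (w - z) zeta by rewrite /kern hdotBl; ring.
have := CauchySchwarz (w - z) zeta; rewrite (hES Ez) mulr1 => h1.
have := le_trans (cRe_normle _) h1; have := h zeta Ez; rewrite cReB; move: hw; lra.
Qed.

Lemma integrable_family_kern_cpow z (s : R) : Re_away z ->
  integrable_family (E : set B) z (fun zeta w => cpow (kern zeta w) s).
Proof.
move=> hz; split.
  apply: smooth_family_cpow; first exact: Re_away_loc.
  by apply: (@smooth_family_kern _ _ _ _ _ id 1) => zeta Ez; rewrite (hES Ez).
apply: filterS (Re_away_near hz) => w hw; apply: cmeas_kern_cpow => zeta Ez.
exact: Re_away_gt0 hw Ez.
Qed.

Lemma integrable_familyM z (F G : B -> V -> C) : integrable_family (E : set B) z F ->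
  integrable_family (E : set B) z G ->
  integrable_family (E : set B) z (fun zeta w => F zeta w * G zeta w).
Proof.
move=> [f1 f2] [g1 g2]; split; first exact: smooth_familyM.
by apply: filterS2 f2 g2 => w; exact: cmeasM.
Qed.
Lemma integrable_familyD z (F G : B -> V -> C) : integrable_family (E : set B) z F ->
  integrable_family (E : set B) z G ->
  integrable_family (E : set B) z (fun zeta w => F zeta w + G zeta w).
Proof.
move=> [f1 f2] [g1 g2]; split; first exact: smooth_familyD.
by apply: filterS2 f2 g2 => w; exact: cmeasD.
Qed.
Lemma integrable_family_const z (F : V -> C) : smooth_at z F ->
  integrable_family (E : set B) z (fun _ => F).
Proof.
move=> hF; split; first exact: smooth_at_const.
by apply: filterE => w; exact: cmeas_cst.
Qed.

End KernelFamilies.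

(** * Estimates for the derivatives of the extension *)

Section ExtensionEstimates.
Context {R : realType} {n : nat}.
Local Notation C := (Cplx R).
Local Notation V := (Cn R n).
Local Notation B := (borelCn R n).
Variables (E : set V) (upsilon : R) (mu : probability B R).
Variables (e : V -> 'M[C]_(n, n.+1)) (alpha q : R) (near_pt : V -> V).
Hypothesis Eclosed : closed E.
Hypothesis hES : E `<=` sphere.
Hypothesis hU : upper_class upsilon E mu.
Hypothesis hD : doubling E mu.
Hypothesis alpha_gt0 : 0 < alpha.
Hypothesis he : tangent_frame E e.
Hypothesis hq_gt : alpha + upsilon < q.
Hypothesis hnear : forall z, (cball `\` E) z ->
  E (near_pt z) /\ dist z (near_pt z) = dist_set z E.
Hypothesis hlow : exists2 c : R, 0 < c & forall z, (cball `\` E) z ->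
  c * dist_set z E `^ (- q)
    * fine (mu (dball (near_pt z) (3 * dist_set z E))) <= cabs (hq E mu q z).
Implicit Types (z w v u : V) (f : multiindex n -> V -> C) (L : seq (@wop R n)).
Local Notation jnorm := (jnorm E e alpha).
Local Notation mball := (mball mu).
Local Notation T := (taylor e alpha).
Local Notation integrable_family := (@integrable_family R n _ B (E : set B)).

Let mE : measurable (E : set B). Proof. exact: borel_closed. Qed.

Lemma E_nonempty : E !=set0.
Proof.
apply/set0P/eqP => E0; have := hU.1; rewrite E0 measure0 => /eqP.
by rewrite eq_sym onee_eq0.
Qed.

Lemma dist_set_le z zeta : E zeta -> dist_set z E <= dist z zeta.
Proof.
move=> Ez; apply: ge_inf; last by exists zeta.
by exists 0 => _ [w _ <-]; exact: dist_ge0.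
Qed.

(* z lies off E and z0 is its chosen nearest point. *)
Definition far z z0 := [/\ cball z, E z0, 0 < dist z z0, z0 = near_pt z &
  forall zeta, E zeta -> dist z z0 <= dist z zeta].

Lemma far_near z : (cball `\` E) z -> far z (near_pt z).
Proof.
move=> hz; have [Ez0 hd] := hnear hz; case: hz => bz nE.
have d0 : 0 < dist z (near_pt z).
  by apply: dist_gt0_sphere => //; [exact: hES|apply/eqP => zE; apply: nE; rewrite zE].
by split => // zeta Ez; rewrite hd; exact: dist_set_le.
Qed.

Lemma far_Re_away z z0 : far z z0 -> Re_away E z.
Proof.
move=> [bz Ez0 d0 _ hmin]; exists (dist z z0 ^+ 2 / 2); first by rewrite divr_gt0// exprn_gt0.
move=> zeta Ez; apply: le_trans (Re_kern_ge bz (hES Ez)).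
by rewrite ler_pM2r ?invr_gt0// ler_pXn2r ?nnegrE ?dist_ge0// hmin.
Qed.

Lemma cintegral_kernel s : upsilon < s -> exists2 c : R, 0 <= c &
  forall z z0 (F : B -> C) (K : R), far z z0 -> 0 <= K -> cmeas (E : set B) F ->
    bounded_on (E : set B) F ->
    (forall zeta, E zeta -> cabs (F zeta) <= K * dist z zeta `^ (- s)) ->
  cabs (cintegral mu (E : set B) F) <=
    c * K * dist z z0 `^ (- s) * mball z0 (3 * dist z z0).
Proof.
move=> us; have [c c0 hc] := kernel_integral hES mE hU hD us.
exists (2 * c); first exact: mulr_ge0.
move=> z z0 F K [bz Ez0 d0 _ hmin] K0 mF bF hF.
have [h [ih hh] hi] := hc z z0 bz Ez0 d0 hmin.
have ihK : mu.-integrable (E : set B) (EFin \o (fun t : B => K * h t)).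
  by have := integrableZl mE K ih; apply: eq_integrable.
apply: le_trans (cabs_cintegral_le mE mF bF ihK _) _.
  by move=> zeta Ez; apply: le_trans (hF _ Ez) _; rewrite ler_wpM2l// hh.
rewrite RintegralZl//.
apply: (@le_trans _ _ (2 * (K * (c * dist z z0 `^ (- s) * mball z0 (3 * dist z z0))))).
  by rewrite ler_pM2l// ler_wpM2l.
by rewrite le_eqVlt; apply/orP; left; apply/eqP; ring.
Qed.

(** Operators differentiate with z0 = p.2 frozen; that z0 is the chosen nearest point is required
    only at the point z where the derivatives are evaluated. *)
Definition edom (p : (multiindex n -> V -> C) * V) z := A_jet e alpha p.1 E /\ far z p.2.
Local Notation gauge := (fun p z => dist z p.2).

Lemma edom_cball p z : edom p z -> cball z. Proof. by move=> [_ []]. Qed.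
Lemma edom_gt0 p z : edom p z -> 0 < dist z p.2. Proof. by move=> [_ []]. Qed.
Lemma edom_le2 p z : edom p z -> dist z p.2 <= 2.
Proof. by move=> [_ [bz /hES sz _ _ _]]; rewrite dist_le2//; exact: sphere_cball. Qed.

Definition wkernel (zeta : B) w : C := cpow (kern zeta w) (- q).

Lemma integrable_wkernel z z0 : far z z0 -> integrable_family z wkernel.
Proof. by move=> /far_Re_away h; exact: integrable_family_kern_cpow. Qed.

(** A derivative of weight omega turns the kernel into O(d(z, zeta)^(-q - omega)), to which
    [cintegral_kernel] applies as q + omega > upsilon; the mass of B_z becomes the prefactor. *)
Lemma order_hq : order edom gauge (fun p z => mball p.2 (3 * dist z p.2)) (- q)
  (fun _ => hq E mu q).
Proof.
move=> k; split=> [[f z0] z [_ hz]|L _]; first exact/integral_smooth_at/(integrable_wkernel hz).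
have us : upsilon < q + wts L by have := wts_ge0 L; move: alpha_gt0 hq_gt; lra.
have [c c0 hc] := cintegral_kernel us.
pose dom (zeta : V) z := [/\ cball z, E zeta & 0 < dist z zeta].
have h1 zeta z : dom zeta z -> cball z by case.
have h2 zeta z : dom zeta z -> sphere zeta by case=> _ /hES.
have h3 zeta z : dom zeta z -> 0 < dist z zeta by case.
have [d d0 hd] := order_bound L (order_kern_cpow h1 h2 h3 (- q)).
exists (c * d); first exact: mulr_ge0.
move=> [f z0] z [_ /= hz]; have [bz Ez0 d1 _ hmin] := hz.
have hi := integrable_wkernel hz.
rewrite (integral_wapplys _ mE L bz hi).
have hL := integrable_family_wapplys L bz hi.
rewrite -opprD (mulrAC (c * d)).
apply: hc => //; [exact: integrable_family_cmeas hL|exact: integrable_family_bounded hL|].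
move=> zeta Ez; have := hd zeta z; rewrite mulr1 opprD; apply; split => //.
exact: lt_le_trans d1 (hmin _ Ez).
Qed.

Lemma mball_edom p z : edom p z -> 0 < mball p.2 (3 * dist z p.2).
Proof. by move=> [_ [_ Ez0 d0 _ _]]; apply: (mball_gt0 hES mE hU hD) => //; rewrite mulr_gt0. Qed.

Lemma hq_low : exists2 c : R, 0 < c & forall z z0, far z z0 ->
  c * mball z0 (3 * dist z z0) * dist z z0 `^ (- q) <= cabs (hq E mu q z).
Proof.
have [c c0 hc] := hlow; exists c => // z z0 [bz Ez0 d0 hz0 hmin].
have hz : (cball `\` E) z.
  split => // Ez; have := hmin z Ez.
  rewrite leNgt => /negP; apply; apply: le_lt_trans d0.
  by rewrite /dist hdotzz (hES Ez) expr1n mkC10 subrr cabs0.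
have [_ hd] := hnear hz; have := hc z hz.
by rewrite -hd -hz0 mulrAC.
Qed.

Lemma order_hqV : order edom gauge (fun p z => (mball p.2 (3 * dist z p.2))^-1) q
  (fun _ w => (hq E mu q w)^-1).
Proof.
move=> k; rewrite -[q in order_upto _ _ _ _ q]opprK.
apply: (order_uptoV edom_cball edom_gt0 edom_le2 mball_edom _ (order_hq k)).
have [c c0 hc] := hq_low; exists c => // p z [_ hz]; exact: hc.
Qed.

Lemma hq_neq0 z z0 : far z z0 -> hq E mu q z != 0.
Proof.
move=> hz; have [c c0 hc] := hq_low; rewrite -cabs_gt0; apply: lt_le_trans (hc _ _ hz).
case: hz => [bz Ez0 d0 _ _]; rewrite !mulr_gt0 ?powR_gt0//.
by apply: (mball_gt0 hES mE hU hD) => //; rewrite mulr_gt0.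
Qed.

Definition remainder f z0 w : C :=
  cintegral mu (E : set B) (fun zeta => (T f zeta w - T f z0 w) * wkernel zeta w).

Lemma smooth_at_taylor f z0 z : A_jet e alpha f E -> E z0 -> smooth_at z (T f z0).
Proof.
move=> hf Ez0; have [h _] := integrable_family_taylor hES he E_nonempty z hf.
exact: smooth_at_of_family Ez0 h.
Qed.

Lemma integrable_diff f z0 z : A_jet e alpha f E -> E z0 ->
  integrable_family z (fun zeta w => T f zeta w - T f z0 w).
Proof.
move=> hf Ez0; have h := integrable_family_taylor hES he E_nonempty z hf.
have h2 : smooth_at z (fun w => - T f z0 w).
  apply: smooth_at_eq (smooth_atM (smooth_at_cst z (-1)) (smooth_at_taylor z hf Ez0)).
  by apply: filterE => w; rewrite mulN1r.
exact: (integrable_familyD h (integrable_family_const _ h2)).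
Qed.

Lemma integrable_remainder f z z0 : A_jet e alpha f E -> far z z0 ->
  integrable_family z (fun zeta w => (T f zeta w - T f z0 w) * wkernel zeta w).
Proof.
move=> hf hz; have [_ Ez0 _ _ _] := hz.
exact: integrable_familyM (integrable_diff _ hf Ez0) (integrable_wkernel hz).
Qed.

Lemma jet_dom_far f z z0 zeta : A_jet e alpha f E -> far z z0 -> E zeta ->
  jet_dom E e alpha (f, (z0, zeta)) z.
Proof. by move=> hf [bz Ez0 d0 _ hmin] Ez; split => //=; exact: hmin. Qed.

(** The integrand has order alpha - q in the gauge d(z, zeta), and q - alpha > upsilon lets
    [cintegral_kernel] apply to all its derivatives. Integration replaces this gauge by d(z, z0). *)
Lemma order_remainder : order edom gauge
  (fun p z => jnorm p.1 * mball p.2 (3 * dist z p.2)) (alpha - q)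
  (fun p => remainder p.1 p.2).
Proof.
move=> k; split=> [[f z0] z [hf hz]|L _]; first exact/integral_smooth_at/(integrable_remainder hf hz).
have us : upsilon < q - alpha + wts L by have := wts_ge0 L; move: hq_gt; lra.
have [c c0 hc] := cintegral_kernel us.
have h1 := @jet_dom_cball R n E e alpha.
have h2 := jet_dom_sphere (e := e) (alpha := alpha) hES.
have h3 := @jet_dom_gt0 R n E e alpha.
have h4 := jet_dom_le2 (e := e) (alpha := alpha) hES.
have [d d0 hd] : exists2 d : R, 0 <= d & forall p z, jet_dom E e alpha p z ->
    cabs (wapplys L (fun w => (T p.1 p.2.2 w - T p.1 p.2.1 w) * wkernel p.2.2 w) z) <=
    d * jnorm p.1 * dist z p.2.2 `^ (alpha - q - wts L).
  have N0 p z : jet_dom E e alpha p z -> 0 <= jnorm p.1.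
    by move=> _; exact: jnorm_ge0 E_nonempty _.
  have hT := order_taylor_diff alpha hES he E_nonempty (size L).
  have hK := order_kern_cpow h1 h2 h3 (- q) (size L).
  have [_ /(_ L (leqnn _))[d d0 hd]] := order_uptoM h1 h3 N0 (fun _ _ _ => ler01) hT hK.
  by exists d => // p z /hd; rewrite mulr1.
exists (c * d); first exact: mulr_ge0.
move=> [f z0] z [/= hf hz]; have [bz Ez0 d1 _ hmin] := hz.
have hi := integrable_remainder hf hz.
rewrite (integral_wapplys _ mE L bz hi).
have hL := integrable_family_wapplys L bz hi.
have N0 : 0 <= jnorm f by exact: jnorm_ge0 E_nonempty _.
have -> : alpha - q - wts L = - (q - alpha + wts L) by ring.
have -> : c * d * (jnorm f * mball z0 (3 * dist z z0)) * dist z z0 `^ (- (q - alpha + wts L)) =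
  c * (d * jnorm f) * dist z z0 `^ (- (q - alpha + wts L)) * mball z0 (3 * dist z z0) by ring.
apply: hc => //; [exact: mulr_ge0|exact: integrable_family_cmeas hL|exact: integrable_family_bounded hL|].
move=> zeta Ez; have -> : - (q - alpha + wts L) = alpha - q - wts L by ring.
exact: hd (jet_dom_far hf hz Ez).
Qed.

(** The mass of B_z in the remainder cancels against its inverse from 1 / h_q, and q + (alpha - q) =
    alpha. *)
Lemma order_quotient : order edom gauge (fun p _ => jnorm p.1) alpha
  (fun p w => (hq E mu q w)^-1 * remainder p.1 p.2 w).
Proof.
have N0 p z : edom p z -> 0 <= jnorm p.1 by move=> _; exact: jnorm_ge0 E_nonempty _.
have m0 p z : edom p z -> 0 <= (mball p.2 (3 * dist z p.2))^-1.
  by move=> /mball_edom /ltW; rewrite invr_ge0.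
have r0 p z : edom p z -> 0 <= jnorm p.1 * mball p.2 (3 * dist z p.2).
  by move=> hp; rewrite mulr_ge0 ?(N0 p z)// ltW// mball_edom.
move=> k; have := order_uptoM edom_cball edom_gt0 m0 r0 (order_hqV k) (order_remainder k).
apply: (order_upto_weaken edom_gt0 edom_le2).
- by rewrite addrCA subrr addr0.
- by move=> p z hp; rewrite mulr_ge0 ?m0 ?r0.
- exists 1 => // p z hp; rewrite mul1r mulrCA mulVf ?mulr1//.
  by rewrite gt_eqF// mball_edom.
Qed.

Lemma kern_neq0 z zeta : Re_away E z -> E zeta -> kern zeta z != 0.
Proof.
move=> h Ez; rewrite -cabs_gt0; apply: lt_le_trans (cRe_normle _).
exact: Re_away_gt0 h Ez.
Qed.

Lemma wkernelE (F : C) z zeta : Re_away E z -> E zeta ->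
  F / cpow (1 - hdot z zeta) q = F * wkernel zeta z.
Proof. by move=> h Ez; rewrite /wkernel cpowN// kern_neq0. Qed.

Lemma extension_split f z0 z : A_jet e alpha f E -> E z0 -> Re_away E z -> hq E mu q z != 0 ->
  extension E mu q e alpha f z = T f z0 z + (hq E mu q z)^-1 * remainder f z0 z.
Proof.
move=> hf Ez0 hz h0; rewrite /extension /average.
have iK := integrable_family_kern_cpow hES (- q) hz.
have iT := integrable_familyM (integrable_diff z hf Ez0) iK.
have -> : cintegral mu (E : set B) (fun zeta => T f zeta z / cpow (1 - hdot z zeta) q) =
  cintegral mu (E : set B) (fun zeta => T f z0 z * wkernel zeta z +
     (T f zeta z - T f z0 z) * wkernel zeta z).
  by apply: eq_cintegral => zeta Ez; rewrite wkernelE//; ring.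
rewrite cintegralD//.
- rewrite cintegralZ//; first by rewrite mulrDr mulrCA mulVf// mulr1.
    exact: integrable_family_cmeas iK.
  exact: integrable_family_bounded iK.
- by apply: cmeasM; [exact: cmeas_cst|exact: integrable_family_cmeas iK].
- by apply: bounded_onZ; exact: integrable_family_bounded iK.
- exact: integrable_family_cmeas iT.
- exact: integrable_family_bounded iT.
Qed.

Lemma smooth_at_hq z : Re_away E z -> smooth_at z (hq E mu q).
Proof. by move=> hz; apply: integral_smooth_at => //; exact: integrable_family_kern_cpow. Qed.

(** Near z, h_q stays nonzero and K stays in the right half-plane, so the splitting with z0 fixed
    holds on a neighbourhood and may be differentiated. *)
Lemma extension_near f z z0 : A_jet e alpha f E -> far z z0 -> \forall w \near z,
  extension E mu q e alpha f w = T f z0 w + (hq E mu q w)^-1 * remainder f z0 w.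
Proof.
move=> hf hz; have hR := far_Re_away hz; have [_ Ez0 _ _ _] := hz.
have hn : \forall w \near z, hq E mu q w != 0.
  have /loc_away_near := @loc_away_continuous _ _ unit setT z _
    (continuous_cabs (smooth_at_continuous (smooth_at_hq hR)))
    (ltac:(by rewrite cabs_gt0; exact: hq_neq0 hz)).
  apply: filterS => w [c c0 /nbhs_singleton /(_ tt I)]; rewrite -cabs_gt0.
  exact: lt_le_trans.
by apply: filterS2 hn (Re_away_near hES hR) => w h0 hw; exact: extension_split.
Qed.

Lemma smooth_at_quotient f z z0 : A_jet e alpha f E -> far z z0 ->
  smooth_at z (fun w => (hq E mu q w)^-1 * remainder f z0 w).
Proof. by move=> hf hz; exact: (@order_smooth _ _ _ _ _ _ _ _ (f, z0) _ order_quotient). Qed.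

Lemma smooth_at_extension f z : A_jet e alpha f E -> (cball `\` E) z ->
  smooth_at z (extension E mu q e alpha f).
Proof.
move=> hf /far_near hz; have [_ Ez0 _ _ _] := hz.
apply: smooth_at_eq (smooth_atD (smooth_at_taylor z hf Ez0) (smooth_at_quotient hf hz)).
by apply: filterS (extension_near hf hz) => w ->.
Qed.

Lemma wapplys_extension L f z : A_jet e alpha f E -> (cball `\` E) z ->
  wapplys L (extension E mu q e alpha f) z = wapplys L (T f (near_pt z)) z +
    wapplys L (fun w => (hq E mu q w)^-1 * remainder f (near_pt z) w) z.
Proof.
move=> hf /far_near hz; have [bz Ez0 _ _ _] := hz.
rewrite (wapplys_near_eq L (extension_near hf hz)) wapplysD//.
  exact: smooth_at_taylor.
exact: smooth_at_quotient.
Qed.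

Lemma wapplys_quotient_le L : exists2 c : R, 0 <= c & forall f z, A_jet e alpha f E ->
  (cball `\` E) z ->
  cabs (wapplys L (fun w => (hq E mu q w)^-1 * remainder f (near_pt z) w) z) <=
    c * jnorm f * dist_set z E `^ (alpha - wts L).
Proof.
have [c c0 hc] := order_bound L order_quotient; exists c => // f z hf hz.
have := hc (f, near_pt z) z; rewrite /= (hnear hz).2; apply; split => //.
exact: far_near.
Qed.

Lemma dist_set_bounds z : (cball `\` E) z -> 0 < dist_set z E <= 2.
Proof.
move=> hz; have [_ hd] := hnear hz; have [bz /hES sz d0 _ _] := far_near hz.
by rewrite -hd d0 dist_le2//; exact: sphere_cball.
Qed.

(** The derivatives of T_{z0} f are bounded, and they are absorbed because d(z, E) <= 2 has a
    nonpositive exponent. *)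
Lemma extension_high L : alpha <= wts L -> exists2 c : R, 0 <= c & forall f z,
  A_jet e alpha f E -> (cball `\` E) z ->
  cabs (wapplys L (extension E mu q e alpha f) z) <=
    c * jnorm f * dist_set z E `^ (alpha - wts L).
Proof.
move=> aL; have [c c0 hc] := wapplys_quotient_le L.
have [d d0 hd] := taylor_bounded alpha hES he E_nonempty L.
exists (d * 2 `^ (wts L - alpha) + c); first by rewrite addr_ge0// mulr_ge0 ?powR_ge0.
move=> f z hf hz; rewrite wapplys_extension//; apply: le_trans (ler_cabsD _ _) _.
rewrite mulrDl [leRHS]mulrDl lerD ?hc//; have [Ez0 _] := hnear hz.
apply: le_trans (hd _ _ _ hf Ez0 hz.1) _.
have N0 : 0 <= jnorm f by exact: jnorm_ge0 E_nonempty _.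
rewrite (mulrAC d) -[leRHS]mulrA ler_peMr ?(mulr_ge0 d0)//.
have /andP[p0 p2] := dist_set_bounds hz.
rewrite -[alpha - _]opprB powRN ler_pdivlMr ?powR_gt0// mul1r.
by apply: ge0_ler_powR; rewrite ?nnegrE ?subr_ge0// ltW.
Qed.

(** Below weight alpha the exponent of d(z, E) is positive and both terms are bounded; this is the
    boundedness of lower derivatives in [lipschitz_ball]. *)
Lemma extension_low L : wts L < alpha -> exists2 c : R, 0 <= c & forall f z,
  A_jet e alpha f E -> (cball `\` E) z ->
  cabs (wapplys L (extension E mu q e alpha f) z) <= c * jnorm f.
Proof.
move=> aL; have [c c0 hc] := wapplys_quotient_le L.
have [d d0 hd] := taylor_bounded alpha hES he E_nonempty L.
exists (d + c * 2 `^ (alpha - wts L)); first by rewrite addr_ge0// mulr_ge0 ?powR_ge0.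
move=> f z hf hz; rewrite wapplys_extension//; apply: le_trans (ler_cabsD _ _) _.
have [Ez0 _] := hnear hz; rewrite mulrDl lerD ?(hd _ _ _ hf Ez0 hz.1)//.
apply: le_trans (hc f z hf hz) _; rewrite mulrAC ler_wpM2r ?jnorm_ge0//; first exact: E_nonempty.
rewrite ler_wpM2l//; have /andP[p0 p2] := dist_set_bounds hz.
by apply: ge0_ler_powR; rewrite ?nnegrE ?subr_ge0// ltW.
Qed.

Lemma extension_op_split (XX : seq (vfield R n)) f z : A_jet e alpha f E -> (cball `\` E) z ->
  extension_op E mu q e alpha f XX z = opapply XX (T f (near_pt z)) z +
    (hq E mu q z)^-1 * cintegral mu (E : set B) (fun zeta =>
      wapplys (map (@vfield_wop R n) XX) (fun w => T f zeta w - T f (near_pt z) w) z * wkernel zeta z).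
Proof.
move=> hf /far_near hz; have [bz Ez0 _ _ _] := hz; have hR := far_Re_away hz.
rewrite opapplyE /extension_op /average; set L := map _ XX; set z0 := near_pt z.
have iK := integrable_wkernel hz.
have iD := integrable_family_wapplys L bz (integrable_diff z hf Ez0).
have iT := integrable_familyM iD iK.
have -> : cintegral mu (E : set B) (fun zeta => opapply XX (T f zeta) z / cpow (1 - hdot z zeta) q) =
  cintegral mu (E : set B) (fun zeta => wapplys L (T f z0) z * wkernel zeta z +
     wapplys L (fun w => T f zeta w - T f z0 w) z * wkernel zeta z).
  apply: eq_cintegral => zeta Ez; rewrite wkernelE// opapplyE -mulrDl -wapplysD//.
  - by congr (wapplys _ _ _ * _); apply/funext => w; rewrite addrC subrK.
  - exact: smooth_at_taylor.
  - have [h _] := integrable_diff z hf Ez0; exact: (smooth_at_of_family Ez h).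
rewrite cintegralD//.
- rewrite cintegralZ//; first by rewrite mulrDr mulrCA mulVf ?mulr1// (hq_neq0 hz).
    exact: integrable_family_cmeas iK.
  exact: integrable_family_bounded iK.
- by apply: cmeasM; [exact: cmeas_cst|exact: integrable_family_cmeas iK].
- by apply: bounded_onZ; exact: integrable_family_bounded iK.
- exact: integrable_family_cmeas iT.
- exact: integrable_family_bounded iT.
Qed.

(** The operator acts on the Taylor polynomials only and costs d(z, zeta)^(-omega) there, while the
    kernel stays undifferentiated. Since the kernel average of a constant is that constant,
    subtracting X T_{z0} f leaves an integral of differences. *)
Lemma extension_op_le (XX : seq (vfield R n)) : opweight XX < alpha -> exists2 c : R, 0 <= c &
  forall f z, A_jet e alpha f E -> (cball `\` E) z ->
  cabs (extension_op E mu q e alpha f XX z - opapply XX (T f (near_pt z)) z) <=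
    c * jnorm f * dist_set z E `^ (alpha - opweight XX).
Proof.
rewrite opweightE => aL; have us : upsilon < q - alpha + wts (map (@vfield_wop R n) XX).
  by have := wts_ge0 (map (@vfield_wop R n) XX); move: hq_gt; lra.
set L := map _ XX in aL us *; have [c c0 hc] := cintegral_kernel us.
have [d d0 hd] := order_bound L (order_taylor_diff alpha hES he E_nonempty).
have [b b0 hb] := order_bound [::] order_hqV.
exists (b * (c * d)); first by rewrite !mulr_ge0.
move=> f z hf hz; rewrite extension_op_split// addrAC subrr add0r cabsM.
have hfar := far_near hz; have [bz Ez0 d1 _ hmin] := hfar.
set z0 := near_pt z in Ez0 d1 hmin hfar *; rewrite -(hnear hz).2 -/z0.
have N0 : 0 <= jnorm f by exact: jnorm_ge0 E_nonempty _.
have iT := integrable_familyM (integrable_family_wapplys L bz (integrable_diff z hf Ez0))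
  (integrable_wkernel hfar).
have h1 := hc z z0 _ (d * jnorm f) hfar (mulr_ge0 d0 N0) (integrable_family_cmeas iT)
  (integrable_family_bounded iT).
have h2 : cabs (hq E mu q z)^-1 <= b * (mball z0 (3 * dist z z0))^-1 * dist z z0 `^ q.
  by have := hb (f, z0) z (conj hf hfar); rewrite /wts big_nil subr0.
have h3 zeta : E zeta -> cabs (wapplys L (fun w => T f zeta w - T f z0 w) z * wkernel zeta z) <=
    d * jnorm f * dist z zeta `^ (- (q - alpha + wts L)).
  move=> Ez; rewrite cabsM cabs_cpow cabs_kern.
  have p0 : 0 < dist z zeta by exact: lt_le_trans d1 (hmin _ Ez).
  have -> : - (q - alpha + wts L) = (alpha - wts L) + - q by ring.
  rewrite (powRDp _ _ p0) mulrA; apply: (ler_wpM2r (powR_ge0 _ _)).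
  exact: hd (jet_dom_far hf hfar Ez).
have h4 := ler_pM (cabs_ge0 _) (cabs_ge0 _) h2 (h1 h3).
apply: le_trans h4 _.
have m0 : 0 < mball z0 (3 * dist z z0) := @mball_edom (f, z0) z (conj hf hfar).
have -> : alpha - wts L = q + - (q - alpha + wts L) by ring.
rewrite (powRDp _ _ d1); move: (dist z z0 `^ q) (dist z z0 `^ - _) (mball z0 _) m0 => x y m m0.
rewrite le_eqVlt; apply/orP; left; apply/eqP; field; exact: lt0r_neq0.
Qed.

End ExtensionEstimates.

(** * Holomorphy and the Lipschitz condition *)

Section Holomorphic.
Context {R : realType} {n : nat}.
Local Notation C := (Cplx R).
Local Notation V := (Cn R n).
Implicit Types (z w v u : V) (F G : V -> C).

Lemma smooth_at_rgrad F z v : smooth_at z F -> is_rderive F v z (rgrad F v z).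
Proof.
move=> h; apply: is_rderive_rgrad => u.
  by apply: filterS (smooth_at_near h) => y /(smooth_at_is_rderive u)/is_rderiveP[].
exact: smooth_at_continuous (smooth_family_rderive u h).
Qed.

(** Smoothness with the Cauchy-Riemann equations, written as complex linearity of the real
    differential. *)
Definition holo_at F z := smooth_at z F /\
  forall v, rderive ('i *: v) F z = 'i * rderive v F z.

Lemma holo_at_cst (c : C) z : holo_at (fun _ => c) z.
Proof.
split=> [|v]; first exact: smooth_at_cst.
by rewrite !(is_rderive_val (is_rderive_cst _ _ _)) mulr0.
Qed.
Lemma holo_atD F G z : holo_at F z -> holo_at G z -> holo_at (fun w => F w + G w) z.
Proof.
move=> [hF cF] [hG cG]; split=> [|v]; first exact: smooth_atD.
rewrite !(is_rderive_val (is_rderiveD (smooth_at_is_rderive _ hF) (smooth_at_is_rderive _ hG))).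
by rewrite cF cG mulrDr.
Qed.
Lemma holo_atM F G z : holo_at F z -> holo_at G z -> holo_at (fun w => F w * G w) z.
Proof.
move=> [hF cF] [hG cG]; split=> [|v]; first exact: smooth_atM.
rewrite !(is_rderive_val (is_rderiveM (smooth_at_is_rderive _ hF) (smooth_at_is_rderive _ hG))).
by rewrite cF cG; ring.
Qed.
Lemma holo_atV F z : F z != 0 -> holo_at F z -> holo_at (fun w => (F w)^-1) z.
Proof.
move=> F0 [hF cF]; split=> [|v]; first exact: smooth_atV.
rewrite !(is_rderive_val (is_rderiveV F0 (smooth_at_is_rderive _ hF))).
by rewrite cF; ring.
Qed.
Lemma holo_at_cpow F z (s : R) : loc_away setT (fun (_ : unit) w => cRe (F w)) z ->
  0 < cRe (F z) -> holo_at F z -> holo_at (fun w => cpow (F w) s) z.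
Proof.
move=> hz F0 [hF cF]; split=> [|v]; first exact: smooth_family_cpow hz hF.
rewrite !(is_rderive_val (is_rderive_cpow s F0 (smooth_at_is_rderive _ hF))).
by rewrite cF; ring.
Qed.
Lemma holo_at_hdot u z : holo_at (hdot^~ u) z.
Proof.
split=> [|v]; first exact: (@smooth_family_hdot _ _ unit setT z (fun _ => u) (enorm u)).
by rewrite !(is_rderive_val (is_rderive_hdot _ _ _)) hdotZl.
Qed.
Lemma holo_at_eq F G z : (\forall w \near z, F w = G w) -> holo_at F z -> holo_at G z.
Proof.
move=> h [hF cF]; split=> [|v]; first exact: smooth_at_eq h hF.
by rewrite -!(rderive_near_eq _ h) cF.
Qed.
Lemma holo_at_sum (I : Type) (s : seq I) (F : I -> V -> C) z :
  (forall i, holo_at (F i) z) -> holo_at (fun w => \sum_(i <- s) F i w) z.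
Proof.
move=> h; elim: s => [|i s IH].
  by apply: holo_at_eq (holo_at_cst 0 z); apply: filterE => w; rewrite big_nil.
by apply: holo_at_eq (holo_atD (h i) IH); apply: filterE => w; rewrite big_cons.
Qed.
Lemma holo_at_prod (I : Type) (s : seq I) (F : I -> V -> C) z :
  (forall i, holo_at (F i) z) -> holo_at (fun w => \prod_(i <- s) F i w) z.
Proof.
move=> h; elim: s => [|i s IH].
  by apply: holo_at_eq (holo_at_cst 1 z); apply: filterE => w; rewrite big_nil.
by apply: holo_at_eq (holo_atM (h i) IH); apply: filterE => w; rewrite big_cons.
Qed.
Lemma holo_at_exp F z k : holo_at F z -> holo_at (fun w => F w ^+ k) z.
Proof.
move=> h; elim: k => [|k IH].
  by apply: holo_at_eq (holo_at_cst 1 z); apply: filterE => w; rewrite expr0.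
by apply: holo_at_eq (holo_atM h IH); apply: filterE => w; rewrite exprS.
Qed.

Lemma holo_at_integral (mu : probability (borelCn R n) R) (E : set (borelCn R n))
    (G : borelCn R n -> V -> C) z : measurable E ->
  integrable_family E z G -> (forall zeta, E zeta -> holo_at (G zeta) z) ->
  holo_at (fun w => cintegral mu E (fun zeta => G zeta w)) z.
Proof.
move=> mE iG hG; split=> [|v]; first exact: integral_smooth_at.
rewrite !integral_rderive//.
have iv := integrable_family_rderive v iG.
rewrite -(cintegralZ mu mE _ (integrable_family_cmeas iv) (integrable_family_bounded iv)).
by apply: eq_cintegral => zeta /hG[_ ->].
Qed.

(** The norm of [V] is complex valued and a maximum over coordinates. The factor 2 provides the
    strict inequality needed for membership in a ball, and n+1 comes from [enorm_le_coord]. *)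
Lemma enorm_le_norm v : mkC (enorm v) 0 <= mkC (2 * n.+1%:R) 0 * `|v|.
Proof.
have [->|v0] := eqVneq v 0; first by rewrite enorm0 normr0 mulr0.
have /gtC0P[r r0 hr] : 0 < `|v| by rewrite normr_gt0.
have hb : ball (0 : V) (mkC (2 * r) 0) v.
  rewrite -ball_normE /= sub0r normrN hr ltC_mkC; move: r0; lra.
have h j : cabs (v 0 j) < 2 * r.
  move: hb => [_ /(_ 0 j)]; rewrite -ball_normE /= mxE sub0r normrN normCE ltC_mkC.
  exact.
rewrite hr mkC0M leC_mkC; apply: le_trans (enorm_le_coord h) _.
by rewrite le_eqVlt; apply/orP; left; apply/eqP; ring.
Qed.

Lemma holo_at_rgrad F z v : holo_at F z ->
  rgrad F v z = \sum_(j < n.+1) v 0 j * rderive (ebase j) F z.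
Proof.
move=> [_ cF]; apply: eq_bigr => j _; rewrite cF mulrA -mulrDl; congr (_ * _).
by apply: cext; rewrite !cE; ring.
Qed.

(** On a short segment the partial derivatives are close to those at z; d' absorbs the factor 2 of
    [segment_bound] and the n+1 coordinates. *)
Lemma holo_at_first_order F z : (\forall w \near z, holo_at F w) ->
  forall d : R, 0 < d -> exists2 r : R, 0 < r & forall v, enorm v < r ->
    cabs (F (z + v) - F z - \sum_(j < n.+1) v 0 j * rderive (ebase j) F z) <= d * enorm v.
Proof.
move=> hF d d0; pose d' := d / (2 * n.+1%:R).
have n0 : 0 < 2 * n.+1%:R :> R by rewrite mulr_gt0.
have d'0 : 0 < d' by rewrite divr_gt0.
have hz := nbhs_singleton hF.
have hc (j : 'I_n.+1) : \forall w \near z,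
    cabs (rderive (ebase j) F w - rderive (ebase j) F z) < d'.
  apply/nbhs_enormP.
  have /continuousVP := smooth_at_continuous (smooth_family_rderive (ebase j) hz.1).
  exact.
have [r r0 hr] := (nbhs_enormP z _).1
  (@filterI _ (nbhs z) (nbhs_filter z) _ _ hF (filter_forall (nbhs_filter z) hc)).
exists r => // v hv; have hs (s : R) : 0 <= s <= 1 -> enorm (z + mkC s 0 *: v - z) < r.
  move=> /andP[s0 s1]; rewrite addrAC subrr add0r enormZ cabs_mkC ger0_norm//.
  by apply: le_lt_trans hv; rewrite ler_piMl ?enorm_ge0.
apply: (@le_trans _ _ (2 * (n.+1%:R * d' * enorm v))).
  apply: (@segment_bound _ _ F v z (fun s => rgrad F v (z + mkC s 0 *: v))).
    by move=> s /hs/hr[[h _] _]; exact: smooth_at_rgrad.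
  move=> s /hs/hr[h hj]; rewrite holo_at_rgrad// -sumrB.
  apply: le_trans (ler_cabs_sum _ _ _) _.
  apply: (@le_trans _ _ (\sum_(j < n.+1) d' * enorm v)).
    apply: ler_sum => j _; rewrite -mulrBr cabsM mulrC.
    by apply: ler_pM; rewrite ?cabs_ge0 ?cabs_coord_le// ltW.
  by rewrite sumr_const card_ord -[leLHS]mulr_natl mulrA.
have -> : 2 * (n.+1%:R * d' * enorm v) = d' * (2 * n.+1%:R) * enorm v by ring.
by rewrite /d' divfK// gt_eqF.
Qed.

Lemma holo_at_differentiable F z : (\forall w \near z, holo_at F w) -> differentiable F z.
Proof.
(* The entries are conjugated so that [hdot^~ u] is the differential; its linearity and continuity
   are then already available. *)
move=> hF; pose u : V := \row_j (rderive (ebase j) F z)^*.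
have uE v : hdot v u = \sum_(j < n.+1) v 0 j * rderive (ebase j) F z.
  by apply: eq_bigr => j _; rewrite mxE conjCK.
pose df : V -> C := hdot^~ u.
have dfL : linear df by move=> c v w; rewrite /df hdotDl hdotZl.
pose dfl : {linear V -> C} := HB.pack df (GRing.isLinear.Build C V C _ df dfL).
have cf : continuous dfl by move=> v; exact: continuous_hdot.
have hd : F \o shift z = cst (F z) + dfl +o_ (0 : V) id.
  apply/eqaddoP => _ /gtC0P[d d0 ->].
  have n0 : 0 < 2 * n.+1%:R :> R by rewrite mulr_gt0.
  have d'0 : 0 < d / (2 * n.+1%:R) by rewrite divr_gt0.
  have [r r0 hr] := holo_at_first_order hF d'0.
  apply/nbhs_enormP; exists r => // v; rewrite subr0 => hv.
  have := hr v hv; rewrite -uE => h.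
  have -> : (F \o shift z - (cst (F z) + dfl)) v = F (z + v) - F z - hdot v u.
    by rewrite -[LHS]/(F (v + z) - (F z + hdot v u)) opprD addrA (addrC v z).
  rewrite normCE /=; apply: (@le_trans _ _ (mkC (d / (2 * n.+1%:R)) 0 * mkC (enorm v) 0)).
    by rewrite mkC0M leC_mkC.
  apply: le_trans (ler_wpM2l _ (enorm_le_norm v)) _; first by rewrite ltW// mkC_gt0.
  by rewrite mulrA mkC0M divfK// gt_eqF.
by apply/diff_locallyP; rewrite (diff_unique cf hd).
Qed.

End Holomorphic.

(** * The Hardy-Littlewood lemma *)

Section HardyLittlewood.
Context {R : realType} {n : nat}.
Local Notation C := (Cplx R).
Local Notation V := (Cn R n).
Implicit Types (z w v u : V) (F G : V -> C).

Variables (F : V -> C) (K beta : R).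
Hypothesis beta_gt0 : 0 < beta.
Hypothesis beta_le1 : beta <= 1.
Hypothesis hF : forall z, oball z -> smooth_at z F.
Hypothesis hK : forall z v, oball z ->
  cabs (rderive v F z) <= K * enorm v * (1 - enorm z) `^ (beta - 1).

(** At depth at least rho the derivative is at most K |v| rho^(beta - 1), since beta - 1 <= 0, and
    |v| <= L rho. *)
Lemma gradient_segment z v (L rho : R) : 0 <= K -> 0 <= L -> 0 < rho -> enorm v <= L * rho ->
  (forall s : R, 0 <= s <= 1 -> enorm (z + mkC s 0 *: v) <= 1 - rho) ->
  cabs (F (z + v) - F z) <= 2 * K * L * rho `^ beta.
Proof.
move=> K0 L0 r0 hv hs.
have ho (s : R) : 0 <= s <= 1 -> oball (z + mkC s 0 *: v).
  by move=> /hs; rewrite /oball /= => /le_lt_trans; apply; rewrite ltrBlDr ltrDl.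
rewrite -[F (z + v) - F z]subr0 -!mulrA.
apply: (@segment_bound _ _ F v z (fun s => rderive v F (z + mkC s 0 *: v))) => s sI.
  by apply: smooth_at_is_rderive; apply: hF; exact: ho.
rewrite subr0; apply: le_trans (hK v (ho s sI)) _; rewrite -!mulrA; apply: ler_wpM2l => //.
have -> : rho `^ beta = rho * rho `^ (beta - 1).
  by rewrite -{2}[rho](powRr1 (ltW r0)) -powRDp// addrCA subrr addr0.
rewrite mulrA; apply: ler_pM; rewrite ?enorm_ge0 ?powR_ge0//.
have r1 : rho <= 1 - enorm (z + mkC s 0 *: v) by rewrite lerBrDr addrC -lerBrDr hs.
have b1 : 0 <= 1 - beta by rewrite subr_ge0.
have p1 := lt_le_trans r0 r1.
rewrite -[beta - 1]opprB !powRN lef_pV2 ?posrE ?powR_gt0//.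
by apply: (ge0_ler_powR b1) r1; rewrite nnegrE ltW.
Qed.

(** The ratio of the geometric series that sums the increments over the halved segments. *)
Let th : R := 2 `^ (- beta).
Let th0 : 0 <= th. Proof. exact: powR_ge0. Qed.
Let th1 : th < 1.
Proof.
rewrite /th powRN invf_lt1 ?powR_gt0//.
have := @gt0_ltr_powR R beta beta_gt0 1 2; rewrite powR1 !nnegrE; apply; lra.
Qed.

(* A chain of segments from (1 - r) z to z whose lengths are halved at each step
   avoids integrating (1 - |z|)^(beta - 1) up to the boundary. *)
Lemma radial_bound z (r : R) : 0 <= K -> oball z -> 0 < r -> r <= 1 ->
  cabs (F z - F (mkC (1 - r) 0 *: z)) <= 2 * K * r `^ beta / (1 - th).
Proof.
move=> K0 bz r0 r1; have z1 : enorm z <= 1 by exact: ltW.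
pose rho (m : nat) : R := r / 2 ^+ m; pose p m : V := mkC (1 - rho m) 0 *: z.
have rho0 m : 0 < rho m by rewrite divr_gt0// exprn_gt0.
have rhoS m : rho m = 2 * rho m.+1.
  by rewrite /rho exprS invfM; field; exact: lt0r_neq0 (exprn_gt0 _ _).
have rho1 m : rho m <= 1.
  by rewrite /rho ler_pdivrMr ?exprn_gt0// mul1r (le_trans r1)// exprn_ege1// ler1n.
have step m : cabs (F (p m.+1) - F (p m)) <= 2 * K * r `^ beta * th ^+ m.
  have -> : p m.+1 = p m + mkC (rho m.+1) 0 *: z.
    rewrite /p -scalerDl; congr (_ *: _); apply: cext; rewrite !cE ?addr0//.
    by rewrite [rho m]rhoS; ring.
  have h : cabs (F (p m + mkC (rho m.+1) 0 *: z) - F (p m)) <= 2 * K * 1 * rho m.+1 `^ beta.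
    apply: gradient_segment => //.
      by rewrite mul1r enormZ cabs_mkC gtr0_norm// ler_piMr// ltW.
    move=> s /andP[s0 s1].
    have -> : p m + mkC s 0 *: (mkC (rho m.+1) 0 *: z) = mkC (1 - rho m + s * rho m.+1) 0 *: z.
      by rewrite /p scalerA -scalerDl mkC0M; congr (_ *: _); apply: cext; rewrite !cE ?addr0.
    have c1 : 0 <= s * rho m.+1 <= rho m.+1.
      by rewrite mulr_ge0 ?(ltW (rho0 _))//= ler_piMl// ltW.
    have := rho1 m; rewrite enormZ cabs_mkC; move: c1 => /andP[c0 c1]; rewrite [rho m]rhoS => c2.
    rewrite ger0_norm; last by move: c0 c1 c2; lra.
    apply: le_trans (_ : _ <= 1 - 2 * rho m.+1 + s * rho m.+1) _; last by lra.
    by rewrite ler_piMr//; move: c0 c1 c2; lra.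
  apply: le_trans h _; rewrite mulr1 -[leRHS]mulrA ler_wpM2l ?mulr_ge0//.
  have rm : rho m.+1 <= rho m by rewrite [rho m]rhoS; have := rho0 m.+1; lra.
  apply: (@le_trans _ _ (rho m `^ beta)).
    by apply: ge0_ler_powR; rewrite ?nnegrE ?(ltW beta_gt0) ?(ltW (rho0 _)).
  have e1 : th ^+ m = (2 ^+ m)^-1 `^ beta.
    by rewrite -(powR_mulrn m th0) -powRrM -(powR_mulrn m (ler0n R 2)) -powRN -powRrM; congr (_ `^ _); ring.
  by rewrite e1 -powRM// ?invr_ge0 ?exprn_ge0// ltW.
have chain m : cabs (F (p m) - F (p 0%N)) <= 2 * K * r `^ beta / (1 - th).
  have h : cabs (F (p m) - F (p 0%N)) <= \sum_(i < m) 2 * K * r `^ beta * th ^+ i.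
    elim: m => [|m IH]; first by rewrite big_ord0 subrr cabs0.
    rewrite big_ord_recr /=; have := ler_cabsD (F (p m) - F (p 0%N)) (F (p m.+1) - F (p m)).
    rewrite [in X in X -> _](_ : F (p m) - F (p 0%N) + (F (p m.+1) - F (p m)) = F (p m.+1) - F (p 0%N)).
      by move=> /le_trans; apply; rewrite lerD.
    by ring.
  apply: le_trans h _; rewrite -mulr_sumr; apply: ler_wpM2l.
    by rewrite !mulr_ge0 ?powR_ge0.
  have t0 : 0 < 1 - th by rewrite subr_gt0.
  rewrite -div1r ler_pdivlMr// mulrC -opprB mulNr -subrX1 opprB.
  by rewrite lerBlDr lerDl exprn_ge0.
have p00 : p 0%N = mkC (1 - r) 0 *: z by rewrite /p /rho expr0 divr1.
(* The chain only tends to z; continuity of F at z closes the gap up to an arbitrary d. *)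
apply/ler_addgt0Pr => d d0.
have /continuousVP/(_ d d0)[l l0 hl] := smooth_at_continuous (hF bz).
have [m hm] : exists m, rho m < l.
  exists (Num.truncn (r / l)).+1; rewrite /rho ltr_pdivrMr ?exprn_gt0// mulrC -ltr_pdivrMr//.
  apply: lt_trans (truncnS_gt _) _.
  by rewrite -natrX ltr_nat ltn_expl.
have hpz : enorm (p m - z) < l.
  have -> : p m - z = mkC (- rho m) 0 *: z.
    rewrite -[in X in _ - X](scale1r z) /p -scalerBl; congr (_ *: _).
    by apply: cext; rewrite !cE; ring.
  rewrite enormZ cabs_mkC normrN gtr0_norm//; apply: le_lt_trans hm.
  by rewrite ler_piMr// ltW.
have -> : F z - F (mkC (1 - r) 0 *: z) = (F (p m) - F (p 0%N)) - (F (p m) - F z).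
  by rewrite p00; ring.
apply: le_trans (ler_cabsD _ _) _; rewrite cabsN lerD ?chain//.
by apply: ltW; exact: hl.
Qed.

(** With r = |z - w| / 2 <= 1, both points are moved radially to (1 - r) z and (1 - r) w, which are
    joined by a segment at depth at least r and of length at most 2 r. *)
Lemma hardy_littlewood : 0 <= K -> exists M : R, forall z w, oball z -> oball w ->
  cabs (F z - F w) <= M * enorm (z - w) `^ beta.
Proof.
move=> K0; exists (4 * K / (1 - th) + 4 * K) => z w bz bw.
have [zw|zw] := eqVneq (enorm (z - w)) 0.
  have /eqP := enorm_eq0 zw; rewrite subr_eq0 => /eqP ->; rewrite subrr cabs0.
  by rewrite mulr_ge0 ?powR_ge0// addr_ge0 ?divr_ge0 ?mulr_ge0// subr_ge0 ltW.
set h := enorm (z - w) in zw *.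
have h0 : 0 < h by rewrite lt0r zw enorm_ge0.
have h2 : h < 2.
  have := ler_enormD z (- w); rewrite enormN -/h; move: bz bw; rewrite /oball /=; lra.
pose r := h / 2; have r0 : 0 < r by rewrite divr_gt0.
have r1 : r <= 1 by rewrite /r ler_pdivrMr// mul1r ltW.
have c0 : 0 <= 1 - r by rewrite subr_ge0.
have rh : r `^ beta <= h `^ beta.
  by apply: ge0_ler_powR; rewrite ?nnegrE ?(ltW beta_gt0) ?(ltW r0) ?(ltW h0)// /r; lra.
have hz := radial_bound K0 bz r0 r1; have hw := radial_bound K0 bw r0 r1.
have hm : cabs (F (mkC (1 - r) 0 *: w) - F (mkC (1 - r) 0 *: z)) <= 2 * K * 2 * r `^ beta.
  have -> : mkC (1 - r) 0 *: w = mkC (1 - r) 0 *: z + mkC (1 - r) 0 *: (w - z).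
    by rewrite -scalerDr (addrC z) subrK.
  apply: gradient_segment => //.
    rewrite enormZ cabs_mkC ger0_norm// enorm_distC -/h.
    have -> : 2 * r = h by rewrite /r; field.
    by rewrite ler_piMl ?(ltW h0)//; lra.
  move=> s /andP[s0 s1].
  have -> : mkC (1 - r) 0 *: z + mkC s 0 *: (mkC (1 - r) 0 *: (w - z)) =
      mkC (1 - r) 0 *: (mkC (1 - s) 0 *: z + mkC s 0 *: w).
    have -> : mkC (1 - s) 0 = 1 - mkC s 0 :> C by apply: cext; rewrite !cE ?subr0.
    move: (mkC (1 - r) 0) (mkC s 0) => a b; apply/rowP => j; rewrite !mxE; ring.
  rewrite enormZ cabs_mkC ger0_norm// ler_piMr//.
  apply: le_trans (ler_enormD _ _) _; rewrite !enormZ !cabs_mkC !ger0_norm ?subr_ge0//.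
  have a1 : (1 - s) * enorm z <= 1 - s by rewrite ler_piMr ?subr_ge0// ltW.
  have a2 : s * enorm w <= s by rewrite ler_piMr// ltW.
  by lra.
have t0 : 0 < 1 - th by rewrite subr_gt0.
have -> : F z - F w = (F z - F (mkC (1 - r) 0 *: z)) - (F w - F (mkC (1 - r) 0 *: w)) -
  (F (mkC (1 - r) 0 *: w) - F (mkC (1 - r) 0 *: z)) by ring.
apply: (@le_trans _ _ ((4 * K / (1 - th) + 4 * K) * r `^ beta)); last first.
  by rewrite ler_wpM2l// addr_ge0 ?divr_ge0 ?mulr_ge0// ltW.
have := ler_cabsD (F z - F (mkC (1 - r) 0 *: z)) (- (F w - F (mkC (1 - r) 0 *: w))).
rewrite cabsN; have := ler_cabsD (F z - F (mkC (1 - r) 0 *: z) - (F w - F (mkC (1 - r) 0 *: w)))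
  (- (F (mkC (1 - r) 0 *: w) - F (mkC (1 - r) 0 *: z))).
rewrite cabsN.
have -> : (4 * K / (1 - th) + 4 * K) * r `^ beta = 2 * K * r `^ beta / (1 - th) +
  2 * K * r `^ beta / (1 - th) + 2 * K * 2 * r `^ beta by ring.
move: hz hw hm; lra.
Qed.

End HardyLittlewood.

(** * Membership of the extension in the holomorphic Lipschitz space *)

Section ExtensionLipschitz.
Context {R : realType} {n : nat}.
Local Notation C := (Cplx R).
Local Notation V := (Cn R n).
Local Notation B := (borelCn R n).
Variables (E : set V) (upsilon : R) (mu : probability B R).
Variables (e : V -> 'M[C]_(n, n.+1)) (alpha q : R) (near_pt : V -> V).
Hypothesis Eclosed : closed E.
Hypothesis hES : E `<=` sphere.
Hypothesis hU : upper_class upsilon E mu.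
Hypothesis hD : doubling E mu.
Hypothesis alpha_gt0 : 0 < alpha.
Hypothesis he : tangent_frame E e.
Hypothesis hq_gt : alpha + upsilon < q.
Hypothesis hnear : forall z, (cball `\` E) z ->
  E (near_pt z) /\ dist z (near_pt z) = dist_set z E.
Hypothesis hlow : exists2 c : R, 0 < c & forall z, (cball `\` E) z ->
  c * dist_set z E `^ (- q)
    * fine (mu (dball (near_pt z) (3 * dist_set z E))) <= cabs (hq E mu q z).
Hypothesis halphaN : forall p : nat, 2 * alpha != p%:R.
Variable f : multiindex n -> V -> C.
Hypothesis hf : A_jet e alpha f E.
Implicit Types (z w v u : V).
Local Notation T := (taylor e alpha).
Local Notation ext := (extension E mu q e alpha f).

Let mE : measurable (E : set B). Proof. exact: borel_closed. Qed.
Let E0 : E !=set0. Proof. exact: E_nonempty hU. Qed.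

Lemma oball_off z : oball z -> (cball `\` E) z.
Proof.
by rewrite /oball /= => bz; split; [exact: ltW|move=> /hES /= zs; move: bz; rewrite zs ltxx].
Qed.

Lemma holo_at_taylor z0 z : holo_at (T f z0) z.
Proof.
apply: (@holo_at_eq _ _ (fun w => \sum_(j <- jet_indices (n := n) alpha)
  (mfact j)%:R^-1 * f j z0 * wmonomial e j z0 w)).
  by apply: filterE => w; rewrite taylorE.
apply: holo_at_sum => j; apply: holo_atM; first exact: holo_at_cst.
apply: holo_at_prod => i; apply: holo_at_exp.
apply: holo_at_eq (holo_atD (holo_at_hdot (fvec e z0 i) z) (holo_at_cst (- hdot z0 (fvec e z0 i)) z)).
by apply: filterE => w; rewrite /wcoord hdotBl.
Qed.

Lemma holo_at_wkernel zeta z : Re_away E z -> E zeta -> holo_at (wkernel q zeta) z.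
Proof.
move=> hz Ez; apply: holo_at_cpow; last 1 first.
- apply: holo_at_eq (holo_atD (holo_at_cst 1 z) (holo_atM (holo_at_cst (-1) z) (holo_at_hdot zeta z))).
  by apply: filterE => w; rewrite mulN1r.
- have [c c0 h] := Re_away_loc hES hz; exists c => //.
  by apply: filterS h => w h _ _; exact: h.
- exact: Re_away_gt0 hz Ez.
Qed.

Lemma holo_at_extension z : oball z -> holo_at ext z.
Proof.
move=> /oball_off hz.
have hfar := far_near hES hnear hz.
have hR := far_Re_away hES hfar.
have iK := integrable_family_kern_cpow hES (- q) hR.
have iT := integrable_familyM (integrable_family_taylor hES he E0 z hf) iK.
apply: (@holo_at_eq _ _ (fun w => (hq E mu q w)^-1 *
  cintegral mu (E : set B) (fun zeta => T f zeta w * wkernel q zeta w))).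
  apply: filterS (Re_away_near hES hR) => w hw; rewrite /extension /average.
  by congr (_ * _); apply: eq_cintegral => zeta Ez; rewrite (wkernelE _ _ hw Ez).
apply: holo_atM.
  apply: holo_atV; first exact: (hq_neq0 Eclosed hES hU hD hnear hlow hfar).
  by apply: (holo_at_integral mu mE iK) => zeta Ez; exact: holo_at_wkernel.
apply: (holo_at_integral mu mE iT) => zeta Ez.
by apply: holo_atM; [exact: holo_at_taylor|exact: holo_at_wkernel].
Qed.

(** One more derivative has weight k+1 > alpha and is O(d(z, E)^(alpha - k - 1)). This exponent is
    negative and d(z, E) >= 1 - |z|, which is the gradient bound of [hardy_littlewood] with beta =
    alpha - k. *)
Lemma rderives_holder s k : k%:R < alpha < k.+1%:R -> size s = k -> exists M : R,
  forall z w, oball z -> oball w ->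
    cabs (rderives s ext z - rderives s ext w) <= M * enorm (z - w) `^ (alpha - k%:R).
Proof.
move=> /andP[ka ak] sk.
have k1 : k.+1%:R = k%:R + 1 :> R by rewrite -natr1.
have hb v : exists c : R, 0 <= c /\ forall z, oball z ->
    cabs (rderive v (rderives s ext) z) <= c * (1 - enorm z) `^ (alpha - k%:R - 1).
  have [|c c0 hc] := extension_high Eclosed hES hU hD alpha_gt0 he hq_gt hnear hlow
    (L := map (@dir_wop R n) (v :: s)).
    by rewrite wts_dir /= sk ltW.
  have N0 : 0 <= jnorm E e alpha f by exact: jnorm_ge0.
  exists (c * jnorm E e alpha f); split; first exact: mulr_ge0.
  move=> z bz; have hz := oball_off bz.
  have := hc f z hf hz; rewrite -rderivesE wts_dir /= sk k1 opprD addrA => /le_trans; apply.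
  rewrite ler_wpM2l ?mulr_ge0//.
  have [Ez0 hd] := hnear hz; have p : 0 < 1 - enorm z by rewrite subr_gt0.
  have le : 1 - enorm z <= dist_set z E.
    by rewrite -hd; apply: dist_ge_norm hz.1 _; apply: sphere_cball; exact: hES.
  have b1 : 0 <= 1 - (alpha - k%:R) by move: ak; rewrite k1; lra.
  rewrite -[alpha - k%:R - 1]opprB !powRN lef_pV2 ?posrE ?powR_gt0 ?(lt_le_trans p le)//.
  have p' := lt_le_trans p le.
  by apply: (ge0_ler_powR b1) le; rewrite nnegrE ltW.
have [c hc] := @choice 'I_n.+1 R (fun j c => 0 <= c /\ forall z, oball z ->
  cabs (rderive (ebase j) (rderives s ext) z) <= c * (1 - enorm z) `^ (alpha - k%:R - 1))
  (fun j => hb (ebase j)).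
have [d hd] := @choice 'I_n.+1 R (fun j c => 0 <= c /\ forall z, oball z ->
  cabs (rderive ('i *: (ebase j : V)) (rderives s ext) z) <= c * (1 - enorm z) `^ (alpha - k%:R - 1))
  (fun j => hb ('i *: (ebase j : V))).
pose S : R := \sum_j (c j + d j).
have cdS j : c j <= S /\ d j <= S.
  have : c j + d j <= S.
    rewrite /S (bigD1 j)//= lerDl; apply: sumr_ge0 => i _.
    by rewrite addr_ge0 ?(hc i).1 ?(hd i).1.
  by have := (hc j).1; have := (hd j).1; split; lra.
have S0 : 0 <= S by apply: sumr_ge0 => i _; rewrite addr_ge0 ?(hc i).1 ?(hd i).1.
have hs z : oball z -> smooth_at z (rderives s ext).
  move=> bz; rewrite rderivesE; apply: smooth_at_wapplys; first exact: ltW.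
  exact: (holo_at_extension bz).1.
apply: (@hardy_littlewood _ _ _ (2 * n.+1%:R * S)) => //.
- by rewrite subr_gt0.
- by move: ak; rewrite k1; lra.
- move=> z v bz; rewrite (is_rderive_val (smooth_at_rgrad v (hs z bz))).
  have p (x : R) : x <= S -> x * (1 - enorm z) `^ (alpha - k%:R - 1) <= S * (1 - enorm z) `^ (alpha - k%:R - 1).
    by move=> xS; rewrite ler_wpM2r ?powR_ge0.
  have := @cabs_rgrad_le _ _ (rderives s ext) v z (S * (1 - enorm z) `^ (alpha - k%:R - 1)).
  have -> : 2 * n.+1%:R * (S * (1 - enorm z) `^ (alpha - k%:R - 1)) * enorm v =
    2 * n.+1%:R * S * enorm v * (1 - enorm z) `^ (alpha - k%:R - 1) by ring.
  apply => j; first by apply: le_trans ((hc j).2 z bz) (p _ (cdS j).1).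
  by apply: le_trans ((hd j).2 z bz) (p _ (cdS j).2).
- by rewrite !mulr_ge0.
Qed.

Lemma extension_A_ball : A_ball alpha ext.
Proof.
split=> [z bz|].
  apply: holo_at_differentiable; apply: filterS (open_near (@oball_open R n) bz) => w.
  exact: holo_at_extension.
have /andP[ka ak] := truncn_itv (ltW alpha_gt0).
(* An integer alpha would make 2 alpha a natural number. *)
have kN : (Num.truncn alpha)%:R != alpha.
  apply/eqP => h; have := halphaN (2 * Num.truncn alpha); rewrite natrM h eqxx//.
have kI : (Num.truncn alpha)%:R < alpha < (Num.truncn alpha).+1%:R.
  by rewrite ak andbT lt_neqAle kN.
exists (Num.truncn alpha); split => //.
- apply: smooth_at_on => z bz; exact: (holo_at_extension bz).1.
- move=> s sk; have [|c c0 hc] := extension_low Eclosed hES hU hD alpha_gt0 he hq_gt hnear hlow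
    (L := map (@dir_wop R n) s).
    rewrite wts_dir; apply: le_lt_trans (_ : _ <= (Num.truncn alpha)%:R) _; first by rewrite ler_nat.
    by case/andP: kI.
  exists (c * jnorm E e alpha f) => z bz; rewrite rderivesE.
  exact: hc hf (oball_off bz).
- by move=> s sk; exact: rderives_holder.
Qed.

End ExtensionLipschitz.

Theorem theorem7 (R : realType) (n : nat)
  (E : set (Cn R n)) (hEclosed : closed E) (hES : E `<=` sphere)
  (upsilon lambda : R)
  (hupsilon : (upper_dim E <= upsilon%:E)%E)
  (hlambda : (lambda%:E <= lower_dim E)%E)
  (mu : probability (borelCn R n) R)
  (hmuU : upper_class upsilon E mu) (hmuL : lower_class lambda E mu)
  (alpha : R) (halpha : 0 < alpha) (halphaN : forall p : nat, 2 * alpha != p%:R)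
  (e : Cn R n -> 'M[Cplx R]_(n, n.+1)) (he : tangent_frame E e)
  (q : R) (hq_gt : alpha + upsilon < q)
  (near_pt : Cn R n -> Cn R n)
  (hnear : forall z, (cball `\` E) z ->
     E (near_pt z) /\ dist z (near_pt z) = dist_set z E)
  (hlow : exists2 c : R, 0 < c & forall z, (cball `\` E) z ->
     c * dist_set z E `^ (- q)
       * fine (mu (dball (near_pt z) (3 * dist_set z E)))
     <= cabs (hq E mu q z)) :
  [/\ (forall f : multiindex n -> Cn R n -> Cplx R, A_jet e alpha f E ->
        exists U : set (Cn R n), [/\ open U, cball `\` E `<=` U &
          smooth_on U (extension E mu q e alpha f)]),
      (forall XX : seq (vfield R n), opweight XX < alpha ->
        exists c : R, forall f : multiindex n -> Cn R n -> Cplx R,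
          A_jet e alpha f E -> forall z, (cball `\` E) z ->
          cabs (opapply XX (extension E mu q e alpha f) z
                - extension_op E mu q e alpha f XX z)
          <= c * fine (jet_norm e alpha f E)
               * dist_set z E `^ (alpha - opweight XX)),
      (forall XX : seq (vfield R n), alpha < opweight XX ->
        exists c : R, forall f : multiindex n -> Cn R n -> Cplx R,
          A_jet e alpha f E -> forall z, (cball `\` E) z ->
          cabs (opapply XX (extension E mu q e alpha f) z)
          <= c * fine (jet_norm e alpha f E)
               * dist_set z E `^ (alpha - opweight XX)) &
      (forall f : multiindex n -> Cn R n -> Cplx R, A_jet e alpha f E ->
        A_ball alpha (extension E mu q e alpha f))].
Proof.
have hD := hmuL.1.
split=> [f hf|XX hXX|XX hXX|f hf].
(* The points of smoothness form an open set, as [smooth_family] holds on a whole neighbourhood. *)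
- exists [set z | smooth_at z (extension E mu q e alpha f)]; split.
  + exact: smooth_at_open.
  + by move=> z hz; exact: (smooth_at_extension hEclosed hES hmuU hD halpha he hq_gt hnear hlow).
  + exact: smooth_at_on.
(* Both terms of the difference are compared with X T_{z0} f at z, for z0 the chosen nearest point,
   and the two errors add up. *)
- have [c c0 hc] := extension_op_le hEclosed hES hmuU hD halpha he hq_gt hnear hlow hXX.
  have [d d0 hd] := wapplys_quotient_le hEclosed hES hmuU hD halpha he hq_gt hnear hlow
    (map (@vfield_wop R n) XX).
  exists (d + c) => f hf z hz.
  rewrite (opapplyE XX) (wapplys_extension hEclosed hES hmuU hD halpha he hq_gt hnear hlow)//.
  rewrite -opapplyE addrAC -opprB addrC mulrDl [leRHS]mulrDl.
  apply: le_trans (ler_cabsD _ _) _; rewrite cabsN lerD ?hc// opweightE; exact: hd.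
- have [|c c0 hc] := extension_high hEclosed hES hmuU hD halpha he hq_gt hnear hlow
    (L := map (@vfield_wop R n) XX).
    by rewrite -opweightE ltW.
  by exists c => f hf z hz; rewrite opapplyE opweightE; exact: hc.
- exact: (extension_A_ball hEclosed hES hmuU hD halpha he hq_gt hnear hlow halphaN hf).
Qed.
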